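(* Let $t\ge 1$, and let $F=\bigcup_{j=1}^t F_j$ be a forest (vertex-disjoint union) where $F_j$ is a caterpillar for $1\le j\le t$. Let $p>1$ be a real number. (a) Suppose that every $F_j$ is a regular caterpillar, with $F_j=C(s_j;\beta_j)$ where $s_j\ge 2$ and $\beta_j\ge 1$, for $1\le j\le t$. Let $s:=\sum_{j=1}^t s_j$. Then $\tau(F)=\sum_{j=1}^t\big(\lfloor\frac{s_j}{2}\rfloor\beta_j+\lceil\frac{s_j}{2}\rceil\big)$, and there exists $n_0=n_0(F,p)$ such that, if $G$ is an $F$-free graph on $n\ge n_0$ vertices with $e_p(G)=\mathrm{ex}_p(n,F)$, then - $G=L(n,s-1,0)$, if $\beta_j=1$ for all $j$; - $G=K_{\tau(F)-1,\,n-\tau(F)+1}$, if $\beta_{j_1}\ge 2$ and $s_{j_1}$ is even for some $j_1$; - $G=M_{\tau(F)-1}\vee E_{n-\tau(F)+1}$, if $\beta_j=1$ for every $j$ with $s_j\ne 3$, and $\beta_{j_1}\ge 2$, $s_{j_1}=3$ for some $j_1$; - $G=E^+_{\tau(F)-1}\vee E_{n-\tau(F)+1}$, if $\beta_j=1$ for every $j$ with $s_j$ even, and $\beta_{j_1}\ge 2$, $s_{j_1}\ge 5$ is odd for some $j_1$. (b) Suppose that every $F_j$ is a broom, a double star, or a double broom, with $F_j=C(s_j;\beta_j,\gamma_j)$ where $s_j\ge 2$ and $1\le\beta_j\le\gamma_j$, for $1\le j\le t$. Let $\beta:=\min_{1\le j\le t}\beta_j$. Then \[ \tau(F)=\sum_{j:\,s_j\text{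 even}}\Big(\frac{s_j}{2}+\beta_j\Big)+\sum_{j:\,s_j\text{ odd}}\Big\lceil\frac{s_j}{2}\Big\rceil, \] and there exists $n_0=n_0(F,p)$ such that, if $G$ is an $F$-free graph on $n\ge n_0$ vertices with $e_p(G)=\mathrm{ex}_p(n,F)$, then - $G=K_{\tau(F)-1,\,n-\tau(F)+1}$, if $\beta_{j_1}\ge 2$ and $s_{j_1}$ is even for some $j_1$; - $G=L(n,\tau(F)-1,0)$, if $\beta_j=1$ for every $j$ with $s_j$ even, and $s_{j_1}$ is even for some $j_1$; - $G\in\mathcal L(n,2t-1,\beta)$, if $s_j=3$ and $1\le\beta_j<\gamma_j$ for all $j$; - $G=L(n,\tau(F)-1,1)$, if $s_j\in\{3,5\}$ for all $j$, $1\le\beta_j<\gamma_j$ for every $j$ with $s_j=3$, $\beta_j\ge 2$ for every $j$ with $s_j=5$, and $s_{j_1}=5$ for some $j_1$; - $G=E(n,\tau(F)-1)$, if $s_j$ is odd for all $j$, and for some $j_1$ at least one of the following holds: $\beta_{j_1}=\gamma_{j_1}=1$ and $s_{j_1}=3$; or $\beta_{j_1}=1$ and $s_{j_1}=5$; or $s_{j_1}\ge 7$. Moreover, in the case that $s_j=3$ and $1\le\beta_j<\gamma_j$ for all $j$, every graph of $\mathcal L(n,2t-1,\beta)$ (with $n\ge n_0$) is an extremal graph for $\mathrm{ex}_p(n,F)$.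
   Context: All graphs are finite, simple and undirected; equality of graphs is up to isomorphism. A graph is $F$-free if it does not contain $F$ as a (not necessarily induced) subgraph. For real $p>0$, $e_p(G)=\sum_{v\in V(G)}d_G(v)^p$ (with $0^p=0$), and $\mathrm{ex}_p(n,F)$ is the maximum of $e_p(G)$ over all $F$-free graphs $G$ on $n$ vertices; an extremal graph is an $F$-free graph on $n$ vertices attaining this maximum. For a bipartite graph $F$, $\tau(F)$ is the minimum size of an independent set of vertices meeting every edge of $F$. Caterpillars: for $s\ge1$ and $\alpha_1,\dots,\alpha_s\ge 0$, the caterpillar $C(\alpha_1,\dots,\alpha_s)$ is formed from a path $v_1v_2\cdots v_s$ (its spine) by attaching $\alpha_i$ pendant edges to $v_i$ for each $i$. $C(s;\beta)$ is the regular caterpillar with $\alpha_1=\cdots=\alpha_s=\beta$. $C(s;\beta,\gamma)$ is the caterpillar with spine on $s\ge2$ vertices, $\alpha_1=\beta$, $\alpha_s=\gamma$ and $\alpha_i=0$ for $2\le i\le s-1$ (a double broom; a double star if $s=2$; it is a broom, i.e. a path with pendant edges added at one end-vertex, if $\beta=1$). Graphs: $K_{a,b}$ is the complete bipartite graph with classes of sizes $a,b$. $E_m$ is the empty (edgeless) graph on $m$ vertices; $E_m^+$ is the graph on $m$ vertices with exactly one edge; $M_m$ is a maximum matching on $m$ vertices (i.e. $\lfloor m/2\rfloor$ disjoint edges, plus an isolated vertex if $m$ is odd). The join $G\vee H$ is obtained from vertex-disjoint copies of $G$ and $H$ by adding all edges between them. A graph $L$ on $m$ vertices is near $\ell$-regular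 if it is $\ell$-regular when $\ell m$ is even, and otherwise has $m-1$ vertices of degree $\ell$ and one vertex of degree $\ell-1$. $\mathcal L(n,q,\ell)$ is the family of all graphs $K_q\vee L$ with $L$ a near $\ell$-regular graph on $n-q$ vertices. For $\ell\in\{0,1\}$, $L(n,q,\ell)$ is the unique member of $\mathcal L(n,q,\ell)$; thus $L(n,q,0)=K_q\vee E_{n-q}$ and $L(n,q,1)=K_q\vee M_{n-q}$. $E(n,q)=K_q\vee E^+_{n-q}$. *)

(* Defs.v *)
From HB Require Import structures.
From mathcomp Require Import all_boot all_order all_algebra.
From mathcomp Require Import reals exp.

Set Implicit Arguments.
Unset Strict Implicit.
Unset Printing Implicit Defensive.

Import Order.TTheory GRing.Theory Num.Theory.

Definition is_graph (T : finType) (E : {set T * T}) : bool :=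
  [forall x, (x, x) \notin E]
  && [forall x, forall y, ((x, y) \in E) == ((y, x) \in E)].

(* A simple graph with vertex type T, given by its set of ordered pairs of
   adjacent vertices; for fixed T such graphs form a finite type. *)
Record sgraph (T : finType) : Type :=
  SGraph { edges : {set T * T}; edgesP : is_graph edges }.

HB.instance Definition _ (T : finType) := [isSub for @edges T].
HB.instance Definition _ (T : finType) := [Finite of sgraph T by <:].

Definition adj (T : finType) (G : sgraph T) : rel T :=
  fun x y => (x, y) \in edges G.

Lemma adj_irrefl (T : finType) (G : sgraph T) : irreflexive (adj G).
Proof.
by have /andP[/forallP irrG _] := edgesP G; move=> x; apply/negbTE/irrG.
Qed.

Lemma adj_sym (T : finType) (G : sgraph T) : symmetric (adj G).
Proof.
have /andP[_ /forallP symG] := edgesP G.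
by move=> x y; have /forallP/(_ y)/eqP := symG x.
Qed.

(* The graph obtained from an arbitrary relation by symmetrizing it and
   dropping loops. *)
Definition edges_of_rel (T : finType) (r : rel T) : {set T * T} :=
  [set u | (u.1 != u.2) && (r u.1 u.2 || r u.2 u.1)].

Lemma edges_of_relP (T : finType) (r : rel T) : is_graph (edges_of_rel r).
Proof.
apply/andP; split; first by apply/forallP => x; rewrite inE eqxx.
apply/forallP => x; apply/forallP => y; apply/eqP.
by rewrite !inE /= [y == x]eq_sym orbC.
Qed.

Definition graph_of_rel (T : finType) (r : rel T) : sgraph T :=
  SGraph (edges_of_relP r).

Lemma adj_graph_of_rel (T : finType) (r : rel T) x y :
  adj (graph_of_rel r) x y = (x != y) && (r x y || r y x).
Proof. by rewrite /adj inE. Qed.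

Definition deg (T : finType) (G : sgraph T) (v : T) : nat := #|adj G v|.

Definition graph_iso (T U : finType) (G : sgraph T) (H : sgraph U) : Prop :=
  exists2 f : T -> U, bijective f & forall x y, adj H (f x) (f y) = adj G x y.

Definition contains (T U : finType) (F : sgraph T) (G : sgraph U) : bool :=
  [exists f : {ffun T -> U},
     injectiveb f && [forall x, forall y, adj F x y ==> adj G (f x) (f y)]].

Definition subgraph_free (T U : finType) (F : sgraph T) (G : sgraph U)
    : bool :=
  ~~ contains F G.

(* powR satisfies 0 `^ p = 0 for p <> 0. *)
Definition e_ (R : realType) (p : R) (T : finType) (G : sgraph T) : R :=
  (\sum_(v : T) (deg G v)%:R `^ p)%R.

(* All values e_ p G are nonnegative, so the default 0 is harmless. *)
Definition ex_ (R : realType) (p : R) (n : nat) (T : finType) (F : sgraph T)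
    : R :=
  (\big[Num.max/0]_(G : sgraph 'I_n | subgraph_free F G) e_ p G)%R.

Definition extremal (R : realType) (p : R) (n : nat) (T : finType)
    (F : sgraph T) (G : sgraph 'I_n) : Prop :=
  subgraph_free F G /\ e_ p G = ex_ p n F.

Definition independent_set (T : finType) (G : sgraph T) (S : {set T}) : bool :=
  [forall x in S, forall y in S, ~~ adj G x y].

Definition edge_cover (T : finType) (G : sgraph T) (S : {set T}) : bool :=
  [forall x, forall y, adj G x y ==> (x \in S) || (y \in S)].

(* For a bipartite graph an independent set meeting every edge exists, and then
   the default #|T| does not affect the minimum. *)
Definition tau (T : finType) (F : sgraph T) : nat :=
  \big[minn/#|T|]_(S : {set T} | independent_set F S && edge_cover F S) #|S|.

Definition disjoint_union (I : finType) (V : I -> finType)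
    (G : forall i, sgraph (V i)) : sgraph {i : I & V i} :=
  graph_of_rel (fun x y : {i : I & V i} =>
    (tag x == tag y) && adj (G (tag x)) (tagged x) (tagged_as x y)).

Definition graph_join (T U : finType) (G : sgraph T) (H : sgraph U)
    : sgraph (T + U)%type :=
  graph_of_rel (fun x y : T + U =>
    match x, y with
    | inl a, inl b => adj G a b
    | inr a, inr b => adj H a b
    | _, _ => true
    end).

(* The spine vertex v_(i+1) is inl i, and the pendant vertices attached to it
   are the inr (existT _ i k) with k < alpha i. *)
Definition caterpillar (s : nat) (alpha : 'I_s -> nat)
    : sgraph ('I_s + {i : 'I_s & 'I_(alpha i)})%type :=
  graph_of_rel (fun x y : 'I_s + {i : 'I_s & 'I_(alpha i)} =>
    match x, y with
    | inl i, inl j => j == i.+1 :> nat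
    | inl i, inr l => tag l == i
    | _, _ => false
    end).

Definition regular_caterpillar (s beta : nat) :=
  caterpillar (fun _ : 'I_s => beta).

Definition double_broom (s beta gamma : nat) :=
  caterpillar (fun i : 'I_s =>
    if i == 0 :> nat then beta else if i == s.-1 :> nat then gamma else 0).

Definition complete_bipartite (a b : nat) : sgraph ('I_a + 'I_b)%type :=
  graph_of_rel (fun x y : 'I_a + 'I_b =>
    match x, y with inl _, inr _ => true | _, _ => false end).

Definition complete_graph (m : nat) : sgraph 'I_m :=
  graph_of_rel (fun _ _ => true).

Definition empty_graph (m : nat) : sgraph 'I_m :=
  graph_of_rel (fun _ _ => false).

(* Meaningful for 2 <= m. *)
Definition one_edge (m : nat) : sgraph 'I_m :=
  graph_of_rel (fun i j : 'I_m => (i == 0 :> nat) && (j == 1 :> nat)).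

(* The edges are the pairs {2k, 2k+1}. *)
Definition max_matching (m : nat) : sgraph 'I_m :=
  graph_of_rel (fun i j : 'I_m => i./2 == j./2).

Definition near_regular (l m : nat) (L : sgraph 'I_m) : Prop :=
  if odd (l * m) then
    exists v, deg L v = l.-1 /\ forall u, u != v -> deg L u = l
  else forall u, deg L u = l.

Definition in_familyL (n q l : nat) (T : finType) (G : sgraph T) : Prop :=
  exists2 L : sgraph 'I_(n - q),
    near_regular l L & graph_iso G (graph_join (complete_graph q) L).

(* graphL0 n q and graphL1 n q are, up to isomorphism, the unique members of
   the family in_familyL n q l for l = 0 and l = 1. *)
Definition graphL0 (n q : nat) :=
  graph_join (complete_graph q) (empty_graph (n - q)).

Definition graphL1 (n q : nat) :=
  graph_join (complete_graph q) (max_matching (n - q)).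

Definition graphE (n q : nat) :=
  graph_join (complete_graph q) (one_edge (n - q)).

(* The minimum of f for 0 < t; the default is at least every value of f. *)
Definition min_over (t : nat) (f : 'I_t -> nat) : nat :=
  \big[minn / \max_(j < t) f j]_(j < t) f j.

(* Main.v *)
Require Import Defs.
From HB Require Import structures.
From mathcomp Require Import all_boot all_order all_algebra.
From mathcomp Require Import reals exp.
From mathcomp Require Import zify ring lra.

Set Implicit Arguments.
Unset Strict Implicit.
Unset Printing Implicit Defensive.

Import Order.TTheory GRing.Theory Num.Theory.

(* Let q = tau(F) - 1.  An F-free graph G has O(n) edges because F is a forest,
   and every set of q + 1 vertices has O(1) common neighbours because F embeds in
   K_{q+1,|F|}.  Hence the vertices of linear degree have total degree at most
   q n + O(1), and by convexity of x^p an extremal G, which beats K_{q,n-q}, has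
   exactly q vertices of degree close to n; let A be their set.  If some vertices
   outside A miss part of A, then detaching them from the complement of A and
   joining them to A keeps the graph F-free and raises e_p, since degrees outside A
   are a small multiple of n.  So A is completely joined to its complement, and
   what remains is to decide which edges inside A or inside the complement can be
   tolerated.  A 2-colouring of one component with fewer than its share of
   tau(F) vertices on the A-side, whose monochromatic edges are already in G,
   embeds F; conversely a copy of F in the target graph leaves on A a trace that is
   too large.  When all components are C(3;beta_j,gamma_j) with beta_j < gamma_j,
   two defects of degree outside A could be repaired by deleting a remote edge xy
   and adding ux and vy. *)

(** * Embeddings with prescribed parts, and sparsity of forest-free graphs *)

(** In the detaching step gain and loss both carry the factor n^(p-1): a new edge at a vertex of A
    is worth at least (n/2)^(p-1), while an edge lost outside A costs at most a constant times (z
    n)^(p-1), where z n bounds the degrees there. The number of edges lost per detached vertex is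
    bounded independently of z, so z can be chosen small enough for the gain to win. Values of e_p
    are not compared between candidate graphs. Forbidding the bad edges makes G a spanning subgraph
    of the target; the target is F-free, and strict monotonicity of e_p in the degrees turns this
    inclusion into an isomorphism. The near-regular family offers no single target, hence the
    separate exchange argument: there freeness follows from a degree bound outside A alone, so every
    exchange that respects the bound is allowed. Conversely all members of the family are extremal
    because some extremal graph exists, lies in the family, and has the same degree sequence as
    every other member. *)

Definition injhom (T U : finType) (F : sgraph T) (G : sgraph U) (f : T -> U) :=
  injective f /\ forall x y, adj F x y -> adj G (f x) (f y).

Lemma containsP (T U : finType) (F : sgraph T) (G : sgraph U) :
  reflect (exists f, injhom F G f) (contains F G).
Proof.
apply: (iffP existsP) => [[f /andP[/injectiveP injf homf]]|[f [injf homf]]].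
  exists f; split=> // x y Fxy.
  by have /forallP/(_ y)/implyP := forallP homf x; apply.
exists (finfun f); apply/andP; split.
  by apply/injectiveP => x y; rewrite !ffunE => /injf.
by apply/forallP => x; apply/forallP => y; apply/implyP; rewrite !ffunE => /homf.
Qed.

Lemma contains_trans (T U W : finType) (F : sgraph T) (G : sgraph U)
    (H : sgraph W) : contains F G -> contains G H -> contains F H.
Proof.
move=> /containsP[f [injf homf]] /containsP[g [injg homg]]; apply/containsP.
by exists (g \o f); split=> [|x y /homf /homg //]; apply: inj_comp.
Qed.

Lemma in_adj (T : finType) (G : sgraph T) x y : (y \in adj G x) = adj G x y.
Proof. by []. Qed.

Section Degrees.
Variables (T : finType) (G : sgraph T).

Definition degin (U : {set T}) (v : T) : nat := \sum_(w in U) adj G v w.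

Lemma degE v : deg G v = \sum_w adj G v w.
Proof. by rewrite /deg -sum1_card big_mkcond. Qed.

Lemma deginE U v : degin U v = #|[set w in U | adj G v w]|.
Proof.
rewrite /degin -sum1_card big_mkcond [RHS]big_mkcond /=.
by apply: eq_bigr => w _; rewrite inE; case: (w \in U).
Qed.

Lemma degin_le U v : degin U v <= #|U|.
Proof.
rewrite deginE; apply: subset_leq_card; apply/subsetP => w.
by rewrite inE => /andP[].
Qed.

Lemma sum_degin (X Y : {set T}) :
  \sum_(v in X) degin Y v = \sum_(w in Y) degin X w.
Proof.
rewrite /degin exchange_big /=; apply: eq_bigr => w _; apply: eq_bigr => v _.
by rewrite adj_sym.
Qed.

Lemma deg_setC (U : {set T}) v : deg G v = degin U v + degin (~: U) v.
Proof.
rewrite degE (bigID (mem U)) /=; congr addn.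
by apply: eq_bigl => w; rewrite inE.
Qed.

End Degrees.

Lemma injective_placement (T V : finType) (X : {set T}) (Y : {set V}) (v0 : V) :
  #|X| <= #|Y| ->
  exists g : T -> V, {in X &, injective g} /\ {in X, forall x, g x \in Y}.
Proof.
move=> leXY; exists (fun x => nth v0 (enum Y) (index x (enum X))).
have ltY x : x \in X -> index x (enum X) < size (enum Y).
  move=> Xx; rewrite -(cardE (mem Y)); apply: leq_trans leXY.
  by rewrite (cardE (mem X)) index_mem mem_enum.
split=> [x y Xx Xy /eqP|x Xx]; last by rewrite -mem_enum mem_nth ?ltY.
rewrite nth_uniq ?ltY ?enum_uniq // => /eqP eqi.
rewrite -(nth_index x (s := enum X) (x := x)) ?mem_enum // eqi.
by rewrite nth_index ?mem_enum.
Qed.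

(* [P] is the part of [F] to be sent into [A]; the rest goes to [B].  Images are
   prescribed where [f] is defined, which must include the edges inside a part. *)
Definition placeable (T V : finType) (F : sgraph T) (G : sgraph V)
    (A B : {set V}) (P : {set T}) (f : T -> option V) :=
  [/\ forall x v, f x = Some v -> if x \in P then v \in A else v \in B,
      forall x y v, f x = Some v -> f y = Some v -> x = y &
      forall x y, adj F x y -> (x \in P) = (y \in P) ->
        exists u v, [/\ f x = Some u, f y = Some v & adj G u v]].

Lemma placeable_contains (T V : finType) (F : sgraph T) (G : sgraph V)
    (A B : {set V}) (P : {set T}) (f : T -> option V) :
  (forall a b, a \in A -> b \in B -> adj G a b) ->
  #|P| <= #|A| -> #|T| <= #|B| -> placeable F G A B P f -> contains F G.
Proof.
move=> joinAB leP leT [fAB injf monof].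
have disjAB a : a \in A -> a \in B -> False.
  by move=> Aa Ba; have := joinAB a a Aa Ba; rewrite adj_irrefl.
have [T0|T_gt0] := posnP #|T|.
  have noT (x : T) : False by have := fintype0 x T0.
  by apply/containsP; exists (fun x => False_rect V (noT x)); split=> x.
have [v0 _] : exists v0, v0 \in B by apply/card_gt0P; apply: leq_trans leT.
pose h0 x := odflt v0 (f x).
pose D := [set x | f x != None].
have h0E x : x \in D -> f x = Some (h0 x).
  by rewrite inE /h0; case: (f x).
have injh0 : {in D &, injective h0}.
  move=> x y /h0E fx /h0E fy eqh; apply: (injf _ _ (h0 x)) => //.
  by rewrite eqh.
(* Once the prescribed images are removed, each side still has at least as many free vertices as
   there are vertices left to place there. *)
have room (Q : {set T}) (C : {set V}) : #|Q| <= #|C| ->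
    #|Q :\: D| <= #|C :\: h0 @: (Q :&: D)|.
  move=> leQC; have := cardsID D Q; have := cardsID (h0 @: (Q :&: D)) C.
  have := leq_imset_card h0 (Q :&: D).
  by have := subset_leq_card (subsetIr C (h0 @: (Q :&: D))); lia.
have [gA [injA gAin]] := injective_placement v0 (room _ _ leP).
have leCP : #|~: P| <= #|B| by apply: leq_trans leT; exact: max_card.
have [gB [injB gBin]] := injective_placement v0 (room _ _ leCP).
pose h x := if x \in D then h0 x else if x \in P then gA x else gB x.
have hin x : if x \in P then h x \in A else h x \in B.
  rewrite /h; case: (boolP (x \in D)) => [/h0E fx|Dx]; first exact: fAB fx.
  case: (boolP (x \in P)) => Px.
    by have := gAin x; rewrite in_setD Px Dx => /(_ isT) /setDP[].
  by have := gBin x; rewrite in_setD in_setC Px Dx => /(_ isT) /setDP[].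
have mixed x y : x \in P -> y \notin P -> adj G (h x) (h y).
  move=> Px Py; apply: joinAB; first by have := hin x; rewrite Px.
  by have := hin y; rewrite (negbTE Py).
have hcross x y : x \in D -> y \notin D -> h x != h y.
  move=> Dx Dy; have := hin x; have := hin y.
  case: (boolP (x \in P)) => Px; case: (boolP (y \in P)) => Py yin xin.
  - rewrite /h Dx (negbTE Dy) Py.
    have := gAin y; rewrite in_setD Py Dy => /(_ isT) /setDP[_].
    by apply: contra => /eqP <-; apply: imset_f; rewrite in_setI Px.
  - by apply/eqP => eqh; apply: (disjAB (h x)); rewrite // eqh.
  - by apply/eqP => eqh; apply: (disjAB (h y)); rewrite // -eqh.
  - rewrite /h Dx (negbTE Dy) (negbTE Py).
    have := gBin y; rewrite in_setD in_setC Py Dy => /(_ isT) /setDP[_].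
    by apply: contra => /eqP <-; apply: imset_f; rewrite in_setI in_setC Px.
apply/containsP; exists h; split=> [x y eqh|x y Fxy].
  case: (boolP (x \in D)) (boolP (y \in D)) => Dx [] Dy.
  - by apply: injh0 => //; move: eqh; rewrite /h Dx Dy.
  - by have /eqP := hcross x y Dx Dy.
  - by have /eqP := hcross y x Dy Dx; rewrite eqh.
  have := hin x; have := hin y.
  case: (boolP (x \in P)) => Px; case: (boolP (y \in P)) => Py yin xin.
  - apply: injA; rewrite ?in_setD ?Px ?Py ?Dx ?Dy //.
    by move: eqh; rewrite /h (negbTE Dx) (negbTE Dy) Px Py.
  - by case: (disjAB (h x)); rewrite // eqh.
  - by case: (disjAB (h y)); rewrite // -eqh.
  - apply: injB; rewrite ?in_setD ?in_setC ?Px ?Py ?Dx ?Dy //.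
    by move: eqh; rewrite /h (negbTE Dx) (negbTE Dy) (negbTE Px) (negbTE Py).
case: (boolP (x \in P)) => Px; case: (boolP (y \in P)) => Py.
- have [|u [v [fx fy Guv]]] := monof x y Fxy; first by rewrite Px Py.
  by rewrite /h !inE fx fy /= /h0 fx fy.
- exact: mixed.
- by rewrite adj_sym mixed.
- have [|u [v [fx fy Guv]]] := monof x y Fxy.
    by rewrite (negbTE Px) (negbTE Py).
  by rewrite /h !inE fx fy /= /h0 fx fy.
Qed.

(* Forests are exactly the graphs that admit such a ranking. *)
Definition forest_rank (T : finType) (F : sgraph T) (rk : T -> nat) :=
  (forall x y, adj F x y -> rk x != rk y) /\
  (forall x y z, adj F x y -> adj F x z -> rk y < rk x -> rk z < rk x -> y = z).

Lemma forest_embed (T V : finType) (F : sgraph T) (rk : T -> nat)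
    (G : sgraph V) (U : {set V}) (u0 : V) :
  forest_rank F rk -> u0 \in U -> {in U, forall u, #|T| <= degin G U u} ->
  contains F G.
Proof.
move=> [rkn rk1] Uu0 mindeg.
suff: forall m (D : {set T}), #|D| = m -> exists f : T -> V,
    [/\ {in D &, injective f}, {in D, forall x, f x \in U} &
        {in D &, forall x y, adj F x y -> adj G (f x) (f y)}].
  move=> /(_ _ setT erefl)[f [injf _ homf]]; apply/containsP; exists f.
  by split=> [x y|x y Fxy]; [apply: injf; rewrite inE | apply: homf; rewrite ?inE].
elim=> [|m IHm] D cardD.
  exists (fun _ => u0); move/eqP: cardD; rewrite cards_eq0 => /eqP->.
  by split=> x; rewrite ?inE // => y; rewrite inE.
have [x1 Dx1] : exists x1, x1 \in D by apply/card_gt0P; rewrite cardD.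
have [x + maxx] := @arg_maxnP _ x1 (mem D) rk Dx1; rewrite inE => Dx.
have [|f [injf fU homf]] := IHm (D :\ x).
  by have := cardsD1 x D; rewrite Dx cardD => -[].
(* The image of the only neighbour of [x] in [D]; if there is none, any vertex of [U] will do. *)
pose y' := if [pick y in D :\ x | adj F x y] is Some y then f y else u0.
have Uy' : y' \in U by rewrite /y'; case: pickP => // y /andP[/fU].
have ltcard : #|f @: (D :\ x)| < #|[set w in U | adj G y' w]|.
  rewrite -deginE; apply: leq_trans (mindeg _ Uy').
  apply: leq_ltn_trans (leq_imset_card _ _) _.
  by have := max_card (mem D); rewrite (cardsD1 x D) Dx.
have [w [/setIdP[Uw y'w] newf]] : exists w,
    w \in [set w in U | adj G y' w] /\ w \notin f @: (D :\ x).
  have /subsetPn[w Gw nw] : ~~ ([set w in U | adj G y' w] \subset f @: (D :\ x)).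
    by apply: contraL ltcard => /subset_leq_card; rewrite -leqNgt.
  by exists w.
have new z : z \in D -> z != x -> f z != w.
  move=> Dz zx; apply: contra newf => /eqP<-; apply: imset_f.
  by rewrite !inE zx.
have xnbr z : z \in D -> adj F x z -> adj G w (f z).
  move=> Dz Fxz; have zx : z != x by apply: contraL Fxz => /eqP->; rewrite adj_irrefl.
  have lower z' : z' \in D -> adj F x z' -> rk z' < rk x.
    move=> Dz' Fxz'; rewrite ltn_neqAle eq_sym rkn //=; exact: maxx.
  move: y'w; rewrite /y'; case: pickP => [y /andP[/setD1P[_ Dy] Fxy]|/(_ z)].
    by rewrite (rk1 x z y) ?lower // adj_sym.
  by rewrite !inE zx Dz Fxz.
exists (fun z => if z == x then w else f z); split.
- move=> a b Da Db; case: eqP => [->|/eqP ax]; case: eqP => [->|/eqP bx] //.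
  + by move/esym/eqP; rewrite (negbTE (new b Db bx)).
  + by move/eqP; rewrite (negbTE (new a Da ax)).
  + by apply: injf; rewrite !inE ?ax ?bx.
- move=> a Da; case: eqP => // /eqP ax; apply: fU; rewrite !inE ax; exact: Da.
- move=> a b Da Db; case: eqP => [->|/eqP ax]; case: eqP => [->|/eqP bx].
  + by rewrite adj_irrefl.
  + exact: xnbr.
  + by rewrite adj_sym [adj G _ _]adj_sym; apply: xnbr.
  + by apply: homf; rewrite !inE ?ax ?bx.
Qed.

(** By [forest_embed] some vertex of [U] has fewer than |T| neighbours in [U]; it is deleted and the
    rest follows by induction. *)
Lemma forest_free_sparse (T V : finType) (F : sgraph T) (rk : T -> nat)
    (G : sgraph V) (U : {set V}) :
  forest_rank F rk -> subgraph_free F G ->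
  \sum_(u in U) degin G U u <= (2 * #|T|) * #|U|.
Proof.
move=> rkF freeG; move: {2}#|U| (erefl #|U|) => m; elim: m U => [|m IHm] U cardU.
  by move/eqP: cardU; rewrite cards_eq0 => /eqP->; rewrite big_set0.
have [u0 Uu0] : exists u0, u0 \in U by apply/card_gt0P; rewrite cardU.
have /exists_inP[u Uu degu] : [exists u in U, degin G U u < #|T|].
  apply: contraNT freeG => /exists_inPn noU.
  apply: (forest_embed rkF Uu0) => u Uu.
  by have := noU u Uu; rewrite -leqNgt.
have cardU' : #|U :\ u| = m by have := cardsD1 u U; rewrite Uu cardU => -[].
have := IHm (U :\ u) cardU'; rewrite (big_setD1 u Uu) /= => IH.
(* Deleting [u] lowers the sum by its own degree and by one at each of its neighbours in [U]. *)
have -> : \sum_(i in U :\ u) degin G U i =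
    \sum_(i in U :\ u) degin G (U :\ u) i + degin G (U :\ u) u.
  rewrite {2}/degin -big_split /=; apply: eq_bigr => i _.
  by rewrite {1}/degin (big_setD1 u Uu) /= addnC adj_sym.
have : degin G (U :\ u) u <= degin G U u.
  by rewrite [in leqRHS]/degin (big_setD1 u Uu) /= leq_addl.
move=> le_deg; rewrite cardU mulnS; rewrite cardU' in IH.
move: IH le_deg degu; move: (\sum_(i in _) _) (degin G U u) (degin G _ u).
move: (2 * #|T| * m)=> a; move: #|T| => b. lia.
Qed.

(** Otherwise [S] fits into [Y] and the rest of [F] into [Z]; no edge of [F] stays inside a part, so
    nothing has to be prescribed. *)
Lemma common_nbrs_bound (T V : finType) (F : sgraph T) (G : sgraph V)
    (S : {set T}) (Y Z : {set V}) :
  independent_set F S -> edge_cover F S -> subgraph_free F G ->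
  #|S| <= #|Y| -> (forall y z, y \in Y -> z \in Z -> adj G y z) -> #|Z| < #|T|.
Proof.
move=> indS covS freeG leY joinYZ; rewrite ltnNge; apply: contra freeG => leZ.
apply: (@placeable_contains _ _ _ _ _ _ S (fun _ => None) joinYZ leY leZ).
split=> // x y Fxy eqS; exfalso.
have := forallP (forallP covS x) y; rewrite Fxy /= -eqS orbb => Sx.
have /forall_inP/(_ y) := forall_inP indS x Sx.
by rewrite -eqS Sx Fxy => /(_ isT).
Qed.

(** * The join structure of extremal graphs *)

Section PowerInequalities.
Variables (R : realType) (p : R).
Hypothesis hp : (1 < p)%R.
Local Open Scope ring_scope.

Let p_gt0 : 0 < p. Proof. exact: lt_trans hp. Qed.
Let p1_ge0 : 0 <= p - 1. Proof. by rewrite subr_ge0 ltW. Qed.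
Let p1_gt0 : 0 < p - 1. Proof. by rewrite subr_gt0. Qed.

Lemma ler_powR2 (r x y : R) : 0 <= r -> 0 <= x -> x <= y -> x `^ r <= y `^ r.
Proof.
move=> r0 x0 lexy; apply: ge0_ler_powR; rewrite ?nnegrE //.
exact: le_trans lexy.
Qed.

(** The tangent bound with coefficient 1 in place of p: it needs only x^p = x x^(p-1) and
    monotonicity of x^(p-1). *)
Lemma powR_add_ge (x y : R) : 0 <= x -> 0 <= y ->
  x `^ p + y * x `^ (p - 1) <= (x + y) `^ p.
Proof.
move=> x0 y0; have xy0 := addr_ge0 x0 y0.
rewrite -(mulr_powRB1 x0 p_gt0) -(mulr_powRB1 xy0 p_gt0) -mulrDl.
by rewrite ler_wpM2l ?addr_ge0 // ler_powR2 // lerDl.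
Qed.

Lemma expr_bernoulli (r : R) m : 0 <= r <= 1 -> 1 - r ^+ m <= m%:R * (1 - r).
Proof.
move=> /andP[r0 r1]; elim: m => [|m IHm]; first by rewrite expr0 subrr mul0r.
have rm1 : r ^+ m <= 1 by apply: exprn_ile1.
have : r ^+ m * (1 - r) <= 1 - r by rewrite ler_piMl // subr_ge0.
rewrite exprS -natr1 mulrDl mul1r; lra.
Qed.

(** Replaces the mean value theorem, with an integer m >= p as coefficient: for r = y/x in [0,1], 1
    - r^p <= 1 - r^m <= m (1 - r). *)
Lemma powR_sub_le m (x y : R) : p <= m%:R -> 0 <= y -> y <= x ->
  x `^ p - y `^ p <= m%:R * (x - y) * x `^ (p - 1).
Proof.
move=> lepm y0 lexy; have x0 : 0 <= x by apply: le_trans lexy.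
have [xeq0|xN0] := eqVneq x 0.
  have -> : y = x by apply/eqP; rewrite eq_le lexy xeq0.
  by rewrite !subrr mulr0 mul0r.
have x_gt0 : 0 < x by rewrite lt_neqAle eq_sym xN0.
have [->|yN0] := eqVneq y 0.
  rewrite powR0 ?gt_eqF // !subr0 -mulrA mulr_powRB1 // ler_peMl ?powR_ge0 //.
  by apply: le_trans lepm; apply: ltW.
have y_gt0 : 0 < y by rewrite lt_neqAle eq_sym yN0.
pose r := y / x.
have r01 : 0 < r <= 1 by rewrite divr_gt0 // ler_pdivrMr ?mul1r.
have ry : y = r * x by rewrite /r divfK.
have rp : r ^+ m <= r `^ p.
  by rewrite -powR_mulrn ?(ltW (proj1 (andP r01))) // ger_powR.
have rb : 1 - r ^+ m <= m%:R * (1 - r).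
  by apply: expr_bernoulli; case/andP: r01 => /ltW -> ->.
have -> : x `^ p - y `^ p = (1 - r `^ p) * x `^ p.
  by rewrite ry powRM ?(ltW (proj1 (andP r01))) // mulrBl mul1r.
rewrite -(mulr_powRB1 x0 p_gt0).
have -> : m%:R * (x - y) * x `^ (p - 1) = m%:R * (1 - r) * (x * x `^ (p - 1)).
  by rewrite ry; ring.
by apply: ler_wpM2r; [rewrite mulr_ge0 ?powR_ge0 | lra].
Qed.

(** As p - 1 > 0, vertices of degree at most z n weigh arbitrarily little per edge compared with
    n^(p-1). *)
Lemma small_powR (c : R) : 0 < c -> exists z, [/\ 0 < z, z <= 2^-1 & z `^ (p - 1) <= c].
Proof.
move=> c0; exists (Num.min 2^-1 (c `^ (p - 1)^-1)).
have c1 : 0 < c `^ (p - 1)^-1 by apply: powR_gt0.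
split; first by rewrite lt_min c1 invr_gt0 ltr0n.
  by rewrite ge_min lexx.
apply: (@le_trans _ _ ((c `^ (p - 1)^-1) `^ (p - 1))).
  apply: ler_powR2 => //; last by rewrite ge_min lexx orbT.
  by rewrite le_min invr_ge0 ler0n (ltW c1).
by rewrite -powRrM mulVf ?gt_eqF // powRr1 // ltW.
Qed.

Lemma ex_ge n (T : finType) (F : sgraph T) (G : sgraph 'I_n) :
  subgraph_free F G -> e_ p G <= ex_ p n F.
Proof. by move=> freeG; rewrite /ex_; apply: le_bigmax_cond. Qed.

Lemma ler_deg (d d' : nat) : (d <= d')%N -> d%:R `^ p <= d'%:R `^ p :> R.
Proof. by move=> le; apply: ler_powR2; rewrite ?ler0n ?ler_nat // ltW. Qed.

(** x^p is strictly increasing, so a strict gain at one vertex without loss elsewhere would beat the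
    maximum. *)
Lemma extremal_deg n (T : finType) (F : sgraph T) (G G' : sgraph 'I_n) :
  subgraph_free F G' -> e_ p G = ex_ p n F ->
  (forall x, (deg G x <= deg G' x)%N) -> forall x, deg G x = deg G' x.
Proof.
move=> freeG' exG ledeg.
have le_sum : e_ p G <= e_ p G'
    ?= iff [forall x, (deg G x)%:R `^ p == (deg G' x)%:R `^ p :> R].
  have [le1 le2] : e_ p G <= e_ p G' ?= iff [forall (x | true),
      (deg G x)%:R `^ p == (deg G' x)%:R `^ p :> R].
    by apply: leif_sum => x _; split=> //; apply: ler_deg.
  by split=> //; rewrite le2; apply: eq_forallb => x.
have : e_ p G == e_ p G'.
  by rewrite eq_le le_sum /= exG ex_ge.
rewrite le_sum => /forallP eqdeg x; apply/eqP; rewrite eqn_leq ledeg /=.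
rewrite leqNgt; apply/negP => ltd; have := eqdeg x; rewrite lt_eqF //.
by apply: gt0_ltr_powR; rewrite ?nnegrE ?ler0n ?ltr_nat.
Qed.

End PowerInequalities.

Lemma extremal_adj (R : realType) (p : R) n (T : finType) (F : sgraph T)
    (G G' : sgraph 'I_n) :
  (1 < p)%R -> subgraph_free F G' -> e_ p G = ex_ p n F ->
  (forall x y, adj G x y -> adj G' x y) -> adj G =2 adj G'.
Proof.
move=> hp freeG' exG sub x y.
have subx z : {subset adj G z <= adj G' z} by move=> w; rewrite !in_adj; apply: sub.
have le x0 : deg G x0 <= deg G' x0.
  by apply: subset_leq_card; apply/subsetP; exact: subx.
have eqd := extremal_deg hp freeG' exG le x.
have /subset_cardP : #|adj G x| = #|adj G' x| by exact: eqd.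
have -> : adj G x \subset adj G' x by apply/subsetP; exact: subx.
by move=> /(_ isT y); rewrite !in_adj.
Qed.

Definition common_nbrs (V : finType) (G : sgraph V) (Y : {set V}) : {set V} :=
  [set x | [forall y in Y, adj G y x]].

Lemma common_nbrsP (V : finType) (G : sgraph V) (Y : {set V}) x :
  reflect (forall y, y \in Y -> adj G y x) (x \in common_nbrs G Y).
Proof. by rewrite inE; apply: forall_inP. Qed.

Lemma sum_nonadj (V : finType) (G : sgraph V) y :
  \sum_x ~~ adj G y x = #|V| - deg G y.
Proof.
have : \sum_x ~~ adj G y x + deg G y = #|V|.
  rewrite degE -big_split /= -sum1_card; apply: eq_bigr => x _.
  by case: (adj G y x).
by lia.
Qed.

(** Union bound: a vertex that is not a common neighbour is missed by some member of [Y]. *)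
Lemma card_common_nbrs (V : finType) (G : sgraph V) (Y : {set V}) :
  #|V| <= #|common_nbrs G Y| + \sum_(y in Y) (#|V| - deg G y).
Proof.
under eq_bigr => y _ do rewrite -sum_nonadj.
rewrite exchange_big /= -!sum1_card [X in _ <= X + _]big_mkcond -big_split /=.
apply: leq_sum => x _; case: (boolP (x \in common_nbrs G Y)) => // nx.
have /existsP[y /andP[Yy nyx]] : [exists y in Y, ~~ adj G y x].
  rewrite -negb_forall_in; move: nx; rewrite inE; apply: contra => /forall_inP H.
  by apply/forall_inP.
by rewrite (bigD1 y Yy) /= nyx.
Qed.

Section JoinStructure.
Variables (T : finType) (F : sgraph T) (rk : T -> nat) (q : nat) (S : {set T}).
Hypotheses (rkF : forest_rank F rk) (indS : independent_set F S)
  (covS : edge_cover F S) (cardS : #|S| = q.+1)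
  (minS : forall S', independent_set F S' -> edge_cover F S' -> q < #|S'|).
Local Notation k := #|T|.

Section FreeGraph.
Variables (V : finType) (G : sgraph V).
Hypothesis freeG : subgraph_free F G.

Lemma common_nbrs_small (Y : {set V}) : q < #|Y| -> #|common_nbrs G Y| < k.
Proof.
move=> leY; apply: (@common_nbrs_bound _ _ F G S Y) => //; first by rewrite cardS.
by move=> y z Yy /common_nbrsP; apply.
Qed.

(** Edges are counted from their other end: a vertex sees at most [q] members of [W], apart from a
    number of exceptions bounded in terms of |W|, for which |W| is allowed. *)
Lemma sum_deg_heavy (W : {set V}) :
  \sum_(v in W) deg G v <= q * #|V| + #|W| * (2 ^ #|W| * k).
Proof.
have degT v : deg G v = degin G setT v.
  by rewrite degE; apply: eq_bigl => w; rewrite inE.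
under eq_bigr => v _ do rewrite degT.
rewrite sum_degin (eq_bigl (fun _ => true)); last by move=> x; rewrite inE.
pose N x := [set w in W | adj G x w].
(* The exceptional vertices are sorted by their neighbourhood in [W]; a neighbourhood of more than
   [q] vertices is shared by fewer than [k] of them. *)
have cardX : #|[set x | q < degin G W x]| <= 2 ^ #|W| * k.
  rewrite -card_powerset -sum1_card.
  rewrite (partition_big N (mem (powerset W))) /=; last first.
    by move=> x _; rewrite powersetE; apply/subsetP => w; rewrite inE => /andP[].
  rewrite -sum_nat_const; apply: leq_sum => Y _.
  have [qY|qY] := ltnP q #|Y|.
    rewrite sum1_card; apply: ltnW; apply: leq_ltn_trans (common_nbrs_small qY).
    apply: subset_leq_card; apply/subsetP => x xY; apply/common_nbrsP => y.
    move: xY; rewrite unfold_in => /andP[_ /eqP defY].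
    by rewrite -defY inE adj_sym => /andP[].
  rewrite big_pred0 // => x; rewrite inE deginE; apply/negP => /andP[qx /eqP defY].
  by move: qx; rewrite [[set _ in _ | _]]defY ltnNge qY.
apply: (@leq_trans (\sum_x (q + #|W| * (x \in [set x | q < degin G W x])))).
  apply: leq_sum => x _; rewrite inE; case: ltnP => [_|le].
    by rewrite muln1; apply: leq_trans (degin_le _ _ _) (leq_addl _ _).
  by rewrite muln0 addn0.
rewrite big_split /= sum_nat_const cardT -cardT mulnC leq_add2l -big_distrr /=.
rewrite leq_mul2l; apply/orP; right; apply: leq_trans cardX.
rewrite -sum1_card [leqRHS]big_mkcond /=; apply: leq_sum => x _.
by case: (x \in _).
Qed.

End FreeGraph.


(** The preimage of [A] under an embedding would be an independent cover of [F] with at most [q]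
    vertices. *)
Lemma free_of_cover (V : finType) (H : sgraph V) (A : {set V}) :
  #|A| <= q -> (forall x y, adj H x y -> (x \in A) != (y \in A)) ->
  subgraph_free F H.
Proof.
move=> leA bip; apply/containsP => -[f [injf homf]].
have : q < #|f @^-1: A|.
  apply: minS.
    apply/forall_inP => x; rewrite inE => xA; apply/forall_inP => y.
    by rewrite inE => yA; apply/negP => /homf /bip; rewrite xA yA.
  apply/forallP => x; apply/forallP => y; apply/implyP => /homf /bip.
  by rewrite !inE; case: (f x \in A); case: (f y \in A).
rewrite ltnNge; apply/negP; rewrite negbK; apply: leq_trans leA.
rewrite -(card_imset _ injf); apply: subset_leq_card; apply/subsetP => _ /imsetP[x + ->].
by rewrite inE.
Qed.

Section Extremal.
Variables (R : realType) (p : R).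
Hypothesis hp : (1 < p)%R.

(** The graph is complete bipartite with classes of sizes q and n - q; the large class contributes
    only to lower order and is dropped. *)
Lemma biclique_lower n : q <= n -> (q%:R * (n - q)%:R `^ p <= ex_ p n F :> R)%R.
Proof.
move=> leqn; pose H := graph_of_rel (fun x y : 'I_n => (x < q) && (q <= y)).
pose A := [set x : 'I_n | x < q].
have adjH x y : adj H x y = ((x \in A) != (y \in A)).
  rewrite adj_graph_of_rel !inE !(leqNgt q).
  have [->|] := eqVneq x y; first by rewrite eqxx.
  by case: (x < q); case: (y < q).
have cardA : #|A| = q.
  have -> : A = widen_ord leqn @: [set: 'I_q].
    apply/setP => x; apply/idP/imsetP => [|[i _ ->]]; rewrite !inE //=.
    by move=> ltx; exists (Ordinal ltx); rewrite ?inE //; apply: val_inj.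
  by rewrite card_imset ?cardsT ?card_ord // => i j /(congr1 val) /= /val_inj.
have freeH : subgraph_free F H.
  by apply: (@free_of_cover _ _ A) => [|x y]; rewrite ?cardA // adjH.
apply: le_trans (ex_ge p freeH); rewrite /e_ (bigID (mem A)) /=.
rewrite -[leLHS]addr0; apply: lerD; last by apply: sumr_ge0 => *; apply: powR_ge0.
rewrite (eq_bigr (fun _ => (n - q)%:R `^ p)%R); last first.
  move=> v Av; have -> // : deg H v = n - q.
  have -> : deg H v = #|~: A|.
    by apply: eq_card => w; rewrite in_adj adjH Av in_setC.
  by have := cardsC A; rewrite cardA card_ord; lia.
by rewrite sumr_const cardA mulr_natl.
Qed.

(* Replacing [G] by this graph gains order n^(p-1) for each vertex of [U], at the
   vertices of [A], and loses at most a small multiple of that elsewhere. *)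
Definition reattach (V : finType) (G : sgraph V) (A U : {set V}) : sgraph V :=
  graph_of_rel (fun x y => if (x \in U) || (y \in U)
    then (x \in A) && (y \in U) else adj G x y).

Lemma adj_reattach (V : finType) (G : sgraph V) (A U : {set V}) x y :
  [disjoint A & U] ->
  adj (reattach G A U) x y = if (x \in U) || (y \in U)
    then (x \in A) && (y \in U) || (x \in U) && (y \in A) else adj G x y.
Proof.
move=> disjAU; have AU z : z \in A -> z \in U = false by exact: (disjointFr disjAU).
rewrite adj_graph_of_rel (orbC (y \in U)) (adj_sym G y); case: ifP => UU; last first.
  by rewrite orbb; case: eqVneq => [->|//]; rewrite adj_irrefl.
have [->|_] := eqVneq x y; last by rewrite /= [(y \in A) && _]andbC.
by rewrite [(y \in U) && _]andbC orbb; case: (boolP (y \in A)) => //= /AU.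
Qed.

(** In a copy of [F], the vertices lying in [U] have all their neighbours in [A]. Forgetting their
    images leaves only edges across the parts to realise, and they can be placed afresh among the
    common neighbours of [A]. *)
Lemma reattach_free (V : finType) (G : sgraph V) (A U : {set V}) :
  subgraph_free F G -> ~: (A :|: U) = common_nbrs G A -> [disjoint A & U] ->
  k <= #|common_nbrs G A| -> subgraph_free F (reattach G A U).
Proof.
move=> freeG defB disjAU leB; apply: contra freeG => /containsP[f [injf homf]].
have AU z : z \in A -> z \in U = false by exact: (disjointFr disjAU).
apply: (@placeable_contains _ _ F G A (common_nbrs G A) (f @^-1: A)
  (fun x => if f x \in U then None else Some (f x))) => //.
- by move=> a b Aa /common_nbrsP; apply.
- rewrite -(card_imset _ injf); apply: subset_leq_card.
  by apply/subsetP => _ /imsetP[x + ->]; rewrite inE.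
split.
- move=> x v; case: ifP => // Ux [<-]; rewrite inE -defB !inE Ux orbF.
  by case: (f x \in A).
- by move=> x y v; case: ifP => // _ [<-]; case: ifP => // _ [/injf].
move=> x y /homf; rewrite adj_reattach // !inE => Gxy eqA.
have nU : (f x \in U) || (f y \in U) = false.
  apply/negP => UU; move: Gxy; rewrite UU => /orP[] /andP[].
    by rewrite eqA => /AU ->.
  by move=> + yA; rewrite AU // eqA.
by move: Gxy; rewrite nU; case/norP: (negbT nU) => /negbTE-> /negbTE-> Gxy;
  exists (f x), (f y).
Qed.

Lemma deg_reattach_in (V : finType) (G : sgraph V) (A U : {set V}) v :
  [disjoint A & U] -> v \in A ->
  deg (reattach G A U) v = deg G v + \sum_(u in U) ~~ adj G v u.
Proof.
move=> disjAU Av; have Uv := disjointFr disjAU Av.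
rewrite !degE [X in _ + X]big_mkcond -big_split /=; apply: eq_bigr => w _.
rewrite adj_reattach // Uv Av /= orbF.
by case: (w \in U); case: (adj G v w).
Qed.

Lemma deg_reattach_out (V : finType) (G : sgraph V) (A U : {set V}) v :
  [disjoint A & U] -> v \notin A -> v \notin U ->
  deg (reattach G A U) v + degin G U v = deg G v.
Proof.
move=> disjAU nAv nUv; rewrite !degE /degin [X in _ + X]big_mkcond -big_split /=.
apply: eq_bigr => w _; rewrite adj_reattach // (negbTE nUv) (negbTE nAv) /=.
by case: (w \in U); rewrite /= ?addn0.
Qed.

Local Open Scope ring_scope.

Let p_gt0 : 0 < p. Proof. exact: lt_trans hp. Qed.
Let p1_ge0 : 0 <= p - 1. Proof. by rewrite subr_ge0 ltW. Qed.
Let p1_gt0 : 0 < p - 1. Proof. by rewrite subr_gt0. Qed.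

Lemma eventually_le (c d : R) : 0 < d ->
  exists n0, forall n, (n0 <= n)%N -> c <= d * n%:R.
Proof.
move=> d0; exists (Num.bound (`|c| / d)) => n len.
have : `|c| / d < (Num.bound (`|c| / d))%:R.
  by apply: archi_boundP; rewrite divr_ge0 // ltW.
rewrite ltr_pdivrMr // => lt1; apply: le_trans (ler_norm c) _.
apply: le_trans (ltW lt1) _; rewrite mulrC ler_pM2l // ler_nat //.
Qed.

Definition near_full n (G : sgraph 'I_n) (eta : R) : {set 'I_n} :=
  [set v | (1 - eta) * n%:R <= (deg G v)%:R].

Lemma deg_le n (G : sgraph 'I_n) v : (deg G v <= n)%N.
Proof. by rewrite -[leqRHS]card_ord; apply: max_card. Qed.

Lemma sum_codeg n (G : sgraph 'I_n) (eta : R) (Y : {set 'I_n}) :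
  Y \subset near_full G eta ->
  (\sum_(y in Y) (#|'I_n| - deg G y))%:R <= #|Y|%:R * (eta * n%:R) :> R.
Proof.
move=> /subsetP subY; rewrite natr_sum mulr_natl -sumr_const; apply: ler_sum => y /subY.
rewrite inE card_ord natrB ?deg_le //; lra.
Qed.

(** With x^p written as x x^(p-1), the second factor is at most n^(p-1), rho n^(p-1) or eps'
    n^(p-1), according as the vertex is near-full, only heavy, or light. With fewer than q near-full
    vertices the heavy degree sum q n + O(1) is partly discounted by rho, and e_p falls short of the
    biclique by a positive multiple of n^p. *)
Lemma card_near_full (eta : R) : 0 < eta -> 2 * q.+1%:R * eta <= 1 ->
  exists n0, forall n, (n0 <= n)%N -> forall G : sgraph 'I_n,
    subgraph_free F G -> e_ p G = ex_ p n F -> #|near_full G eta| = q.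
Proof.
move=> eta0 leeta.
have q1 : 1 <= q.+1%:R :> R by rewrite ler1n.
have eta2 : eta <= 2^-1.
  rewrite -(ler_pM2l (ltr0n _ 2)) mulfV ?pnatr_eq0 //.
  apply: le_trans leeta; rewrite mulrAC ler_peMr // mulr_ge0 ?ler0n // ltW //.
pose rho := (1 - eta) `^ (p - 1).
have rho0 : 0 <= rho by apply: powR_ge0.
have rho1 : rho < 1.
  have : rho < 1 `^ (p - 1) by apply: gt0_ltr_powR; rewrite ?nnegrE //; lra.
  by rewrite powR1.
(* The light vertices have total degree at most 2 k n, and this choice lets them use up only half of
   the gap 1 - rho. *)
have [eps [eps0 eps2 epsp]] : exists z : R, [/\ 0 < z, z <= 2^-1 &
    z `^ (p - 1) <= (1 - rho) / (4 * k%:R + 1)].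
  apply: (small_powR hp); rewrite divr_gt0 ?subr_gt0 //.
  by rewrite ltr_wpDl // mulr_ge0 ?ler0n.
set eps' := eps `^ (p - 1) in epsp.
have k0 : 0 <= k%:R :> R := ler0n _ _.
have eps'k : eps' * (2 * k%:R) <= (1 - rho) / 2.
  have k1 : 0 < 4 * k%:R + 1 :> R by rewrite ltr_wpDl // mulr_ge0 ?ler0n.
  move: epsp; rewrite ler_pdivlMr // => epsp.
  have : 0 <= eps' by apply: powR_ge0.
  lra.
(* [w] bounds the number of vertices of degree at least eps n, and [c1] the error term of
   [sum_deg_heavy] for them; neither depends on n. *)
pose w := Num.bound (2 * k%:R / eps).
pose c1 := (w * (2 ^ w * k))%N.
pose m := Num.bound p.
have lepm : p <= m%:R by apply: ltW; apply: archi_boundP; apply: ltW.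
(* The other half of the gap has to exceed both the amount m q^2 by which the biclique stays below q
   n and the error [c1]. *)
have [n1 n1P] := @eventually_le (m%:R * q%:R ^+ 2 + c1%:R + 1) ((1 - rho) / 2)
  ltac:(lra).
exists (maxn n1 (maxn (2 * k).+1 q)) => n; rewrite !geq_max => /and3P[/n1P nbig nk nq].
move=> G freeG exG; set A := near_full G eta.
pose N : R := n%:R; have N0 : 0 < N by rewrite ltr0n; apply: leq_trans nk.
have kN : 2 * k%:R < N by rewrite -natrM ltr_nat.
apply/eqP; rewrite eqn_leq; apply/andP; split.
  (* Since 2 (q + 1) eta <= 1, q + 1 near-full vertices together miss at most n/2 vertices, which
     leaves more than [k] common neighbours. *)
  rewrite leqNgt; apply/negP => /card_geqP[s [us szs sA]].
  pose Y := [set x in s].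
  have cardY : #|Y| = q.+1 by rewrite cardsE (card_uniqP us).
  have := card_common_nbrs G Y; have := common_nbrs_small freeG (Y := Y).
  rewrite cardY leqnn => /(_ isT) small; rewrite [X in (X <= _)%N]card_ord.
  rewrite -(ler_nat R) natrD.
  have : (\sum_(y in Y) (#|'I_n| - deg G y))%:R <= q.+1%:R * (eta * N) :> R.
    by rewrite -cardY; apply: sum_codeg; apply/subsetP => y; rewrite inE => /sA.
  have : #|common_nbrs G Y|%:R <= k%:R :> R by rewrite ler_nat ltnW.
  have : q.+1%:R * (eta * N) <= N / 2.
    by have := ler_wpM2r (ltW N0) leeta; lra.
  rewrite -/N; lra.
rewrite leqNgt; apply/negP => ltA.
pose W := [set v | eps * N <= (deg G v)%:R].
pose d v : R := (deg G v)%:R.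
have dN v : d v <= N by rewrite ler_nat deg_le.
have d0 v : 0 <= d v by apply: ler0n.
pose sA : R := \sum_(v in A) d v; pose sW : R := \sum_(v in W) d v.
pose sT : R := \sum_v d v.
have sT_le : sT <= 2 * k%:R * N.
  have := forest_free_sparse setT rkF freeG; rewrite cardsT card_ord.
  rewrite -(ler_nat R) !natrM => le; apply: le_trans le.
  rewrite natr_sum (eq_bigl (fun=> true)); last by move=> v; rewrite inE.
  apply: ler_sum => v _; rewrite ler_nat degE /degin leq_eqVlt; apply/orP; left.
  by apply/eqP; apply: eq_bigl => x; rewrite inE.
have W_le : (#|W| <= w)%N.
  rewrite -(ler_nat R); apply: (@le_trans _ _ (2 * k%:R / eps)); last first.
    by apply: ltW; apply: archi_boundP; rewrite divr_ge0 ?mulr_ge0 ?ler0n // ltW.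
  rewrite ler_pdivlMr // -(ler_pM2r N0); apply: le_trans sT_le.
  rewrite -mulrA mulr_natl -sumr_const.
  apply: (@le_trans _ _ sW); first by apply: ler_sum => v; rewrite inE.
  by rewrite /sT (bigID (mem W)) /= lerDl sumr_ge0.
have sW_le : sW <= q%:R * N + c1%:R.
  have := sum_deg_heavy freeG W; rewrite card_ord -(ler_nat R) natr_sum => le.
  apply: le_trans le _; rewrite natrD natrM lerD2l ler_nat /c1.
  by rewrite leq_mul // leq_mul // leq_exp2l.
have sA_le : sA <= (q%:R - 1) * N.
  apply: (@le_trans _ _ (#|A|%:R * N)).
    by rewrite mulr_natl -sumr_const; apply: ler_sum => v _.
  by rewrite ler_pM2r // lerBrDr natr1 ler_nat.
pose N' := N `^ (p - 1); have N'0 : 0 < N' by apply: powR_gt0.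
(* The weights add up so that a vertex in both [A] and [W] receives at least 1, one in [W] only at
   least rho, and every vertex at least eps'. *)
have upper : e_ p G <= ((1 - rho) * sA + rho * sW + eps' * sT) * N'.
  rewrite /sA /sW [X in (1 - rho) * X]big_mkcond [X in rho * X]big_mkcond.
  rewrite /sT !mulr_sumr -!big_split mulr_suml; apply: ler_sum => v _ /=.
  rewrite -mulr_powRB1 ?d0 // -/(d v).
  have dpow c : 0 <= c -> d v <= c * N -> d v `^ (p - 1) <= c `^ (p - 1) * N'.
    move=> c0 ledc; rewrite -powRM ?(ltW N0) //; exact: ler_powR2.
  have eps'0 : 0 <= eps' * d v by rewrite mulr_ge0 ?powR_ge0.
  case: (boolP (v \in W)) => [_|]; last rewrite inE -ltNge => /ltW vW.
    case: (boolP (v \in A)) => [_|]; last rewrite inE -ltNge => /ltW vA.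
      have le1 : d v `^ (p - 1) <= N' by apply: ler_powR2.
      apply: le_trans (ler_wpM2l (d0 v) le1) _; rewrite ler_wpM2r ?(ltW N'0) //; lra.
    have le1 : d v `^ (p - 1) <= rho * N' by apply: dpow => //; lra.
    apply: le_trans (ler_wpM2l (d0 v) le1) _; rewrite mulrA ler_wpM2r ?(ltW N'0) //; lra.
  have le1 : d v `^ (p - 1) <= eps' * N' by apply: dpow => //; lra.
  apply: le_trans (ler_wpM2l (d0 v) le1) _; rewrite mulrA ler_wpM2r ?(ltW N'0) //.
  case: (v \in A); have := mulr_ge0 (_ : 0 <= 1 - rho) (d0 v); lra.
have lower : (q%:R * N - m%:R * q%:R ^+ 2) * N' <= e_ p G.
  rewrite exG; apply: le_trans (biclique_lower nq).
  have leNq : (n - q)%:R <= N by rewrite ler_nat leq_subr.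
  have := powR_sub_le hp lepm (ler0n _ _) leNq; rewrite natrB // -/N.
  rewrite -(mulr_powRB1 (ltW N0) p_gt0) -/N' => le.
  have := ler_wpM2l (ler0n _ q) le; lra.
have := le_trans lower upper; rewrite ler_pM2r //.
have h1 : (1 - rho) * sA <= (1 - rho) * ((q%:R - 1) * N).
  by apply: ler_wpM2l => //; lra.
have h2 := ler_wpM2l rho0 sW_le.
have h3 : eps' * sT <= (1 - rho) / 2 * N.
  apply: le_trans (ler_wpM2l (powR_ge0 _ _) sT_le) _.
  by rewrite mulrA; apply: ler_wpM2r => //; apply: ltW.
have h4 : rho * c1%:R <= c1%:R by rewrite ler_piMl ?ler0n // ltW.
rewrite -/N in nbig; lra.
Qed.

Theorem extremal_join : exists n0, forall n, (n0 <= n)%N -> forall G : sgraph 'I_n,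
  subgraph_free F G -> e_ p G = ex_ p n F ->
  exists A : {set 'I_n}, #|A| = q /\
    forall x y, x \in A -> y \notin A -> adj G x y.
Proof.
pose m := Num.bound p.
have lepm : p <= m%:R by apply: ltW; apply: archi_boundP; apply: ltW.
(* [M] bounds the loss per detached vertex in units of (z n)^(p-1): q + 3k for the degrees of the
   detached vertices, on average, and m k for the edges that their neighbours in [B] lose. *)
pose M : R := q%:R + 3 * k%:R + m%:R * k%:R.
have M0 : 0 <= M by rewrite !addr_ge0 ?mulr_ge0 ?ler0n.
(* Vertices of [A] have degree at least n/2, so each new edge there gains at least h n^(p-1). *)
pose h : R := 2^-1 `^ (p - 1).
have h0 : 0 < h by apply: powR_gt0; rewrite invr_gt0.
have [z [z0 z2 zp]] : exists z : R, [/\ 0 < z, z <= 2^-1 & z `^ (p - 1) <= h / (M + 1)].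
  by apply: (small_powR hp); rewrite divr_gt0 // ltr_wpDl.
set z' := z `^ (p - 1) in zp.
have z'M : z' * M < h.
  move: zp; rewrite ler_pdivlMr ?ltr_wpDl // => zp.
  have : 0 < z' by apply: powR_gt0.
  lra.
have q1 : 0 < q.+1%:R :> R by rewrite ltr0n.
(* A vertex outside [A] has degree at most q + k + |U|, where |U| <= q eta n and q + k <= eta n; the
   sum is at most (q + 1) eta n = z n. *)
pose eta := z / q.+1%:R.
have eta0 : 0 < eta by rewrite divr_gt0.
have etaz : eta * q.+1%:R = z by rewrite divfK ?gt_eqF.
have etaz' : eta + q%:R * eta = z by rewrite -etaz -natr1; ring.
have q0 : 0 <= q%:R :> R := ler0n _ _.
have k0 : 0 <= k%:R :> R := ler0n _ _.
have qeta0 : 0 <= q%:R * eta by rewrite mulr_ge0 // ltW.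
have [|n1 n1P] := card_near_full eta0; first by rewrite -mulrA [_ * eta]mulrC etaz; lra.
have [n2 n2P] := eventually_le (q%:R + k%:R + 1) eta0.
exists (maxn n1 n2) => n; rewrite !geq_max => /andP[/n1P cardA /n2P nbig] G freeG exG.
have {}cardA := cardA G freeG exG; set A := near_full G eta in cardA.
pose N : R := n%:R; rewrite -/N in nbig.
have N0 : 0 < N.
  by rewrite -(pmulr_rgt0 _ eta0); apply: lt_le_trans nbig; lra.
have etaN : eta * N <= N / 2 by have := ler_wpM2r (ltW N0) z2; rewrite -etaz'; nra.
have qetaN : eta * N + q%:R * eta * N <= N / 2.
  by have := ler_wpM2r (ltW N0) z2; rewrite -etaz'; lra.
pose B := common_nbrs G A; pose U := ~: (A :|: B).
have nAB x : x \in A -> x \in B = false.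
  move=> Ax; apply/negP => /common_nbrsP/(_ x Ax); by rewrite adj_irrefl.
have disjAU : [disjoint A & U].
  by rewrite disjoints_subset setCK subsetUl.
have defB : ~: (A :|: U) = B.
  apply/setP => x; rewrite !in_setC !in_setU in_setC in_setU.
  by case: (boolP (x \in A)) => [/nAB->|] //=; rewrite negbK.
have codeg : (\sum_(y in A) (#|'I_n| - deg G y))%:R <= q%:R * (eta * N) :> R.
  by rewrite -cardA; apply: sum_codeg.
have B_ge : N - q%:R * (eta * N) <= #|B|%:R.
  have := card_common_nbrs G A; rewrite -(ler_nat R) natrD card_ord -/N -/B.
  by rewrite card_ord in codeg; lra.
have kB : (k <= #|B|)%N by rewrite -(ler_nat R); lra.
have U_le : #|U|%:R <= q%:R * (eta * N).
  have : (#|B| + #|U| <= n)%N.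
    apply: (@leq_trans (#|B| + #|~: B|)); last by rewrite cardsC card_ord.
    by rewrite leq_add2l subset_leq_card // setCS subsetUr.
  by rewrite -(ler_nat R) natrD -/N; lra.
(* The neighbours of [v] in [B] are common to the q + 1 vertices of [v |: A]. *)
have deginB v : v \notin A -> (degin G B v <= k)%N.
  move=> nAv; rewrite deginE; apply: ltnW.
  apply: leq_ltn_trans (common_nbrs_small freeG (Y := v |: A) _); last first.
    by rewrite cardsU1 nAv cardA.
  apply: subset_leq_card; apply/subsetP => x /setIdP[/common_nbrsP Bx vx].
  by apply/common_nbrsP => y /setU1P[->|/Bx].
pose d v : R := (deg G v)%:R; have d0 v : 0 <= d v := ler0n _ _.
have degABU v : (deg G v = degin G A v + degin G B v + degin G U v)%N.
  rewrite (deg_setC G A) -addnA; congr addn.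
  rewrite /degin (bigID (mem B)) /=; congr addn; apply: eq_bigl => x.
    rewrite in_setC andbC; case: (boolP (x \in B)) => //= Bx.
    by apply: contraL Bx => /nAB->.
  by rewrite !in_setC in_setU negb_or.
have d_le v : v \notin A -> d v <= z * N.
  move=> nAv; have : (deg G v <= q + k + #|U|)%N.
    by rewrite degABU !leq_add ?degin_le ?deginB // -cardA degin_le.
  by rewrite -(ler_nat R) !natrD -/(d v) -etaz'; lra.
pose G' := reattach G A U.
have freeG' : subgraph_free F G' by apply: reattach_free.
have le_e : e_ p G' <= e_ p G by rewrite exG ex_ge.
pose H := h * N `^ (p - 1); pose Z := z' * N `^ (p - 1).
have N'0 : 0 < N `^ (p - 1) by apply: powR_gt0.
have Z0 : 0 <= Z by rewrite mulr_ge0 ?powR_ge0.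
have HE : (N / 2) `^ (p - 1) = H by rewrite powRM ?invr_ge0 ?(ltW N0) // mulrC.
have ZE : (z * N) `^ (p - 1) = Z by rewrite powRM ?(ltW N0) ?(ltW z0).
pose mv v := (\sum_(u in U) ~~ adj G v u)%N.
(* At a vertex of [U] the whole old contribution is charged as a loss and the new one is only
   bounded below by 0. *)
have pointwise v : d v `^ p + H * (if v \in A then (mv v)%:R else 0) <=
    (deg G' v)%:R `^ p + Z * ((if v \in U then d v else 0) +
      m%:R * (if v \in B then (degin G U v)%:R else 0)).
  case: (boolP (v \in A)) => Av.
    rewrite nAB // (disjointFr disjAU Av) !mulr0 addr0 mulr0 addr0.
    rewrite deg_reattach_in // natrD -/(d v) -/(mv v).
    apply: le_trans (powR_add_ge hp _ _) => //; rewrite lerD2l mulrC.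
    rewrite ler_wpM2l ?ler0n // -HE; apply: ler_powR2 => //.
      by rewrite divr_ge0 // ltW.
    by move: Av; rewrite inE -/N -/(d v); lra.
  rewrite mulr0 addr0; case: (boolP (v \in U)) => Uv.
    have -> : v \in B = false by move: Uv; rewrite -defB !inE => ->; rewrite orbT.
    rewrite !mulr0 addr0 -mulr_powRB1 // [Z * _]mulrC.
    rewrite (le_trans (y := d v * Z)) //; last by rewrite lerDr powR_ge0.
    by rewrite ler_wpM2l // -ZE ler_powR2 // d_le.
  have Bv : v \in B by rewrite -defB in_setC in_setU negb_or Av Uv.
  rewrite Bv add0r; have degv := deg_reattach_out G disjAU Av Uv.
  rewrite -lerBlDl.
  have le' : (deg G' v)%:R <= d v by rewrite ler_nat -degv leq_addr.
  apply: le_trans (powR_sub_le hp lepm (ler0n _ _) le') _.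
  have -> : d v - (deg G' v)%:R = (degin G U v)%:R.
    by rewrite /d -degv natrD addrAC subrr add0r.
  rewrite [Z * _]mulrC; apply: ler_wpM2l; first by rewrite mulr_ge0 ?ler0n.
  by rewrite -ZE ler_powR2 // d_le.
have total : H * (\sum_(v in A) mv v)%:R <=
    Z * ((\sum_(v in U) deg G v)%:R + m%:R * (\sum_(v in B) degin G U v)%:R).
  have : \sum_v (d v `^ p + H * (if v \in A then (mv v)%:R else 0)) <=
      \sum_v ((deg G' v)%:R `^ p + Z * ((if v \in U then d v else 0) +
      m%:R * (if v \in B then (degin G U v)%:R else 0))) by apply: ler_sum.
  rewrite !big_split /= -!mulr_sumr !big_split /= -!mulr_sumr -!big_mkcond.
  by rewrite -!natr_sum /=; move: le_e; rewrite /e_ /d; lra.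
(* Each vertex has at most q neighbours in [A] and k in [B]; inside [U] sparsity gives 2k on
   average. *)
have sumU : (\sum_(v in U) deg G v <= (q + 3 * k) * #|U|)%N.
  under eq_bigr => v _ do rewrite degABU.
  rewrite big_split /=; have := forest_free_sparse U rkF freeG; move=> le.
  have -> : ((q + 3 * k) * #|U| = #|U| * (q + k) + 2 * k * #|U|)%N by ring.
  apply: leq_add => //; rewrite -sum_nat_const; apply: leq_sum => v Uv.
  rewrite leq_add -?cardA ?degin_le // deginB //.
  by apply: contraL Uv => Av; rewrite (disjointFr disjAU Av).
have sumB : (\sum_(v in B) degin G U v <= k * #|U|)%N.
  rewrite sum_degin mulnC -sum_nat_const; apply: leq_sum => v Uv; apply: deginB.
  by apply: contraL Uv => Av; rewrite (disjointFr disjAU Av).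
have sumA : (#|U| <= \sum_(v in A) mv v)%N.
  rewrite exchange_big /= -sum1_card; apply: leq_sum => u Uu.
  have /exists_inP[v Av nuv] : [exists v in A, ~~ adj G v u].
    rewrite -negb_forall_in; move: Uu; rewrite in_setC; apply: contra => /forall_inP Au.
    by rewrite in_setU; apply/orP; right; apply/common_nbrsP.
  by rewrite (bigD1 v Av) /= nuv.
have U0 : #|U| = 0%N.
  apply/eqP; rewrite -leqn0 leqNgt; apply/negP; rewrite -(ltr_nat R) => u0.
  have H0 : 0 < H by rewrite mulr_gt0.
  move: sumU sumB sumA; rewrite -!(ler_nat R) natrM natrD natrM [(k * _)%:R]natrM.
  move=> sumU sumB sumA.
  have t1 := ler_wpM2l (ltW H0) sumA.
  have t2 := ler_wpM2l (ler0n R m) sumB.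
  have t3 : Z * ((\sum_(v in U) deg G v)%:R + m%:R * (\sum_(v in B) degin G U v)%:R) <=
      Z * (M * #|U|%:R) by apply: ler_wpM2l => //; rewrite /M; lra.
  have : H * #|U|%:R <= (z' * M) * N `^ (p - 1) * #|U|%:R.
    by apply: le_trans t1 _; apply: le_trans total _; apply: le_trans t3 _; rewrite /Z; lra.
  by rewrite ler_pM2r // /H ler_pM2r // leNgt z'M.
exists A; split=> // x y Ax nAy.
have : y \in B by rewrite -defB (cards0_eq U0) setU0 in_setC.
by move/common_nbrsP; apply.
Qed.

End Extremal.
End JoinStructure.

(** * Disjoint unions *)

Lemma bigminn_le (I : eqType) (r : seq I) (P : pred I) (f : I -> nat) x i :
  i \in r -> P i -> \big[minn/x]_(j <- r | P j) f j <= f i.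
Proof.
elim: r => // j r IHr; rewrite inE big_cons => /orP[/eqP<- ->|ir Pi].
  by rewrite geq_minl.
by case: ifP => _; [apply: leq_trans (geq_minr _ _) _|]; apply: IHr.
Qed.

Lemma tauP (T : finType) (F : sgraph T) (S : {set T}) :
  independent_set F S -> edge_cover F S ->
  (forall S', independent_set F S' -> edge_cover F S' -> #|S| <= #|S'|) ->
  tau F = #|S|.
Proof.
move=> indS covS minS; apply/eqP; rewrite eqn_leq /tau; apply/andP; split.
  by apply: bigminn_le; rewrite ?mem_index_enum ?indS.
elim/big_ind: _ => [|x y lex ley|S' /andP[]]; first exact: max_card.
  by rewrite leq_min lex.
exact: minS.
Qed.

Lemma min_overP (t : nat) (f : 'I_t -> nat) : 0 < t ->
  exists2 j, f j = min_over f & forall i, min_over f <= f i.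
Proof.
move=> t0; have le i : min_over f <= f i.
  by apply: bigminn_le; rewrite ?mem_index_enum.
have [j _ minj] := @arg_minnP _ (Ordinal t0) xpredT f isT.
exists j => //; apply/eqP; rewrite eqn_leq le andbT /min_over.
elim/big_ind: _ => [|x y lex ley|i _]; last exact: minj.
  by apply: leq_bigmax.
by rewrite leq_min lex.
Qed.

(** Expresses tau(F) = c without the default value of [tau], in a form that adds up over
    components. *)
Definition optimal_cover (T : finType) (F : sgraph T) (c : nat) :=
  (exists S, [/\ independent_set F S, edge_cover F S & #|S| = c]) /\
  (forall S, independent_set F S -> edge_cover F S -> c <= #|S|).

(** Independent covers are the colour classes of proper 2-colourings, and are handled as such on
    caterpillars. *)
Lemma independent_coverP (T : finType) (F : sgraph T) (S : {set T}) :
  independent_set F S && edge_cover F S <->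
  (forall x y, adj F x y -> (x \in S) = (y \notin S)).
Proof.
split=> [/andP[indS covS] x y Fxy|bip].
  have := forallP (forallP covS x) y; rewrite Fxy /=.
  case: (boolP (x \in S)) => [Sx _|_ /= -> //].
  have /forall_inP/(_ y) := forall_inP indS x Sx.
  by case: (y \in S) => // /(_ isT); rewrite Fxy.
apply/andP; split.
  apply/forall_inP => x Sx; apply/forall_inP => y Sy; apply/negP => /bip.
  by rewrite Sx Sy.
apply/forallP => x; apply/forallP => y; apply/implyP => /bip->.
by case: (y \in S).
Qed.

Section Union.
Variables (I : finType) (V : I -> finType) (Fj : forall i, sgraph (V i)).
Local Notation F := (disjoint_union Fj).

Lemma adj_union (i : I) (x y : V i) :
  adj F (Tagged V x) (Tagged V y) = adj (Fj i) x y.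
Proof.
rewrite adj_graph_of_rel /= !eqxx /= !tagged_asE [adj _ y x]adj_sym orbb.
case: (boolP (adj (Fj i) x y)) => [Fxy|]; last by rewrite andbF.
by rewrite andbT eq_Tagged; apply: contraL Fxy => /eqP/=->; rewrite adj_irrefl.
Qed.

Lemma adj_unionP (u v : {i : I & V i}) : adj F u v ->
  exists i (x y : V i), [/\ u = Tagged V x, v = Tagged V y & adj (Fj i) x y].
Proof.
move=> Fuv; have tuv : tag u = tag v.
  move: Fuv; rewrite adj_graph_of_rel => /andP[_ /orP[]] /andP[/eqP] //.
case: u v tuv Fuv => [i x] [j y] /= tuv; subst j => Fuv.
by exists i, x, y; rewrite -adj_union.
Qed.

Lemma union_rank (rk : forall i, V i -> nat) :
  (forall i, forest_rank (Fj i) (rk i)) ->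
  forest_rank F (fun u => rk (tag u) (tagged u)).
Proof.
move=> rkF; split=> [u v /adj_unionP[i [x [y [-> -> Fxy]]]]|u v w].
  by have [+ _] := rkF i; apply.
move=> /adj_unionP[i [x [y [-> -> Fxy]]]]; case: w => j z Fxz.
have [i' [x' [z' [e1 e2 _]]]] := adj_unionP Fxz.
have ij : i = j by move: (congr1 (@tag I V) e1) (congr1 (@tag I V) e2) => /= -> ->.
subst j; rewrite adj_union in Fxz; move=> /= ltx ltz.
by have [_ /(_ x y z Fxy Fxz ltx ltz) ->] := rkF i.
Qed.

Lemma card_union (S : {set {i : I & V i}}) :
  #|S| = \sum_i #|[set x : V i | Tagged V x \in S]|.
Proof.
under eq_bigr => i _ do rewrite -sum1_card.
rewrite sig_big_dep -sum1_card /=; apply: eq_bigl => -[i x] /=.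
by rewrite inE.
Qed.

Lemma union_cover_restrict (S : {set {i : I & V i}}) i :
  independent_set F S && edge_cover F S ->
  independent_set (Fj i) [set x | Tagged V x \in S] &&
  edge_cover (Fj i) [set x | Tagged V x \in S].
Proof.
move=> /independent_coverP bip; apply/independent_coverP => x y Fxy.
by rewrite !inE; apply: bip; rewrite adj_union.
Qed.

Lemma union_optimal_cover (c : I -> nat) :
  (forall i, optimal_cover (Fj i) (c i)) -> optimal_cover F (\sum_i c i).
Proof.
move=> optc; split.
  have [S SP] := fin_all_exists (fun i => proj1 (optc i)).
  exists [set u | tagged u \in S (tag u)]; split.
  - apply/forall_inP => u; rewrite inE => Su; apply/forall_inP => v.
    rewrite inE => Sv; apply/negP => /adj_unionP[i [x [y [eu ev Fxy]]]].
    move: Su Sv; rewrite eu ev /= => Sx Sy; have [indS _ _] := SP i.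
    by have /forall_inP/(_ y Sy) := forall_inP indS x Sx; rewrite Fxy.
  - apply/forallP => u; apply/forallP => v; apply/implyP.
    move=> /adj_unionP[i [x [y [-> -> Fxy]]]]; rewrite !inE /=.
    by have [_ covS _] := SP i; have := forallP (forallP covS x) y; rewrite Fxy.
  rewrite card_union; apply: eq_bigr => i _; have [_ _ <-] := SP i.
  by congr #|pred_of_set _|; apply/setP => x; rewrite !inE.
move=> S indS covS; rewrite card_union; apply: leq_sum => i _.
have [_] := optc i.
have /andP[] := union_cover_restrict i (introT andP (conj indS covS)).
by move=> h1 h2; apply.
Qed.

(** The components of a copy meet [A] in disjoint traces, whose sizes add up to more than |A|. This
    gives the freeness of the target graphs. *)
Lemma union_free (W : finType) (H : sgraph W) (A : {set W}) (c : I -> nat) :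
  (forall i f, injhom (Fj i) H f -> c i <= #|f @^-1: A|) ->
  #|A| < \sum_i c i -> subgraph_free F H.
Proof.
move=> lec; rewrite ltnNge; apply: contra => /containsP[f [injf homf]].
apply: (@leq_trans #|f @^-1: A|); last first.
  rewrite -(card_imset _ injf); apply: subset_leq_card.
  by apply/subsetP => _ /imsetP[x + ->]; rewrite inE.
rewrite card_union; apply: leq_sum => i _.
apply: leq_trans (lec i (fun x => f (Tagged V x)) _) _.
  split=> [x y /injf /eqP|x y Fxy]; first by rewrite eq_Tagged => /eqP.
  by apply: homf; rewrite adj_union.
by apply: subset_leq_card; apply/subsetP => x; rewrite !inE.
Qed.

(** The vertex saved in component [i0] makes up for the one that [A] lacks; the other components put
    an optimal cover into [A] and prescribe no image. *)
Lemma union_contains (W : finType) (G : sgraph W) (A : {set W}) (c : I -> nat)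
    (i0 : I) (P : {set V i0}) (f : V i0 -> option W) :
  (forall x y, x \in A -> y \notin A -> adj G x y) ->
  (forall i, optimal_cover (Fj i) (c i)) ->
  placeable (Fj i0) G A (~: A) P f -> #|P| < c i0 -> \sum_i c i <= #|A|.+1 ->
  #|{: {i : I & V i}}| <= #|~: A| -> contains F G.
Proof.
move=> joinA optc plP ltP sumc leB.
(* The term [(i == i0)] records the saved vertex; the last clause keeps prescribed images of
   different components from colliding. *)
have [Pf PfP] : exists Pf : forall i, {set V i} * (V i -> option W), forall i,
    [/\ placeable (Fj i) G A (~: A) (Pf i).1 (Pf i).2,
        #|(Pf i).1| + (i == i0) <= c i & i != i0 -> forall x, (Pf i).2 x = None].
  apply: (@fin_all_exists _ _ (fun i (Pfi : {set V i} * (V i -> option W)) =>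
    [/\ placeable (Fj i) G A (~: A) Pfi.1 Pfi.2,
        #|Pfi.1| + (i == i0) <= c i & i != i0 -> forall x, Pfi.2 x = None])) => i.
  have [eqi|nei] := eqVneq i i0.
    by subst i; exists (P, f); split; rewrite ?addn1 // eqxx.
  have [[S [indS covS cardS]] _] := optc i.
  exists (S, fun _ => None); split; rewrite /= ?cardS ?addn0 //.
  split=> // x y Fxy.
  have /independent_coverP/(_ x y Fxy)-> : independent_set (Fj i) S && edge_cover (Fj i) S.
    by rewrite indS.
  by case: (y \in S).
apply: (@placeable_contains _ _ F G A (~: A) [set u | tagged u \in (Pf (tag u)).1]
  (fun u => (Pf (tag u)).2 (tagged u))) => //.
- by move=> a b Aa; rewrite in_setC; apply: joinA.
- rewrite -ltnS; apply: leq_trans sumc; rewrite card_union -addn1.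
  have -> : 1 = \sum_i (i == i0 : nat) by rewrite (bigD1 i0) //= eqxx big1 // => i /negbTE->.
  rewrite -big_split /=; apply: leq_sum => i _; have [_ + _] := PfP i.
  apply: leq_trans; rewrite leq_add2r; apply: subset_leq_card.
  by apply/subsetP => x; rewrite !inE.
split.
- case=> i x v /=; rewrite inE /=; have [[+ _ _] _ _] := PfP i; exact.
- case=> i x [j y] v /= fx fy.
  have [eqi|nei] := eqVneq i i0; last by have [_ _ /(_ nei x)] := PfP i; rewrite fx.
  have [eqj|nej] := eqVneq j i0; last by have [_ _ /(_ nej y)] := PfP j; rewrite fy.
  move: y fy; rewrite eqj -eqi => y fy; have [[_ inj _] _ _] := PfP i.
  by rewrite (inj x y v).
move=> u v /adj_unionP[i [x [y [-> -> Fxy]]]]; rewrite !inE /= => eqxy.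
have [[_ _ mono] _ _] := PfP i; exact: mono Fxy eqxy.
Qed.

End Union.

(** * Caterpillars *)

Definition cnt (b : nat -> bool) (n : nat) : nat := \sum_(i < n) b i.

Lemma cntS b n : cnt b n.+1 = cnt b n + b n.
Proof. by rewrite /cnt big_ord_recr. Qed.

Lemma cnt0 b : cnt b 0 = 0.
Proof. by rewrite /cnt big_ord0. Qed.

Lemma cntC b n : cnt b n + cnt (fun i => ~~ b i) n = n.
Proof. by elim: n => [|n IHn]; rewrite ?cnt0 // !cntS; case: (b n) => /=; lia. Qed.

Lemma cnt_alternate b m n : (forall i, b (m + i) = b m (+) odd i) ->
  cnt b (m + n) = cnt b m + (if b m then uphalf n else n./2).
Proof.
move=> alt; elim: n => [|n IHn]; first by rewrite addn0 if_same addn0.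
rewrite addnS cntS IHn alt; case: (b m) => /=; last first.
  by rewrite uphalf_half; case: (odd n); lia.
by rewrite uphalf_half; case: (odd n); lia.
Qed.

Lemma cnt_ge_pairs b o m n : o + m.*2 <= n ->
  (forall i, i < m -> b (o + i.*2) || b (o + i.*2).+1) -> m <= cnt b n.
Proof.
move=> len pairs; have mono r : cnt b (o + m.*2) <= cnt b (o + m.*2 + r).
  by elim: r => [|r IHr]; rewrite ?addn0 // addnS cntS (leq_trans IHr) ?leq_addr.
rewrite -(subnKC len); apply: leq_trans (mono _) => {mono len}.
elim: m pairs => [|m IHm] pairs //; rewrite doubleS !addnS !cntS.
have := IHm (fun i lti => pairs i (leqW lti)); have := pairs m (ltnSn m).
by case: (b (o + m.*2)); case: (b (o + m.*2).+1) => //=; lia.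
Qed.

Section Paths.
Variables (W : finType) (H : sgraph W) (Q : pred W) (h : nat -> W) (n : nat).
Hypothesis injh : forall i j, i < n -> j < n -> h i = h j -> i = j.
Hypothesis homh : forall i, i.+1 < n -> adj H (h i) (h i.+1).

Lemma path_cover m : m.*2 <= n ->
  (forall x y, Q x -> Q y -> ~~ adj H x y) ->
  m <= cnt (fun i => ~~ Q (h i)) n.
Proof.
move=> lemn noQ; apply: (@cnt_ge_pairs _ 0) => // i ltim.
rewrite -negb_and add0n; apply/negP => /andP[Qx Qy].
by have := noQ _ _ Qx Qy; rewrite homh //; lia.
Qed.

(* A path with an even number of edges is covered by two edge-disjoint perfect
   matchings of all vertices but one; one of them avoids the single edge in [Q]. *)
Lemma path_cover1 m : m.*2 < n ->
  (forall x y x' y', Q x -> Q y -> Q x' -> Q y' -> adj H x y -> adj H x' y' ->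
     (x = x' /\ y = y') \/ (x = y' /\ y = x')) ->
  m <= cnt (fun i => ~~ Q (h i)) n.
Proof.
move=> ltmn oneQ.
have [/forallP even|] := boolP [forall i : 'I_m, ~~ Q (h i.*2) || ~~ Q (h i.*2.+1)].
  by apply: (@cnt_ge_pairs _ 0) => [|i ltim]; [lia|exact: (even (Ordinal ltim))].
rewrite negb_forall => /existsP[i]; rewrite -negb_and negbK => /andP[Qi Qi'].
apply: (@cnt_ge_pairs _ 1) => [|j ltjm]; first by lia.
rewrite -negb_and; apply/negP => /andP[Qj Qj']; have ltim := ltn_ord i.
have Hi : adj H (h i.*2) (h i.*2.+1) by apply: homh; lia.
have Hj : adj H (h (1 + j.*2)) (h (1 + j.*2).+1) by apply: homh; lia.
have [[e _]|[e e']] := oneQ _ _ _ _ Qi Qi' Qj Qj' Hi Hj.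
  have : i.*2 = 1 + j.*2 by apply: injh => //; lia.
  by lia.
have : i.*2 = (1 + j.*2).+1 by apply: injh => //; lia.
have : i.*2.+1 = 1 + j.*2 by apply: injh => //; lia.
by lia.
Qed.

Lemma path_card (S : {set W}) : cnt (fun i => h i \in S) n <= #|S|.
Proof.
have -> : cnt (fun i => h i \in S) n = #|[set i : 'I_n | h i \in S]|.
  by rewrite -sum1_card [RHS]big_mkcond; apply: eq_bigr => i _; rewrite inE; case: ifP.
rewrite -(@card_in_imset _ _ (fun i : 'I_n => h i)) => [|i j _ _ eqh].
  by apply: subset_leq_card; apply/subsetP => _ /imsetP[i + ->]; rewrite inE.
by apply: val_inj; apply: injh (ltn_ord i) (ltn_ord j) eqh.
Qed.

End Paths.

Section Caterpillar.
Variables (s : nat) (alpha : 'I_s -> nat).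
Local Notation C := (caterpillar alpha).
Local Notation T := ('I_s + {i : 'I_s & 'I_(alpha i)})%type.

Definition leaf (i : 'I_s) (k : 'I_(alpha i)) : T :=
  inr (Tagged (fun i => 'I_(alpha i)) k).

Lemma adj_spine (i j : 'I_s) :
  adj C (inl i) (inl j) = (j == i.+1 :> nat) || (i == j.+1 :> nat).
Proof.
rewrite adj_graph_of_rel andbC; case: orP => //= ij.
by apply/eqP => -[eqij]; move: ij; rewrite eqij; lia.
Qed.

Lemma adj_leaf i l : adj C (inl i) (inr l) = (tag l == i).
Proof. by rewrite adj_graph_of_rel /= orbF. Qed.

Lemma adj_leaves l l' : adj C (inr l) (inr l') = false.
Proof. by rewrite adj_graph_of_rel /= andbF. Qed.

Lemma caterpillar_adj_ind (P : T -> T -> Prop) :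
  (forall x y, P x y -> P y x) ->
  (forall i j : 'I_s, j = i.+1 :> nat -> P (inl i) (inl j)) ->
  (forall l, P (inl (tag l)) (inr l)) -> forall x y, adj C x y -> P x y.
Proof.
move=> symP spineP leafP [i|l] [j|l'].
- by rewrite adj_spine => /orP[] /eqP; [|move/spineP/symP]; auto.
- by rewrite adj_leaf => /eqP<-.
- by rewrite adj_sym adj_leaf => /eqP<-; apply: symP.
- by rewrite adj_leaves.
Qed.

(** Leaves rank above the whole spine, so the only lower neighbour of a leaf is its spine vertex,
    and that of a spine vertex is its predecessor. *)
Lemma caterpillar_rank :
  forest_rank C (fun x => match x with inl i => val i | inr _ => s end).
Proof.
split.
  apply: caterpillar_adj_ind => [x y|i j ij|l] /=; first by rewrite eq_sym.
    by rewrite ij ltn_eqF.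
  by rewrite ltn_eqF.
move=> [i|l] [j|l'] [j'|l''] //=; rewrite ?adj_spine ?adj_leaf.
- by move=> *; congr inl; apply: val_inj => /=; lia.
- by move=> _ _ _; have := ltn_ord i; lia.
- by move=> _ _; have := ltn_ord i; lia.
- by move=> _ _; have := ltn_ord i; lia.
- by rewrite ![adj C (inr l) _]adj_sym !adj_leaf => /eqP-> /eqP->.
- by lia.
- by lia.
- by lia.
Qed.

Lemma card_caterpillar_set (S : {set T}) :
  #|S| = \sum_(i < s) ((inl i \in S) + #|[set k : 'I_(alpha i) | leaf k \in S]|).
Proof.
rewrite -sum1_card big_mkcond big_sumType /= big_split /=; congr addn.
transitivity (\sum_(i < s) \sum_(k < alpha i) (leaf k \in S : nat)).
  rewrite sig_big_dep /=; apply: eq_bigr => -[i k] _ /=.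
  by rewrite /leaf; case: ifP.
apply: eq_bigr => i _; rewrite -sum1_card [RHS]big_mkcond.
by apply: eq_bigr => k _; rewrite inE; case: ifP.
Qed.

Definition colour (b lb : nat -> bool) (x : T) : bool :=
  match x with inl i => b i | inr l => lb (tag l) end.

Definition colour_set (b lb : nat -> bool) : {set T} := [set x : T | colour b lb x].

Lemma card_colour_set b lb :
  #|colour_set b lb| = \sum_(i < s) (b i + lb i * alpha i).
Proof.
rewrite card_caterpillar_set; apply: eq_bigr => i _; rewrite inE; congr addn.
case: (boolP (lb i)) => lbi; last first.
  by rewrite mul0n; apply: eq_card0 => k; rewrite !inE /= (negbTE lbi).
by rewrite mul1n -[RHS]card_ord; apply: eq_card => k; rewrite !inE /= lbi.
Qed.

Lemma alternating_cover e :
  independent_set C (colour_set (fun i => e (+) odd i) (fun i => ~~ (e (+) odd i))) &&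
  edge_cover C (colour_set (fun i => e (+) odd i) (fun i => ~~ (e (+) odd i))).
Proof.
apply/independent_coverP; apply: caterpillar_adj_ind => [x y ->|i j ij|l].
- by rewrite negbK.
- by rewrite !inE /= ij /= addbN negbK.
- by rewrite !inE negbK.
Qed.

(** A caterpillar is connected, so its only independent covers are its two colour classes, told
    apart by the first spine vertex; [b0] selects the smaller one. *)
Lemma caterpillar_optimal_cover b0 c :
  \sum_(i < s) ((b0 (+) odd i) + ~~ (b0 (+) odd i) * alpha i) = c ->
  c <= \sum_(i < s) (~~ (b0 (+) odd i) + (b0 (+) odd i) * alpha i) ->
  optimal_cover C c.
Proof.
move=> cE c_le; pose b1 (e : bool) i := e (+) odd i.
split.
  exists (colour_set (b1 b0) (fun i => ~~ b1 b0 i)).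
  by have /andP[] := alternating_cover b0; split=> //; rewrite card_colour_set.
move=> S indS covS; have [s0|s_gt0] := posnP s.
  suff -> : c = 0 by [].
  rewrite -cE big1 // => i; by have := ltn_ord i; rewrite {2}s0.
have /independent_coverP bip : independent_set C S && edge_cover C S by rewrite indS.
pose i0 := Ordinal s_gt0.
have spineS : forall n (ltn : n < s), (inl (Ordinal ltn) \in S) = ((inl i0 \in S) (+) odd n).
  elim=> [|n IHn] ltn; first by rewrite addbF; congr (inl _ \in S); apply: val_inj.
  rewrite /= addbN -(IHn (ltnW ltn)).
  rewrite (bip (inl (Ordinal (ltnW ltn))) (inl (Ordinal ltn))) ?negbK //.
  by rewrite adj_spine eqxx.
have -> : S = colour_set (b1 (inl i0 \in S)) (fun i => ~~ b1 (inl i0 \in S) i).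
  apply/setP => -[[n ltn]|l]; rewrite inE /b1 /=; first by rewrite spineS.
  have /bip : adj C (inl (tag l)) (inr l) by rewrite adj_leaf.
  by case: (tag l) => n ltn /=; rewrite spineS => ->; rewrite negbK.
rewrite card_colour_set /b1; have [->|/eqP neb] := eqVneq (inl i0 \in S) b0.
  by rewrite cE.
have -> : (inl i0 \in S) = ~~ b0 by move: neb; case: (inl i0 \in S); case: (b0).
apply: leq_trans c_le _; apply: leq_sum => i _.
by rewrite addNb negbK.
Qed.

Lemma caterpillar_placeable (W : finType) (G : sgraph W) (A : {set W})
    (b lb : nat -> bool) (f : T -> option W) :
  (forall x v, f x = Some v -> (v \in A) = (x \in colour_set b lb)) ->
  (forall x y v, f x = Some v -> f y = Some v -> x = y) ->
  (forall i j : 'I_s, j = i.+1 :> nat -> b i = b j ->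
     exists u v, [/\ f (inl i) = Some u, f (inl j) = Some v & adj G u v]) ->
  (forall l : {i : 'I_s & 'I_(alpha i)}, b (tag l) = lb (tag l) ->
     exists u v, [/\ f (inl (tag l)) = Some u, f (inr l) = Some v & adj G u v]) ->
  placeable C G A (~: A) (colour_set b lb) f.
Proof.
move=> fA injf spinef leaff; split=> // [x v fx|].
  by rewrite in_setC -(fA x v fx); case: (v \in A).
apply: caterpillar_adj_ind => [x y + eqxy|i j ij|l].
- by case=> // u [v [fy fx]]; rewrite adj_sym; exists v, u.
- by rewrite !inE /=; apply: spinef.
- by rewrite !inE /=; apply: leaff.
Qed.

(** Each leaf gets the colour opposite to its spine vertex, so only spine edges can be monochromatic
    and only spine vertices need prescribed images. *)
Lemma spine_placeable (W : finType) (G : sgraph W) (A : {set W})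
    (b : nat -> bool) (f : nat -> option W) :
  (forall i v, i < s -> f i = Some v -> (v \in A) = b i) ->
  (forall i j v, i < s -> j < s -> f i = Some v -> f j = Some v -> i = j) ->
  (forall i, i.+1 < s -> b i = b i.+1 ->
     exists u v, [/\ f i = Some u, f i.+1 = Some v & adj G u v]) ->
  placeable C G A (~: A) (colour_set b (fun i => ~~ b i))
    (fun x => if x is inl i then f i else None).
Proof.
move=> fA injf spinef; apply: caterpillar_placeable.
- by case=> // i v fi; rewrite inE /= (fA _ _ _ fi).
- by case=> // i [] // j v fi fj; congr inl; apply: val_inj; apply: injf fi fj.
- by move=> i j ij; rewrite ij; apply: spinef; rewrite -ij.
- by move=> l; case: (b _).
Qed.

End Caterpillar.

(** * Placements that use one vertex less than an optimal cover *)

Lemma cnt_parity e n : cnt (fun i => e (+) odd i) n = if e then uphalf n else n./2.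
Proof.
have := @cnt_alternate (fun i => e (+) odd i) 0 n; rewrite cnt0 !add0n addbF.
exact.
Qed.

Lemma subn_uphalf n : n - uphalf n = n./2.
Proof. by have := odd_double_half n; rewrite uphalf_half; lia. Qed.

Lemma subn_half n : n - n./2 = uphalf n.
Proof. by have := odd_double_half n; rewrite uphalf_half; lia. Qed.

Lemma leq_half_uphalf n : n./2 <= uphalf n.
Proof. by rewrite uphalf_half leq_addl. Qed.

Lemma sum_regular (b : nat -> bool) s beta :
  \sum_(i < s) (b i + ~~ b i * beta) = cnt b s + (s - cnt b s) * beta.
Proof.
rewrite big_split /= -big_distrl /=; congr (_ + _ * _).
by have := cntC b s; rewrite /cnt /=; lia.
Qed.

(** Compared with the optimal cover, one more spine vertex is on the A-side, and its [beta] >= 2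
    leaves are off it. *)
Lemma sum_regular_lt (b : nat -> bool) s beta : 2 <= s -> 2 <= beta ->
  cnt b s = (uphalf s).+1 ->
  \sum_(i < s) (b i + ~~ b i * beta) < s./2 * beta + uphalf s.
Proof.
move=> s2 beta2 cntb; rewrite sum_regular cntb.
have -> : s - (uphalf s).+1 = (s./2).-1 by lia.
have : 0 < s./2 by lia.
by case: (s./2) => // h _; rewrite mulSn /=; lia.
Qed.

Lemma cnt_tail b m s : m <= s -> (forall i, b (m + i) = b m (+) odd i) ->
  cnt b s = cnt b m + (if b m then uphalf (s - m) else (s - m)./2).
Proof. by move=> lems /cnt_alternate <-; rewrite subnKC. Qed.

Lemma sum_broom (b lb : nat -> bool) s beta gamma : 2 <= s ->
  \sum_(i < s) (b i + lb i * if i == 0 :> nat then beta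
                             else if i == s.-1 :> nat then gamma else 0) =
  cnt b s + (lb 0 * beta + lb s.-1 * gamma).
Proof.
case: s => [|[|s]] // _; rewrite big_split /=; congr addn.
rewrite big_ord_recl big_ord_recr /= eqxx big1 ?add0n // => i _.
by rewrite /bump /= add1n eqSS ltn_eqF ?muln0.
Qed.

Lemma regular_optimal_cover s beta : 1 <= beta ->
  optimal_cover (regular_caterpillar s beta) (s./2 * beta + uphalf s).
Proof.
move=> beta1; apply: (@caterpillar_optimal_cover _ _ true).
  apply: etrans (sum_regular (fun i => true (+) odd i) s beta) _.
  by rewrite cnt_parity subn_uphalf addnC.
apply: (@leq_trans (cnt (fun i => odd i) s + (s - cnt (fun i => odd i) s) * beta)).
  have -> : cnt (fun i => odd i) s = s./2 by exact: (cnt_parity false s).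
  by rewrite subn_half; have := leq_half_uphalf s; nia.
rewrite -sum_regular; apply: leq_sum => i _ /=; rewrite negbK; exact: leqnn.
Qed.

(** For odd [s] the better class contains both ends of the spine and no leaf. For even [s] it
    contains just one end, preferably that with [gamma] leaves, and pays for the [beta] leaves of
    the other. *)
Lemma broom_optimal_cover s beta gamma : 2 <= s -> 1 <= beta <= gamma ->
  optimal_cover (double_broom s beta gamma)
    (if odd s then uphalf s else s./2 + beta).
Proof.
move=> s2 /andP[beta1 lebg]; apply: (@caterpillar_optimal_cover s (fun i : 'I_s =>
  if i == 0 :> nat then beta else if i == s.-1 :> nat then gamma else 0) (odd s)).
  apply: etrans (sum_broom (fun i => odd s (+) odd i)
    (fun i => ~~ (odd s (+) odd i)) beta gamma s2) _; rewrite cnt_parity addbF.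
  by case: s s2 => [|s] //=; case: (odd s) => //=; lia.
apply: leq_trans (eq_leq (esym (sum_broom (fun i => ~~ (odd s (+) odd i))
  (fun i => odd s (+) odd i) beta gamma s2))); rewrite addbF.
have := cntC (fun i => odd s (+) odd i) s; rewrite cnt_parity uphalf_half.
by case: s s2 => [|s] //=; case: (odd s) => //=; lia.
Qed.

(* With [c] the size of an optimal cover of the component [F], such a placement
   lets the whole forest fit although [A] has one vertex too few. *)
Definition overplaceable (T V : finType) (F : sgraph T) (G : sgraph V)
    (A : {set V}) (c : nat) :=
  exists P f, placeable F G A (~: A) P f /\ #|P| < c.

Section Placements.
Variables (W : finType) (G : sgraph W) (A : {set W}).

(** The leaf [l] leaves the A-side and the edge to its only neighbour is realised by [x y]; all
    other edges still run across. *)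
Lemma leaf_overplaceable (T : finType) (F : sgraph T) (S : {set T}) l v x y :
  independent_set F S && edge_cover F S -> l \in S -> adj F l v ->
  (forall w, adj F l w -> w = v) -> x \notin A -> y \notin A -> adj G x y ->
  overplaceable F G A #|S|.
Proof.
move=> /independent_coverP bip Sl Flv leafl Ax Ay Gxy.
have vl : v != l by apply: contraL Flv => /eqP->; rewrite adj_irrefl.
have xy : x != y by apply: contraL Gxy => /eqP->; rewrite adj_irrefl.
have Sv : v \notin S by rewrite -(bip _ _ Flv).
exists (S :\ l), (fun z => if z == v then Some x else if z == l then Some y else None).
split; last by rewrite (cardsD1 l S) Sl.
split.
- move=> z u; rewrite in_setD1 in_setC; case: eqP => [-> [<-]|_].
    by rewrite (negbTE Sv) andbF.
  by case: eqP => // _ [<-].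
- move=> z z' u.
  have [->|_] := eqVneq z v; have [->|_] := eqVneq z' v => //.
  + by case: eqP => // _ [<-] [exy]; rewrite exy eqxx in xy.
  + by case: eqP => // _ [<-] [exy]; rewrite exy eqxx in xy.
  + by case: eqP => // ->; case: eqP => // ->.
move=> z w Fzw; rewrite !in_setD1 (bip _ _ Fzw).
have [eqz|nz] := eqVneq z l.
  rewrite eqz in Fzw *; rewrite (leafl _ Fzw) !eqxx [l == v]eq_sym (negbTE vl) => _.
  by exists y, x; rewrite adj_sym.
have [eqw|nw] := eqVneq w l; last by case: (w \in S).
rewrite eqw adj_sym in Fzw *; rewrite (leafl _ Fzw) !eqxx [l == v]eq_sym (negbTE vl) => _.
by exists x, y.
Qed.

(** The optimal cover avoids the second spine vertex, hence contains its leaves, and one of these is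
    traded for the edge. *)
Lemma outer_edge_regular s beta x y : 2 <= s -> 1 <= beta ->
  x \notin A -> y \notin A -> adj G x y ->
  overplaceable (regular_caterpillar s beta) G A (s./2 * beta + uphalf s).
Proof.
move=> s2 beta1 Ax Ay Gxy; pose k0 : 'I_beta := Ordinal beta1.
pose v1 := @Ordinal s 1 s2.
have <- : #|@colour_set s (fun _ => beta) (fun i => true (+) odd i)
             (fun i => ~~ (true (+) odd i))| = s./2 * beta + uphalf s.
  rewrite card_colour_set.
  apply: etrans (sum_regular (fun i => true (+) odd i) s beta) _.
  by rewrite cnt_parity subn_uphalf addnC.
apply: (@leaf_overplaceable _ _ _ (@leaf s (fun _ => beta) v1 k0) (inl v1) x y) => //.
- exact: alternating_cover.
- by rewrite inE.
- by rewrite adj_sym adj_leaf.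
- by case=> [i|l]; rewrite ?adj_leaves // adj_sym adj_leaf => /eqP/= <-.
Qed.

(** For even [s] the optimal cover avoids the first spine vertex, hence contains its [beta] leaves,
    and one of these is traded for the edge. *)
Lemma outer_edge_broom s beta gamma x y : 2 <= s -> ~~ odd s -> 1 <= beta ->
  x \notin A -> y \notin A -> adj G x y ->
  overplaceable (double_broom s beta gamma) G A (s./2 + beta).
Proof.
move=> s2 evens beta1 Ax Ay Gxy; have s0 : 0 < s by exact: ltnW.
pose al (i : 'I_s) := if i == 0 :> nat then beta
                      else if i == s.-1 :> nat then gamma else 0.
pose v0 := Ordinal s0; pose k0 : 'I_(al v0) := Ordinal beta1.
have <- : #|@colour_set s al (fun i => false (+) odd i)
             (fun i => ~~ (false (+) odd i))| = s./2 + beta.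
  rewrite card_colour_set; apply: etrans (sum_broom (fun i => false (+) odd i)
    (fun i => ~~ (false (+) odd i)) beta gamma s2) _; rewrite cnt_parity.
  by case: s s2 evens {s0 al v0 k0} => [|s] //= _; rewrite negbK => ->; lia.
apply: (@leaf_overplaceable _ _ _ (@leaf s al v0 k0) (inl v0) x y) => //.
- exact: alternating_cover.
- by rewrite inE.
- by rewrite adj_sym adj_leaf.
- by case=> [i|l]; rewrite ?adj_leaves // adj_sym adj_leaf => /eqP/= <-.
Qed.

Lemma spine_overplaceable s (alpha : 'I_s -> nat) (b : nat -> bool)
    (f : nat -> option W) c :
  (forall i v, i < s -> f i = Some v -> (v \in A) = b i) ->
  (forall i j v, i < s -> j < s -> f i = Some v -> f j = Some v -> i = j) ->
  (forall i, i.+1 < s -> b i = b i.+1 ->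
     exists u v, [/\ f i = Some u, f i.+1 = Some v & adj G u v]) ->
  \sum_(i < s) (b i + ~~ b i * alpha i) < c ->
  overplaceable (caterpillar alpha) G A c.
Proof.
move=> fA injf spinef ltc; exists (@colour_set s alpha b (fun i => ~~ b i)).
exists (fun x : 'I_s + {i : 'I_s & 'I_(alpha i)} => if x is inl i then f i else None).
by split; [exact: spine_placeable | rewrite card_colour_set].
Qed.

(* In the spine colourings below the colours alternate, except that the prescribed
   edges of [G] are inserted as monochromatic spine edges near the first vertex. *)
Lemma inner_edge s (alpha : 'I_s -> nat) c x y :
  x \in A -> y \in A -> adj G x y ->
  \sum_(i < s) (((i == 0 :> nat) || odd i) + ~~ ((i == 0 :> nat) || odd i) * alpha i) < c ->
  overplaceable (caterpillar alpha) G A c.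
Proof.
move=> Ax Ay Gxy; have xy : x <> y by move=> e; rewrite e adj_irrefl in Gxy.
apply: (@spine_overplaceable _ _ (fun i => (i == 0) || odd i)
  (fun i => match i with 0 => Some x | 1 => Some y | _ => None end)).
- by case=> [|[|i]] v //= _ [<-]; rewrite ?Ax ?Ay.
- by case=> [|[|i]] [|[|j]] v /=; congruence.
- by case=> [|[|i]] /= _; [exists x, y | | case: (odd i)].
Qed.

(** Spine pattern A A A B A B ..., with B for the complement of [A]. *)
Lemma inner_path s (alpha : 'I_s -> nat) c x y z :
  x \in A -> y \in A -> z \in A -> adj G x y -> adj G y z -> x != z ->
  let b i := (i == 1) || ~~ odd i in
  \sum_(i < s) (b i + ~~ b i * alpha i) < c ->
  overplaceable (caterpillar alpha) G A c.
Proof.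
move=> Ax Ay Az Gxy Gyz /eqP xz b.
have xy : x <> y by move=> e; rewrite e adj_irrefl in Gxy.
have yz : y <> z by move=> e; rewrite e adj_irrefl in Gyz.
apply: (@spine_overplaceable _ _ b
  (fun i => match i with 0 => Some x | 1 => Some y | 2 => Some z | _ => None end)).
- by case=> [|[|[|i]]] v //= _ [<-]; rewrite ?Ax ?Ay ?Az.
- by case=> [|[|[|i]]] [|[|[|j]]] v /=; congruence.
- rewrite /b; by case=> [|[|[|i]]] /= _; [exists x, y | exists y, z | | case: (odd i)].
Qed.

(** Spine pattern A A B A A B A B ... *)
Lemma inner_two_edges s (alpha : 'I_s -> nat) c x y z w :
  x \in A -> y \in A -> z \in A -> w \in A -> adj G x y -> adj G z w ->
  [/\ x != z, x != w, y != z & y != w] ->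
  let b i := [|| i == 1, i == 3 | ~~ odd i && (i != 2)] in
  \sum_(i < s) (b i + ~~ b i * alpha i) < c ->
  overplaceable (caterpillar alpha) G A c.
Proof.
move=> Ax Ay Az Aw Gxy Gzw [/eqP xz /eqP xw /eqP yz /eqP yw] b.
have xy : x <> y by move=> e; rewrite e adj_irrefl in Gxy.
have zw : z <> w by move=> e; rewrite e adj_irrefl in Gzw.
apply: (@spine_overplaceable _ _ b (fun i => match i with
  0 => Some x | 1 => Some y | 3 => Some z | 4 => Some w | _ => None end)).
- by case=> [|[|[|[|[|i]]]]] v //= _ [<-]; rewrite ?Ax ?Ay ?Az ?Aw.
- by case=> [|[|[|[|[|i]]]]] [|[|[|[|[|j]]]]] v /=; congruence.
- rewrite /b; case=> [|[|[|[|[|i]]]]] /= _ //; [by exists x, y | by exists z, w |].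
  by rewrite !negbK !andbT; case: (odd i).
Qed.

(** Spine pattern A B B B A B A ... *)
Lemma outer_path s (alpha : 'I_s -> nat) c x y z :
  x \notin A -> y \notin A -> z \notin A -> adj G x y -> adj G y z -> x != z ->
  let b i := ~~ odd i && (i != 2) in
  \sum_(i < s) (b i + ~~ b i * alpha i) < c ->
  overplaceable (caterpillar alpha) G A c.
Proof.
move=> Ax Ay Az Gxy Gyz /eqP xz b.
have xy : x <> y by move=> e; rewrite e adj_irrefl in Gxy.
have yz : y <> z by move=> e; rewrite e adj_irrefl in Gyz.
apply: (@spine_overplaceable _ _ b (fun i => match i with
  1 => Some x | 2 => Some y | 3 => Some z | _ => None end)).
- by case=> [|[|[|[|i]]]] v //= _ [<-]; rewrite ?(negbTE Ax) ?(negbTE Ay) ?(negbTE Az).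
- by case=> [|[|[|[|i]]]] [|[|[|[|j]]]] v /=; congruence.
- rewrite /b; case=> [|[|[|[|i]]]] /= _ //; [by exists x, y | by exists y, z |].
  by rewrite !negbK !andbT; case: (odd i).
Qed.

(** Spine pattern A B B A B B A B ... *)
Lemma outer_two_edges s (alpha : 'I_s -> nat) c x y z w :
  x \notin A -> y \notin A -> z \notin A -> w \notin A -> adj G x y -> adj G z w ->
  [/\ x != z, x != w, y != z & y != w] ->
  let b i := (i == 3) || [&& ~~ odd i, i != 2 & i != 4] in
  \sum_(i < s) (b i + ~~ b i * alpha i) < c ->
  overplaceable (caterpillar alpha) G A c.
Proof.
move=> Ax Ay Az Aw Gxy Gzw [/eqP xz /eqP xw /eqP yz /eqP yw] b.
have xy : x <> y by move=> e; rewrite e adj_irrefl in Gxy.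
have zw : z <> w by move=> e; rewrite e adj_irrefl in Gzw.
apply: (@spine_overplaceable _ _ b (fun i => match i with
  1 => Some x | 2 => Some y | 4 => Some z | 5 => Some w | _ => None end)).
- by case=> [|[|[|[|[|[|i]]]]]] v //= _ [<-];
    rewrite ?(negbTE Ax) ?(negbTE Ay) ?(negbTE Az) ?(negbTE Aw).
- by case=> [|[|[|[|[|[|i]]]]]] [|[|[|[|[|[|j]]]]]] v /=; congruence.
- rewrite /b; case=> [|[|[|[|[|[|i]]]]]] /= _ //; [by exists x, y | by exists z, w |].
  by rewrite !negbK !andbT; case: (odd i).
Qed.


(** For even [s] the pattern A A B A ... B A has s/2 + 1 spine vertices on the A-side, one above the
    optimal cover; for odd [s] there would be no excess. *)
Lemma inner_edge_regular s beta x y : 2 <= s -> ~~ odd s -> 2 <= beta ->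
  x \in A -> y \in A -> adj G x y ->
  overplaceable (regular_caterpillar s beta) G A (s./2 * beta + uphalf s).
Proof.
move=> s2 evens beta2 Ax Ay Gxy; apply: inner_edge Ax Ay Gxy _.
apply: (@sum_regular_lt (fun i => (i == 0) || odd i)) => //.
rewrite (@cnt_tail _ 1) ?(ltnW s2) //.
by rewrite cntS cnt0 /=; lia.
Qed.

(** Both ends of the spine are on the A-side, so no leaf is, and s/2 + 1 < s/2 + beta. *)
Lemma inner_edge_broom s beta gamma x y : 2 <= s -> ~~ odd s -> 2 <= beta ->
  x \in A -> y \in A -> adj G x y ->
  overplaceable (double_broom s beta gamma) G A (s./2 + beta).
Proof.
move=> s2 evens beta2 Ax Ay Gxy; apply: inner_edge Ax Ay Gxy _.
apply: leq_ltn_trans (eq_leq (sum_broom (fun i => (i == 0) || odd i)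
  (fun i => ~~ ((i == 0) || odd i)) beta gamma s2)) _.
rewrite (@cnt_tail _ 1) ?(ltnW s2) //.
rewrite cntS cnt0 /= (_ : odd s.-1); last by lia.
by rewrite orbT /=; lia.
Qed.

Lemma inner_path_regular s beta x y z : 3 <= s -> odd s -> 2 <= beta ->
  x \in A -> y \in A -> z \in A -> adj G x y -> adj G y z -> x != z ->
  overplaceable (regular_caterpillar s beta) G A (s./2 * beta + uphalf s).
Proof.
move=> s3 odds beta2 Ax Ay Az Gxy Gyz xz; apply: inner_path Ax Ay Az Gxy Gyz xz _.
apply: (@sum_regular_lt (fun i => (i == 1) || ~~ odd i)) => //; first exact: ltnW.
rewrite (@cnt_tail _ 2) ?(ltnW s3) // => [|i]; last by rewrite /= negbK.
by rewrite !cntS cnt0 /=; lia.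
Qed.

Lemma inner_two_edges_regular s beta x y z w : 5 <= s -> odd s -> 2 <= beta ->
  x \in A -> y \in A -> z \in A -> w \in A -> adj G x y -> adj G z w ->
  [/\ x != z, x != w, y != z & y != w] ->
  overplaceable (regular_caterpillar s beta) G A (s./2 * beta + uphalf s).
Proof.
move=> s5 odds beta2 Ax Ay Az Aw Gxy Gzw dist.
apply: inner_two_edges Ax Ay Az Aw Gxy Gzw dist _.
apply: (@sum_regular_lt (fun i => [|| i == 1, i == 3 | ~~ odd i && (i != 2)])) => //.
  by lia.
rewrite (@cnt_tail _ 4) ?(ltnW s5) // => [|i]; last by rewrite /= !negbK andbT.
by rewrite !cntS cnt0 /=; lia.
Qed.

(** The third spine vertex is moved off the A-side; s >= 5 ensures that it is not the end carrying
    the [gamma] leaves. *)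
Lemma outer_path_broom s beta gamma x y z : 5 <= s -> odd s ->
  x \notin A -> y \notin A -> z \notin A -> adj G x y -> adj G y z -> x != z ->
  overplaceable (double_broom s beta gamma) G A (uphalf s).
Proof.
move=> s5 odds Ax Ay Az Gxy Gyz xz; have s2 : 2 <= s by lia.
apply: outer_path Ax Ay Az Gxy Gyz xz _.
apply: leq_ltn_trans (eq_leq (sum_broom (fun i => ~~ odd i && (i != 2))
  (fun i => ~~ (~~ odd i && (i != 2))) beta gamma s2)) _.
rewrite (@cnt_tail _ 3) => [||i]; last by rewrite /= !negbK andbT.
  rewrite !cntS cnt0 /= (_ : odd s.-1 = false); last by lia.
  have -> : s.-1 != 2 by lia.
  by rewrite /=; lia.
by lia.
Qed.

(** The third and fifth spine vertices are exchanged for the fourth; s >= 7 keeps both ends of the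
    spine on the A-side. *)
Lemma outer_two_edges_broom s beta gamma x y z w : 7 <= s -> odd s ->
  x \notin A -> y \notin A -> z \notin A -> w \notin A -> adj G x y -> adj G z w ->
  [/\ x != z, x != w, y != z & y != w] ->
  overplaceable (double_broom s beta gamma) G A (uphalf s).
Proof.
move=> s7 odds Ax Ay Az Aw Gxy Gzw dist; have s2 : 2 <= s by lia.
apply: outer_two_edges Ax Ay Az Aw Gxy Gzw dist _.
pose b i := (i == 3) || [&& ~~ odd i, i != 2 & i != 4].
apply: leq_ltn_trans (eq_leq (sum_broom b (fun i => ~~ b i) beta gamma s2)) _.
rewrite (@cnt_tail _ 5) => [||i]; last by rewrite /b /= !negbK andbT.
  rewrite !cntS cnt0 /b /= (_ : odd s.-1 = false); last by lia.
  have [ns3 ns2 ns4] : [/\ s.-1 == 3 = false, s.-1 != 2 & s.-1 != 4] by split; lia.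
  by rewrite ns3 ns2 ns4 /=; lia.
by lia.
Qed.

(** Only the last spine vertex goes to [A]. The first one goes to [y], and the middle one and the
    [beta] leaves use beta + 1 neighbours of [y]. *)
Lemma outer_star_broom beta gamma y (X : {set W}) : y \notin A ->
  {in X, forall x, x \notin A /\ adj G y x} -> beta < #|X| ->
  overplaceable (double_broom 3 beta gamma) G A 2.
Proof.
move=> Ay XP ltX; pose e i := nth y (enum X) i.
have eX i : i <= beta -> e i \in X.
  by move=> lei; rewrite -mem_enum mem_nth // -cardE (leq_ltn_trans lei).
have inje i j : i <= beta -> j <= beta -> e i = e j -> i = j.
  move=> lei lej /eqP; rewrite nth_uniq ?enum_uniq -?cardE ?(leq_ltn_trans lei) //;
    last exact: leq_ltn_trans ltX.
  by move/eqP.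
have ye i : i <= beta -> y <> e i.
  by move=> /eX/XP[_] + eqy; rewrite -eqy adj_irrefl.
pose al (i : 'I_3) := if i == 0 :> nat then beta
                      else if i == 2 :> nat then gamma else 0.
have ltk (i : 'I_3) (k : 'I_(al i)) : i == 0 :> nat -> k < beta.
  by move=> i0; apply: leq_trans (ltn_ord k) _; rewrite /al i0.
pose f (t : 'I_3 + {i : 'I_3 & 'I_(al i)}) : option W := match t with
  | inl i => if i == 0 :> nat then Some y else if i == 1 :> nat then Some (e beta) else None
  | inr (existT i k) => if i == 0 :> nat then Some (e k) else None end.
exists (@colour_set 3 al (fun i => i == 2) (fun i => i == 1)), f; split; last first.
  by rewrite card_colour_set (@sum_broom (fun i => i == 2) (fun i => i == 1) 3) // !cntS cnt0.
apply: caterpillar_placeable.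
- move=> [i|[i k]] v; rewrite inE /=.
    case: (val i == 0) / eqP => [->|_] /=; first by move=> [<-]; apply/negbTE.
    case: (val i == 1) / eqP => [->|//] [<-]; apply/negbTE.
    by case: (XP _ (eX beta (leqnn _))).
  case: (val i == 0) / eqP => [i0|//] [<-]; rewrite i0 /=; apply/negbTE.
  by case: (XP _ (eX k _)) => //; apply: ltnW; apply: ltk; rewrite i0.
- move=> [i|[i k]] [j|[j k']] v /=.
  + case: (val i == 0) / eqP => [i0|_]; case: (val j == 0) / eqP => [j0|_] //.
    * by move=> _ _; congr inl; apply: val_inj; rewrite i0 j0.
    * by case: eqP => // _ [<-] [/esym/ye]; case.
    * by case: eqP => // _ [<-] [/ye]; case.
    case: (val i == 1) / eqP => [i1|//]; case: (val j == 1) / eqP => [j1|//].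
    by move=> _ _; congr inl; apply: val_inj; rewrite i1 j1.
  + case: (val j == 0) / eqP => [j0|//]; have := @ltk j k'; rewrite j0 => /(_ isT) lt.
    case: eqP => [_ [<-] [/esym/ye]|_]; first by case; apply: ltnW.
    case: eqP => // _ [<-] [eqe].
    by have := inje _ _ (ltnW lt) (leqnn _) eqe; lia.
  + case: (val i == 0) / eqP => [i0|//]; have := @ltk i k; rewrite i0 => /(_ isT) lt.
    case: eqP => [_ [<-] [/ye]|_]; first by case; apply: ltnW.
    case: eqP => // _ [<-] [eqe].
    by have := inje _ _ (leqnn _) (ltnW lt) eqe; lia.
  + case: (val i == 0) / eqP => [i0|//]; case: (val j == 0) / eqP => [j0|//].
    have ij : i = j by apply: val_inj; rewrite i0 j0.
    subst j; have := @ltk i k; have := @ltk i k'; rewrite i0 => /(_ isT) lt' /(_ isT) lt.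
    move=> [<-] [/inje] eqk; congr (inr (existT _ _ _)).
    by apply: val_inj; rewrite /= eqk // ltnW.
- move=> i j ij bij; have i0 : i = 0 :> nat.
    by move: bij; rewrite ij; have := ltn_ord j; rewrite ij; case: (val i) => [|[|[|?]]].
  rewrite /= i0 ij i0 /=; exists y, (e beta); split=> //.
  by case: (XP _ (eX beta (leqnn _))).
- move=> [i k] /= bi; have i0 : i = 0 :> nat.
    by move: k bi; rewrite /al; case: i => [[|[|[|?]]]] //= lti [].
  rewrite i0 /=; exists y, (e k); split=> //.
  by case: (XP _ (eX k _)) => //; apply: ltnW; apply: ltk; rewrite i0.
Qed.

(** Here leaf edges may be monochromatic too. [h] assigns one image per spine position, so it may be
    used only where there is at most one leaf. *)
Lemma spine_leaf_overplaceable s (alpha : 'I_s -> nat) (b lb : nat -> bool)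
    (g h : nat -> option W) c :
  (forall i v, g i = Some v -> (v \in A) = b i) ->
  (forall i v, h i = Some v -> (v \in A) = lb i) ->
  (forall i j v, g i = Some v -> g j = Some v -> i = j) ->
  (forall i j v, h i = Some v -> h j = Some v -> i = j) ->
  (forall i j v, g i = Some v -> h j = Some v -> False) ->
  (forall i : 'I_s, h i <> None -> alpha i <= 1) ->
  (forall i, i.+1 < s -> b i = b i.+1 ->
     exists u v, [/\ g i = Some u, g i.+1 = Some v & adj G u v]) ->
  (forall i : 'I_s, 0 < alpha i -> b i = lb i ->
     exists u v, [/\ g i = Some u, h i = Some v & adj G u v]) ->
  \sum_(i < s) (b i + lb i * alpha i) < c ->
  overplaceable (caterpillar alpha) G A c.
Proof.
move=> gA hA injg injh gh h1 spine leaves ltc; exists (@colour_set s alpha b lb).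
exists (fun x : 'I_s + {i : 'I_s & 'I_(alpha i)} =>
  match x with inl i => g i | inr l => h (tag l) end).
split; last by rewrite card_colour_set.
apply: caterpillar_placeable.
- by move=> [i|[i k]] v; rewrite inE /=; [apply: gA | apply: hA].
- move=> [i|[i k]] [j|[j k']] v /= fi fj.
  + by congr inl; apply: val_inj; apply: injg fi fj.
  + by case: (gh _ _ _ fi fj).
  + by case: (gh _ _ _ fj fi).
  + have ij : i = j by apply: val_inj; apply: injh fi fj.
    subst j; congr (inr (existT _ _ _)); apply: val_inj => /=.
    have : alpha i <= 1 by apply: h1; rewrite fi.
    by have := ltn_ord k; have := ltn_ord k'; lia.
- by move=> i j ij; rewrite ij; apply: spine; rewrite -ij.
- by move=> [i k] /= bi; apply: leaves => //; apply: leq_ltn_trans (ltn_ord k).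
Qed.

(** The component is a path on five vertices: its middle vertex goes to [A], and the two outer edges
    realise the two pendant edges. *)
Lemma outer_two_edges_path5 x y z w :
  x \notin A -> y \notin A -> z \notin A -> w \notin A -> adj G x y -> adj G z w ->
  [/\ x != z, x != w, y != z & y != w] ->
  overplaceable (double_broom 3 1 1) G A 2.
Proof.
move=> /negbTE Ax /negbTE Ay /negbTE Az /negbTE Aw Gxy Gzw.
move=> [/eqP xz /eqP xw /eqP yz /eqP yw].
have xy : x <> y by move=> e; rewrite e adj_irrefl in Gxy.
have zw : z <> w by move=> e; rewrite e adj_irrefl in Gzw.
apply: (@spine_leaf_overplaceable _ _ (fun i => i == 1) (fun i => false)
  (fun i => match i with 0 => Some x | 2 => Some z | _ => None end)
  (fun i => match i with 0 => Some y | 2 => Some w | _ => None end)).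
- by case=> [|[|[|i]]] v //= [<-].
- by case=> [|[|[|i]]] v //= [<-].
- by case=> [|[|[|i]]] [|[|[|j]]] v /=; congruence.
- by case=> [|[|[|i]]] [|[|[|j]]] v /=; congruence.
- by case=> [|[|[|i]]] [|[|[|j]]] v /=; congruence.
- by case=> [[|[|[|i]]] lti].
- by case=> [|[|i]].
- by case=> [[|[|[|i]]] lti] //= _ _; [exists x, y | exists z, w].
- by rewrite (@sum_broom (fun i => i == 1) (fun i => false) 3) // !cntS cnt0.
Qed.

(** Spine pattern B A B B A with the single leaf at the first spine vertex also in B: one edge
    serves as this pendant edge, the other as the middle of the spine. *)
Lemma outer_two_edges_broom5 gamma x y z w :
  x \notin A -> y \notin A -> z \notin A -> w \notin A -> adj G x y -> adj G z w ->
  [/\ x != z, x != w, y != z & y != w] ->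
  overplaceable (double_broom 5 1 gamma) G A 3.
Proof.
move=> /negbTE Ax /negbTE Ay /negbTE Az /negbTE Aw Gxy Gzw.
move=> [/eqP xz /eqP xw /eqP yz /eqP yw].
have xy : x <> y by move=> e; rewrite e adj_irrefl in Gxy.
have zw : z <> w by move=> e; rewrite e adj_irrefl in Gzw.
pose b i := (i == 1) || (i == 4); pose lb i := (i == 2) || (i == 3).
apply: (@spine_leaf_overplaceable _ _ b lb
  (fun i => match i with 0 => Some x | 2 => Some z | 3 => Some w | _ => None end)
  (fun i => match i with 0 => Some y | _ => None end)).
- by case=> [|[|[|[|i]]]] v //= [<-].
- by case=> [|i] v //= [<-].
- by case=> [|[|[|[|i]]]] [|[|[|[|j]]]] v /=; congruence.
- by case=> [|i] [|j] v /=; congruence.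
- by case=> [|[|[|[|i]]]] [|j] v /=; congruence.
- by case=> [[|i] lti].
- by case=> [|[|[|[|i]]]] //= _ _; exists z, w.
- by case=> [[|[|[|[|[|i]]]]] lti] //= _ _; exists x, y.
- by rewrite (@sum_broom b lb 5) // !cntS cnt0.
Qed.

End Placements.

(** * Traces of embedded caterpillars on a vertex set *)

Definition edgeless (W : finType) (H : sgraph W) (Q : pred W) :=
  forall x y, Q x -> Q y -> ~~ adj H x y.

(** At most one edge; an edgeless [Q] is allowed. *)
Definition single_edge (W : finType) (H : sgraph W) (Q : pred W) :=
  forall x y x' y', Q x -> Q y -> Q x' -> Q y' -> adj H x y -> adj H x' y' ->
    (x = x' /\ y = y') \/ (x = y' /\ y = x').

Section Traces.
Variables (W : finType) (H : sgraph W) (A : {set W}).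

Section Regular.
Variables (s beta : nat).
Local Notation C := (regular_caterpillar s beta).
Variable f : ('I_s + {i : 'I_s & 'I_beta})%type -> W.
Hypotheses (beta1 : 1 <= beta) (homf : injhom C H f)
  (noH : edgeless H (fun x => x \notin A)).

(** A spine vertex outside [A] forces all its leaves into [A], so [bad] such vertices give a trace
    of at least s - bad + bad * beta, which is nondecreasing in [bad] and equals s when beta = 1. *)
Lemma regular_trace :
  beta = 1 \/ s./2 <= \sum_(i < s) (f (inl i) \notin A) ->
  s./2 * beta + uphalf s <= #|f @^-1: A|.
Proof.
move=> lebad; set bad := \sum_(i < s) _ in lebad.
have le1 : \sum_(i < s) (f (inl i) \in A) + bad * beta <= #|f @^-1: A|.
  rewrite (@card_caterpillar_set s (fun _ => beta)) /bad big_distrl -big_split /=.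
  apply: leq_sum => i _; rewrite inE leq_add2l.
  case: (boolP (f (inl i) \in A)) => Ai //=; rewrite mul1n -[leqLHS]card_ord.
  apply: subset_leq_card; apply/subsetP => k _; rewrite !inE.
  apply: contraLR Ai => Ak; apply/negP => Ai.
  have := noH Ai Ak; rewrite (proj2 homf) // (@adj_leaf s (fun _ => beta)) //=.
have sumE : \sum_(i < s) (f (inl i) \in A) + bad = s.
  rewrite /bad -big_split /= -[RHS]card_ord -sum1_card; apply: eq_bigr => i _.
  by case: (_ \in A).
apply: leq_trans le1; have : s = s./2 + uphalf s by lia.
case: lebad => [e|lebad] es; last by nia.
by rewrite [X in _ * X]e [X in _ <= _ + _ * X]e; lia.
Qed.

(** If the whole spine lay in [A], its middle vertex would have two neighbours inside [A]. *)
Lemma regular_trace3 : s = 3 ->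
  (forall x y z, x \in A -> y \in A -> z \in A -> adj H x y -> adj H x z -> y = z) ->
  s./2 * beta + uphalf s <= #|f @^-1: A|.
Proof.
move=> s3 degA; apply: regular_trace; right; rewrite {1}s3.
rewrite lt0n sum_nat_eq0 negb_forall; apply/existsP.
suff [i Ai] : exists i, f (inl i) \notin A by exists i; rewrite Ai.
apply/existsP; rewrite -negb_forall; apply/negP => /forallP allA.
have lt0 : 0 < s by rewrite s3. have lt1 : 1 < s by rewrite s3.
have lt2 : 2 < s by rewrite s3.
have Hadj i j (lti : i < s) (ltj : j < s) : j = i.+1 \/ i = j.+1 ->
    adj H (f (inl (Ordinal lti))) (f (inl (Ordinal ltj))).
  move=> ij; apply: (proj2 homf); rewrite (@adj_spine s (fun _ => beta)) /=.
  by case: ij => ->; rewrite eqxx ?orbT.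
by have /(proj1 homf) [] := degA _ _ _ (allA (Ordinal lt1)) (allA (Ordinal lt0))
  (allA (Ordinal lt2)) (Hadj 1 0 lt1 lt0 (or_intror erefl))
  (Hadj 1 2 lt1 lt2 (or_introl erefl)).
Qed.

(** [path_cover1] applied to the spine, with [A] in the role of [Q]: at least (s - 1)/2 spine
    vertices are outside [A]. *)
Lemma regular_trace_odd : odd s -> single_edge H (mem A) ->
  s./2 * beta + uphalf s <= #|f @^-1: A|.
Proof.
move=> odds oneA; apply: regular_trace; right.
have s0 : 0 < s by case: (s) odds.
pose h i := f (inl (insubd (Ordinal s0) i)).
have := @path_cover1 W H (mem A) h s _ _ s./2 _ oneA.
rewrite /cnt; under eq_bigr => i _ do rewrite /h valKd; apply.
- move=> i j lti ltj /(proj1 homf) [] /(congr1 val).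
  by rewrite !val_insubd lti ltj.
- move=> i lti; apply: (proj2 homf); rewrite (@adj_spine s (fun _ => beta)).
  by rewrite !val_insubd lti (ltnW lti) eqxx.
- by lia.
Qed.

End Regular.

(** The spine prolonged by one leaf at each end; it carries all the information that the trace
    bounds below need. *)
Lemma broom_path s beta gamma : 2 <= s -> 1 <= beta -> 1 <= gamma ->
  exists h : nat -> 'I_s + {i : 'I_s & 'I_(if i == 0 :> nat then beta
                       else if i == s.-1 :> nat then gamma else 0)},
  (forall i j, i < s.+2 -> j < s.+2 -> h i = h j -> i = j) /\
  (forall i, i.+1 < s.+2 -> adj (double_broom s beta gamma) (h i) (h i.+1)).
Proof.
move=> s2 beta1 gamma1; have s0 : 0 < s by exact: ltnW.
pose al (i : 'I_s) := if i == 0 :> nat then beta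
                      else if i == s.-1 :> nat then gamma else 0.
pose v0 := Ordinal s0; pose k0 : 'I_(al v0) := Ordinal beta1.
have lt1 : s.-1 < s by rewrite prednK.
pose v1 := Ordinal lt1.
have al1 : 0 < al v1 by rewrite /al /= eqxx; case: eqP => //; lia.
pose k1 : 'I_(al v1) := Ordinal al1.
(* Positions are shifted by one: 0 is the first leaf, i + 1 the spine vertex i, and s + 1 the last
   leaf. *)
exists (fun i => if i is i'.+1 then
  if i' < s then inl (insubd v0 i') else @leaf s al v1 k1 else @leaf s al v0 k0).
have neq01 : v0 <> v1 by move=> /(congr1 val) /=; lia.
split.
- have leafN : @leaf s al v0 k0 <> @leaf s al v1 k1.
    by move=> /(congr1 (fun x => if x is inr l then tag l else v0)) /neq01.
  case=> [|i] [|j] lti ltj //.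
  + by case: ltnP.
  + by case: ltnP => // _ /esym.
  case: ltnP => lt1i; case: ltnP => lt1j //.
    by move=> [] /(congr1 val); rewrite !val_insubd lt1i lt1j => ->.
  by move=> _; lia.
- case=> [|i] lti.
    rewrite s0 adj_sym (@adj_leaf s al) /=; apply/eqP/val_inj.
    by rewrite val_insubd s0.
  have lei : i < s by lia.
  rewrite lei; case: ltnP => lti1.
    by rewrite (@adj_spine s al) !val_insubd lei lti1 eqxx.
  rewrite (@adj_leaf s al) /=; apply/eqP/val_inj; rewrite val_insubd lei /=; lia.
Qed.

Section Broom.
Variables (s beta gamma : nat).
Local Notation C := (double_broom s beta gamma).
Variable f : ('I_s + {i : 'I_s & 'I_(if i == 0 :> nat then beta
                       else if i == s.-1 :> nat then gamma else 0)})%type -> W.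
Hypotheses (s2 : 2 <= s) (beta1 : 1 <= beta) (lebg : beta <= gamma)
  (homf : injhom C H f).

(** The path on s + 2 vertices contains floor(s/2) + 1 disjoint edges, each of which meets [A]; this
    is tau of the component when [s] is odd or beta = 1. *)
Lemma broom_trace : (~~ odd s -> beta = 1) -> edgeless H (fun x => x \notin A) ->
  (if odd s then uphalf s else s./2 + beta) <= #|f @^-1: A|.
Proof.
move=> betaE noH; have [h [injh homh]] := broom_path s2 beta1 (leq_trans beta1 lebg).
have -> : (if odd s then uphalf s else s./2 + beta) = s./2.+1.
  by case: (boolP (odd s)) => [odds|/betaE ->]; lia.
apply: leq_trans (path_card injh _).
have := @path_cover W H (fun x => x \notin A) (fun i => f (h i)) s.+2 _ s./2.+1 _ noH.
rewrite /cnt; under eq_bigr => i _ do rewrite negbK.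
under [X in _ -> _ <= X]eq_bigr => i _ do rewrite inE.
apply; first by move=> i /homh /(proj2 homf).
by lia.
Qed.

(** For odd [s] the path has an odd number s + 2 of vertices, so by [path_cover1] a single edge
    outside [A] does not reduce the (s + 1)/2 vertices required in [A]. *)
Lemma broom_trace_odd : odd s -> single_edge H (fun x => x \notin A) ->
  uphalf s <= #|f @^-1: A|.
Proof.
move=> odds oneH; have [h [injh homh]] := broom_path s2 beta1 (leq_trans beta1 lebg).
apply: leq_trans (path_card injh _).
have := @path_cover1 W H (fun x => x \notin A) (fun i => f (h i)) s.+2 _ _ (uphalf s) _ oneH.
rewrite /cnt; under eq_bigr => i _ do rewrite negbK.
under [X in _ -> _ <= X]eq_bigr => i _ do rewrite inE.
apply.
- by move=> i j lti ltj /(proj1 homf) /injh; apply.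
- by move=> i /homh /(proj2 homf).
- by lia.
Qed.

End Broom.

(** A star with more than [d] leaves cannot lie outside [A]; disjoint stars in a component thus
    yield distinct vertices of its trace. *)
Lemma star_trace (T : finType) (F : sgraph T) (f : T -> W) (d : nat) (v : T)
    (X : {set T}) :
  injhom F H f -> (forall w, w \notin A -> degin H (~: A) w <= d) -> d < #|X| ->
  {in X, forall x, adj F v x} -> exists2 x, x \in v |: X & f x \in A.
Proof.
move=> [injf homf] degA ltX vX; apply/exists_inP; apply: contraTT ltX.
move=> /exists_inPn noA; rewrite -leqNgt.
apply: leq_trans (degA (f v) (noA v (setU11 _ _))).
rewrite deginE -(card_imset _ injf); apply: subset_leq_card.
apply/subsetP => _ /imsetP[x Xx ->]; rewrite !inE homf ?vX // andbT.
by apply: noA; rewrite setU1r.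
Qed.

Section Broom35.
Variables (s beta gamma : nat).
Local Notation alpha := (fun i : 'I_s => if i == 0 :> nat then beta
                       else if i == s.-1 :> nat then gamma else 0).
Local Notation C := (double_broom s beta gamma).
Local Notation T := ('I_s + {i : 'I_s & 'I_(alpha i)})%type.

Definition leaves_at (i : 'I_s) : {set T} := [set @leaf s alpha i k | k : 'I_(alpha i)].

Lemma card_leaves_at i : #|leaves_at i| = alpha i.
Proof.
rewrite card_imset ?card_ord // => k k' [] /eqP; rewrite eq_Tagged => /eqP. exact.
Qed.

Lemma adj_leaves_at i x : x \in leaves_at i -> adj C (inl i) x.
Proof. by move=> /imsetP[k _ ->]; rewrite (@adj_leaf s alpha). Qed.

End Broom35.

(** Two disjoint stars: the first spine vertex with its leaves and the middle vertex, beta + 1 > d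
    in all, and the last spine vertex with gamma > d leaves. *)
Lemma broom_trace3 s beta gamma d f : s = 3 -> d <= beta -> beta < gamma ->
  injhom (double_broom s beta gamma) H f ->
  (forall w, w \notin A -> degin H (~: A) w <= d) -> 2 <= #|f @^-1: A|.
Proof.
move=> s3; subst s => led ltbg homf degA.
pose v0 := @Ordinal 3 0 isT; pose v1 := @Ordinal 3 1 isT; pose v2 := @Ordinal 3 2 isT.
have [x x0 Ax] : exists2 x, x \in inl v0 |: (inl v1 |: @leaves_at 3 beta gamma v0) & f x \in A.
  apply: (star_trace homf degA).
    have nv : inl v1 \notin @leaves_at 3 beta gamma v0 by apply/imsetP => -[].
    by rewrite cardsU1 nv card_leaves_at /= add1n ltnS.
  move=> x /setU1P[->|/adj_leaves_at //].
  by rewrite (@adj_spine 3).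
have [y y0 Ay] : exists2 x, x \in inl v2 |: @leaves_at 3 beta gamma v2 & f x \in A.
  apply: (star_trace homf degA); first by rewrite card_leaves_at /=; apply: leq_ltn_trans ltbg.
  by move=> w /adj_leaves_at.
have nxy : x != y.
  apply/negP => /eqP exy; subst y; move: x0 y0.
  by move=> /setU1P[->|/setU1P[->|/imsetP[k _ ->]]] /setU1P[|/imsetP[k' _]].
apply: (@leq_trans #|[set x; y]|); first by rewrite cards2 nxy.
by apply: subset_leq_card; apply/subsetP => z /set2P[]->; rewrite inE.
Qed.

(** Three disjoint stars with at least two leaves each, centred at the first, third and fifth spine
    vertices. *)
Lemma broom_trace5 s beta gamma f : s = 5 -> 2 <= beta -> beta <= gamma ->
  injhom (double_broom s beta gamma) H f ->
  (forall w, w \notin A -> degin H (~: A) w <= 1) -> 3 <= #|f @^-1: A|.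
Proof.
move=> s5; subst s => beta2 lebg homf degA.
pose v0 := @Ordinal 5 0 isT; pose v1 := @Ordinal 5 1 isT; pose v2 := @Ordinal 5 2 isT.
pose v3 := @Ordinal 5 3 isT; pose v4 := @Ordinal 5 4 isT.
have [x x0 Ax] : exists2 x, x \in inl v0 |: @leaves_at 5 beta gamma v0 & f x \in A.
  apply: (star_trace homf degA); first by rewrite card_leaves_at.
  by move=> x /adj_leaves_at.
have [y y0 Ay] : exists2 x, x \in inl v2 |: [set inl v1; inl v3] & f x \in A.
  apply: (star_trace homf degA); first by rewrite cards2.
  by move=> w /set2P[] ->; rewrite (@adj_spine 5).
have [z z0 Az] : exists2 x, x \in inl v4 |: @leaves_at 5 beta gamma v4 & f x \in A.
  apply: (star_trace homf degA); first by rewrite card_leaves_at; apply: leq_trans lebg.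
  by move=> w /adj_leaves_at.
have [nxy nxz nyz] : [/\ x != y, x != z & y != z].
  split; apply/negP => /eqP e.
  - by move: x0 y0; rewrite e => /setU1P[->|/imsetP[k _ ->]] /setU1P[|/set2P[]].
  - by move: x0 z0; rewrite e => /setU1P[->|/imsetP[k _ ->]] /setU1P[|/imsetP[k' _]].
  - by move: z0 y0; rewrite e => /setU1P[->|/imsetP[k _ ->]] /setU1P[|/set2P[]].
apply/card_geqP; exists [:: x; y; z]; split=> //=.
  by rewrite !inE negb_or nxy nxz nyz.
by move=> w; rewrite !inE => /or3P[] /eqP->; rewrite ?Ax ?Ay ?Az.
Qed.

End Traces.

(** * Joins *)

(** Passes from analysis to combinatorics: after this, G is known only through its join structure
    and the placements that its freeness forbids. *)
Lemma union_extremal_join (R : realType) (p : R) (I : finType) (V : I -> finType)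
    (Fj : forall i, sgraph (V i)) (rk : forall i, V i -> nat) (c : I -> nat) :
  (1 < p)%R -> (forall i, forest_rank (Fj i) (rk i)) ->
  (forall i, optimal_cover (Fj i) (c i)) -> 0 < \sum_i c i ->
  let F := disjoint_union Fj in
  [/\ tau F = \sum_i c i,
      forall (W : finType) (H : sgraph W) (A : {set W}), #|A| < \sum_i c i ->
        (forall x y, adj H x y -> (x \in A) != (y \in A)) -> subgraph_free F H &
      exists n0, forall n, n0 <= n -> \sum_i c i <= n /\
        forall G : sgraph 'I_n, subgraph_free F G -> e_ p G = ex_ p n F ->
        exists A : {set 'I_n}, [/\ #|A| = \sum_i c i - 1,
          forall x y, x \in A -> y \notin A -> adj G x y &
          forall i, ~ overplaceable (Fj i) G A (c i)]].
Proof.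
move=> hp rkF optc sum0 F.
have [[S [indS covS cardS]] minS] := union_optimal_cover optc.
pose q := \sum_i c i - 1; have qE : q.+1 = \sum_i c i by rewrite /q subn1 prednK.
have minS' S' : independent_set F S' -> edge_cover F S' -> q < #|S'|.
  by rewrite qE; apply: minS.
split.
- rewrite -cardS; apply: tauP => // S'; rewrite cardS; exact: minS.
- move=> W H A ltA; apply: (free_of_cover minS'); by rewrite -ltnS qE.
have [n1 n1P] := extremal_join (union_rank rkF) indS covS (etrans cardS (esym qE)) minS' hp.
pose k := #|{: {i : I & V i}}|.
(* Leaves at least [k] vertices outside [A], enough for all of [F]. *)
exists (maxn n1 (q + k).+1) => n; rewrite geq_max => /andP[/n1P nP nqk].
split; first by rewrite -qE; lia.
move=> G freeG exG; have [A [cardA joinA]] := nP G freeG exG.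
exists A; split=> // i [P [f [plP ltP]]]; move: freeG; apply/negP; rewrite negbK.
apply: (union_contains joinA optc plP ltP); first by rewrite cardA qE.
have := cardsC A; rewrite cardA card_ord -/k; lia.
Qed.

Section Join.
Variables (T U : finType) (G : sgraph T) (H : sgraph U).
Local Notation J := (graph_join G H).

Lemma adj_join_ll a b : adj J (inl a) (inl b) = adj G a b.
Proof.
rewrite adj_graph_of_rel /= [adj G b a]adj_sym orbb.
case: (boolP (adj G a b)) => [Gab|]; last by rewrite andbF.
by rewrite andbT; apply/eqP => -[e]; rewrite e adj_irrefl in Gab.
Qed.

Lemma adj_join_rr a b : adj J (inr a) (inr b) = adj H a b.
Proof.
rewrite adj_graph_of_rel /= [adj H b a]adj_sym orbb.
case: (boolP (adj H a b)) => [Hab|]; last by rewrite andbF.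
by rewrite andbT; apply/eqP => -[e]; rewrite e adj_irrefl in Hab.
Qed.

Lemma adj_join_lr a b : adj J (inl a) (inr b).
Proof. by rewrite adj_graph_of_rel. Qed.

Lemma adj_join_rl a b : adj J (inr b) (inl a).
Proof. by rewrite adj_graph_of_rel. Qed.

Definition left_part : {set T + U} := [set x | if x is inl _ then true else false].

Lemma card_left_part : #|left_part| = #|T|.
Proof.
have -> : left_part = inl @: [set: T].
  apply/setP => -[a|b]; rewrite inE; first by rewrite imset_f ?inE.
  by apply/esym/imsetP => -[].
by rewrite card_imset ?cardsT // => x y [].
Qed.

Lemma degin_join_right u : degin J (~: left_part) (inr u) = deg H u.
Proof.
rewrite degE /degin big_mkcond big_sumType /= big1 ?add0n => [|a _].
  by apply: eq_bigr => w _; rewrite !inE adj_join_rr.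
by rewrite !inE.
Qed.

Lemma deg_join_right u : deg J (inr u) = #|T| + deg H u.
Proof.
rewrite !degE big_sumType /=; congr addn.
  by rewrite -sum1_card; apply: eq_bigr => a _; rewrite adj_join_rl.
by apply: eq_bigr => w _; rewrite adj_join_rr.
Qed.

Lemma edgeless_join : edgeless H xpredT -> edgeless J (fun x => x \notin left_part).
Proof.
by move=> noH [a|b] [a'|b']; rewrite !inE // => _ _; rewrite adj_join_rr noH.
Qed.

Lemma single_edge_join_right :
  single_edge H xpredT -> single_edge J (fun x => x \notin left_part).
Proof.
move=> oneH [a|b] [a'|b'] [x|x] [y|y]; rewrite !inE // => _ _ _ _.
rewrite !adj_join_rr => bb' xy.
by have [[-> ->]|[-> ->]] := oneH _ _ _ _ isT isT isT isT bb' xy; [left|right].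
Qed.

Lemma single_edge_join_left : single_edge G xpredT -> single_edge J (mem left_part).
Proof.
move=> oneG [a|b] [a'|b'] [x|x] [y|y]; rewrite !inE // => _ _ _ _.
rewrite !adj_join_ll => bb' xy.
by have [[-> ->]|[-> ->]] := oneG _ _ _ _ isT isT isT isT bb' xy; [left|right].
Qed.

End Join.

Lemma adj_complete m (i j : 'I_m) : adj (complete_graph m) i j = (i != j).
Proof. by rewrite adj_graph_of_rel andbT. Qed.

Lemma adj_empty m (i j : 'I_m) : adj (empty_graph m) i j = false.
Proof. by rewrite adj_graph_of_rel andbF. Qed.

Lemma adj_max_matching m (i j : 'I_m) :
  adj (max_matching m) i j = (i != j) && (i./2 == j./2).
Proof. by rewrite adj_graph_of_rel [j./2 == _]eq_sym orbb. Qed.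

Lemma max_matching_unique m (i j k : 'I_m) :
  adj (max_matching m) i j -> adj (max_matching m) i k -> j = k.
Proof.
move: i j k => [i lti] [j ltj] [k ltk]; rewrite !adj_max_matching -!val_eqE /=.
by move=> ij ik; apply: val_inj => /=; lia.
Qed.

Lemma one_edge_single m : single_edge (one_edge m) xpredT.
Proof.
move=> i j k l _ _ _ _; rewrite !adj_graph_of_rel => /andP[_ ij] /andP[_ kl].
have : (i = k :> nat /\ j = l :> nat) \/ (i = l :> nat /\ j = k :> nat).
  by move: ij kl => /orP[] /andP[/eqP-> /eqP->] /orP[] /andP[/eqP-> /eqP->]; auto.
by case=> -[/val_inj-> /val_inj->]; auto.
Qed.

Lemma graph_iso_adj (T U : finType) (G : sgraph T) (H H' : sgraph U) :
  adj H =2 adj H' -> graph_iso G H -> graph_iso G H'.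
Proof. by move=> eqH [f bijf isof]; exists f => // x y; rewrite -eqH. Qed.

Section JoinIso.
Variables (n : nat) (G : sgraph 'I_n) (A : {set 'I_n}) (a b : nat).
Variables (x0 : 'I_n) (sA sB : seq 'I_n).
Hypotheses (cardA : #|A| = a) (cardB : #|~: A| = b)
  (joinA : forall x y, x \in A -> y \notin A -> adj G x y)
  (usA : uniq sA) (sAE : sA =i A) (usB : uniq sB) (sBE : sB =i ~: A).

(** The orders [sA] and [sB] are left free so that the edges inside a part can be lined up with
    those of a concrete graph. *)
Definition join_map (u : 'I_a + 'I_b) : 'I_n :=
  match u with inl i => nth x0 sA i | inr j => nth x0 sB j end.

Let sizeA : size sA = a.
Proof. by rewrite -cardA -(eq_card sAE) (card_uniqP usA). Qed.
Let sizeB : size sB = b.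
Proof. by rewrite -cardB -(eq_card sBE) (card_uniqP usB). Qed.

Lemma join_map_left i : join_map (inl i) \in A.
Proof. by rewrite -sAE mem_nth // sizeA. Qed.

Lemma join_map_right j : join_map (inr j) \notin A.
Proof. by rewrite -in_setC -sBE mem_nth // sizeB. Qed.

Lemma join_map_bij : bijective join_map.
Proof.
apply: inj_card_bij; last first.
  by rewrite card_sum !card_ord -cardA -cardB cardsC card_ord.
move=> [i|j] [i'|j'] /eqP e.
- by move: e; rewrite nth_uniq ?sizeA // => /eqP/val_inj->.
- by move: (join_map_left i); rewrite (eqP e) (negbTE (join_map_right j')).
- by move: (join_map_left i'); rewrite -(eqP e) (negbTE (join_map_right j)).
- by move: e; rewrite nth_uniq ?sizeB // => /eqP/val_inj->.
Qed.

Lemma join_iso (H1 : sgraph 'I_a) (H2 : sgraph 'I_b) :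
  (forall i j, adj G (join_map (inl i)) (join_map (inl j)) = adj H1 i j) ->
  (forall i j, adj G (join_map (inr i)) (join_map (inr j)) = adj H2 i j) ->
  graph_iso G (graph_join H1 H2).
Proof.
move=> adj1 adj2; have [g gK Kg] := join_map_bij.
exists g => [|x y]; first by exists join_map.
rewrite -{2}[x]Kg -{2}[y]Kg.
case: (g x) (g y) => [i|i] [j|j]; rewrite ?adj_join_ll ?adj_join_rr.
- by rewrite adj1.
- by rewrite adj_join_lr joinA ?join_map_left ?join_map_right.
- by rewrite adj_join_rl adj_sym joinA ?join_map_left ?join_map_right.
- by rewrite adj2.
Qed.

(* [G] embeds into an [F]-free graph on as many vertices, so extremality forces
   equality. *)
Lemma extremal_join_iso (R : realType) (p : R) (T : finType) (F : sgraph T)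
    (H1 : sgraph 'I_a) (H2 : sgraph 'I_b) :
  (1 < p)%R -> e_ p G = ex_ p n F -> subgraph_free F (graph_join H1 H2) ->
  (forall i j, adj G (join_map (inl i)) (join_map (inl j)) -> adj H1 i j) ->
  (forall i j, adj G (join_map (inr i)) (join_map (inr j)) -> adj H2 i j) ->
  graph_iso G (graph_join H1 H2).
Proof.
move=> hp exG freeJ hom1 hom2; have [g gK Kg] := join_map_bij.
pose J := graph_join H1 H2; pose G' := graph_of_rel (fun x y => adj J (g x) (g y)).
have adjG' x y : adj G' x y = adj J (g x) (g y).
  rewrite adj_graph_of_rel [adj J (g y) _]adj_sym orbb.
  by case: eqVneq => [->|//]; rewrite adj_irrefl.
have freeG' : subgraph_free F G'.
  apply: contra freeJ => /contains_trans; apply; apply/containsP; exists g.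
  by split=> [|x y]; [apply: can_inj Kg | rewrite adjG'].
have eqG : adj G =2 adj G'.
  apply: (extremal_adj hp freeG' exG) => x y; rewrite adjG'.
  rewrite -{1}[x]Kg -{1}[y]Kg.
  case: (g x) (g y) => [i|i] [j|j]; rewrite /J ?adj_join_ll ?adj_join_rr.
  - exact: hom1.
  - by rewrite adj_join_lr.
  - by rewrite adj_join_rl.
  - exact: hom2.
apply: join_iso => i j; rewrite eqG adjG' !gK.
  exact: adj_join_ll.
exact: adj_join_rr.
Qed.

End JoinIso.

Section Labellings.
Variables (V : finType) (G : sgraph V) (x0 : V).

(** Matched pairs are listed first, so each occupies positions 2k and 2k + 1. Only the inclusion
    into [max_matching] is claimed; equality comes from extremality. *)
Lemma matching_labelling (A : {set V}) :
  (forall x y z, x \in A -> y \in A -> z \in A -> adj G x y -> adj G x z -> y = z) ->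
  exists s : seq V, [/\ uniq s, s =i A & forall i j, i < size s -> j < size s ->
    adj G (nth x0 s i) (nth x0 s j) -> i./2 = j./2].
Proof.
move: {2}#|A| (leqnn #|A|) => m; elim: m A => [|m IHm] A leA matchA.
  exists [::]; split=> // x; rewrite in_nil; apply/esym/negbTE.
  by move: leA; rewrite leqn0 cards_eq0 => /eqP->; rewrite inE.
have [/exists_inP[x Ax /exists_inP[y Ay Gxy]]|noE] :=
    boolP [exists x in A, exists y in A, adj G x y]; last first.
  exists (enum A); split=> [||i j lti ltj Gij]; first exact: enum_uniq.
    exact: mem_enum.
  case/negP: noE; apply/exists_inP; exists (nth x0 (enum A) i).
    by rewrite -mem_enum mem_nth.
  by apply/exists_inP; exists (nth x0 (enum A) j); rewrite // -mem_enum mem_nth.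
have xy : x != y by apply: contraL Gxy => /eqP->; rewrite adj_irrefl.
have [||s [us sE matchs]] := IHm (A :\ x :\ y).
- by have := cardsD1 x A; rewrite Ax; have := subset_leq_card (subD1set (A :\ x) y); lia.
- by move=> u v w /setD1P[_ /setD1P[_ Au]] /setD1P[_ /setD1P[_ Av]]
    /setD1P[_ /setD1P[_ Aw]]; apply: matchA.
have inA k : k < size s -> [/\ nth x0 s k != y, nth x0 s k != x & nth x0 s k \in A].
  by move=> /(mem_nth x0); rewrite sE => /setD1P[-> /setD1P[-> ->]].
exists [:: x, y & s]; split.
- by rewrite /= us !inE !sE !inE !eqxx (negbTE xy) /= ?andbF.
- move=> z; rewrite !inE sE !inE.
  have [->|] := eqVneq z x; first by rewrite Ax.
  by have [->|] := eqVneq z y; first by rewrite Ay.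
move=> [|[|i]] [|[|j]] //=; rewrite ?ltnS => lti ltj Gij.
- have [/eqP ny _ Aj] := inA j ltj; case: ny.
  exact: matchA Ax Aj Ay Gij Gxy.
- have [_ /eqP nx Aj] := inA j ltj; case: nx.
  by apply: (matchA y) => //; rewrite adj_sym.
- have [/eqP ny _ Ai] := inA i lti; case: ny.
  by apply: (matchA x) => //; rewrite adj_sym.
- have [_ /eqP nx Ai] := inA i lti; case: nx.
  by apply: (matchA y) => //; rewrite adj_sym.
- by rewrite (matchs i j).
Qed.

Lemma single_edge_labelling (A : {set V}) : single_edge G (mem A) ->
  exists s : seq V, [/\ uniq s, s =i A & forall i j, i < size s -> j < size s ->
    adj G (nth x0 s i) (nth x0 s j) ->
    (i == 0) && (j == 1) || (j == 0) && (i == 1)].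
Proof.
move=> oneA.
have [/exists_inP[x Ax /exists_inP[y Ay Gxy]]|noE] :=
    boolP [exists x in A, exists y in A, adj G x y]; last first.
  exists (enum A); split=> [||i j lti ltj Gij]; first exact: enum_uniq.
    exact: mem_enum.
  case/negP: noE; apply/exists_inP; exists (nth x0 (enum A) i).
    by rewrite -mem_enum mem_nth.
  by apply/exists_inP; exists (nth x0 (enum A) j); rewrite // -mem_enum mem_nth.
have xy : x != y by apply: contraL Gxy => /eqP->; rewrite adj_irrefl.
pose s := [:: x, y & enum (A :\ x :\ y)].
have us : uniq s by rewrite /= enum_uniq !inE !mem_enum !inE !eqxx (negbTE xy) /= ?andbF.
have sE : s =i A.
  move=> z; rewrite !inE mem_enum !inE.
  have [->|] := eqVneq z x; first by rewrite Ax.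
  by have [->|] := eqVneq z y; first by rewrite Ay.
exists s; split=> // i j lti ltj Gij.
have Ai : nth x0 s i \in A by rewrite -sE mem_nth.
have Aj : nth x0 s j \in A by rewrite -sE mem_nth.
have [[e1 e2]|[e1 e2]] := oneA _ _ _ _ Ax Ay Ai Aj Gxy Gij.
- apply/orP; left; rewrite -(nth_uniq x0 lti _ us) // -(nth_uniq x0 ltj _ us) //.
  by rewrite -e1 -e2 !eqxx.
- apply/orP; right; rewrite -(nth_uniq x0 lti _ us) // -(nth_uniq x0 ltj _ us) //.
  by rewrite -e1 -e2 !eqxx.
Qed.

(** Two different edges either share a vertex, forming a path, or are disjoint. *)
Lemma single_edge_intro (Q : pred V) :
  (forall x y z, Q x -> Q y -> Q z -> adj G x y -> adj G y z -> x != z -> False) ->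
  (forall x y z w, Q x -> Q y -> Q z -> Q w -> adj G x y -> adj G z w ->
    [/\ x != z, x != w, y != z & y != w] -> False) ->
  single_edge G Q.
Proof.
move=> nopath no2 x y z w Qx Qy Qz Qw Gxy Gzw.
have path u v v' : Q u -> Q v -> Q v' -> adj G u v -> adj G u v' -> v = v'.
  move=> Qu Qv Qv' Guv Guv'; apply/eqP; apply/negPn/negP => nv.
  by apply: (nopath v u v') => //; rewrite adj_sym.
have Gyx : adj G y x by rewrite adj_sym.
have Gwz : adj G w z by rewrite adj_sym.
have [e|xz] := eqVneq x z.
  by left; split=> //; apply: (path x) => //; rewrite e.
have [e|xw] := eqVneq x w.
  by right; split=> //; apply: (path x) => //; rewrite e.
have [e|yz] := eqVneq y z.
  by case/eqP: xw; apply: (path y) => //; rewrite e.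
have [e|yw] := eqVneq y w.
  by case/eqP: xz; apply: (path y) => //; rewrite e.
by case: (no2 x y z w).
Qed.

End Labellings.

(** * Near-regular graphs *)

Lemma handshake m (L : sgraph 'I_m) : ~~ odd (\sum_v deg L v).
Proof.
have -> : \sum_v deg L v = (\sum_(v : 'I_m) \sum_(w : 'I_m) ((v < w) && adj L v w : nat)).*2.
  rewrite -addnn {2}exchange_big /= -big_split; apply: eq_bigr => v _.
  rewrite degE -big_split; apply: eq_bigr => w _ /=.
  rewrite [adj L w v]adj_sym; have [_|_|/val_inj->] := ltngtP v w.
  - by rewrite addn0.
  - by [].
  - by rewrite adj_irrefl.
by rewrite odd_double.
Qed.

Section EdgeSwitch.
Variables (V : finType) (G : sgraph V).

Definition add_edge (a b : V) : sgraph V :=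
  graph_of_rel (fun x y => adj G x y || (x == a) && (y == b)).

Definition del_edge (a b : V) : sgraph V :=
  graph_of_rel (fun x y => adj G x y &&
    ~~ ((x == a) && (y == b) || (x == b) && (y == a))).

Lemma adj_add_edge a b x y : a != b -> adj (add_edge a b) x y =
  [|| adj G x y, (x == a) && (y == b) | (x == b) && (y == a)].
Proof.
move=> ab; rewrite adj_graph_of_rel [adj G y x]adj_sym.
have [->|_] := eqVneq x y; last by rewrite orbACA orbb [(y == a) && _]andbC.
rewrite adj_irrefl; have [->|] := eqVneq y a; first by rewrite (negbTE ab).
by rewrite andbF.
Qed.

Lemma adj_del_edge a b x y : adj (del_edge a b) x y =
  adj G x y && ~~ ((x == a) && (y == b) || (x == b) && (y == a)).
Proof.
rewrite adj_graph_of_rel [adj G y x]adj_sym.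
have [->|_] := eqVneq x y; first by rewrite adj_irrefl.
rewrite /= [(y == a) && _]andbC [(y == b) && _]andbC [in X in _ || X]orbC.
by rewrite orbb.
Qed.

Lemma sum_indicator (U : {set V}) (e : bool) b :
  \sum_(z in U) (e && (z == b)) = e && (b \in U).
Proof.
case: e => /=; last by rewrite big1.
have [Ub|Ub] := boolP (b \in U).
  by rewrite (bigD1 b Ub) /= eqxx big1 // => z /andP[_ /negbTE->].
by rewrite big1 // => z Uz; case: eqP => // ezb; rewrite -ezb Uz in Ub.
Qed.

Lemma degin_add_edge a b (U : {set V}) w : a != b -> ~~ adj G a b ->
  degin (add_edge a b) U w =
  degin G U w + ((w == a) && (b \in U)) + ((w == b) && (a \in U)).
Proof.
move=> ab nGab; rewrite /degin -!sum_indicator -!big_split /=.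
apply: eq_bigr => z _; rewrite adj_add_edge //.
have [->|_] := eqVneq w a.
  rewrite (negbTE ab) /= addn0 orbF.
  by have [->|_] := eqVneq z b; rewrite ?(negbTE nGab) // orbF addn0.
rewrite /= addn0; have [->|_] := eqVneq w b; last by rewrite orbF addn0.
have [->|_] /= := eqVneq z a; last by rewrite orbF addn0.
by rewrite adj_sym (negbTE nGab).
Qed.

Lemma degin_del_edge a b (U : {set V}) w : adj G a b ->
  degin (del_edge a b) U w + ((w == a) && (b \in U)) + ((w == b) && (a \in U)) =
  degin G U w.
Proof.
move=> Gab; have ab : a != b by apply: contraL Gab => /eqP->; rewrite adj_irrefl.
rewrite /degin -!sum_indicator -!big_split /=.
apply: eq_bigr => z _; rewrite adj_del_edge.
have [->|_] := eqVneq w a.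
  rewrite (negbTE ab) /= orbF addn0; have [->|_] := eqVneq z b; first by rewrite Gab.
  by rewrite andbT addn0.
rewrite /= addn0; have [->|_] := eqVneq w b; last by rewrite andbT addn0.
have [->|_] /= := eqVneq z a; first by rewrite adj_sym Gab.
by rewrite andbT addn0.
Qed.

Lemma deg_degin v : deg G v = degin G setT v.
Proof. by rewrite degE; apply: eq_bigl => w; rewrite inE. Qed.

End EdgeSwitch.

Section NearRegular.
Variables (R : realType) (p : R) (n : nat) (T : finType) (F : sgraph T).
Variables (G : sgraph 'I_n) (A : {set 'I_n}) (d : nat).
Local Notation B := (~: A).
Hypotheses (hp : (1 < p)%R) (d1 : 1 <= d)
  (freeF : forall H : sgraph 'I_n, (forall w, w \notin A -> degin H B w <= d) ->
     subgraph_free F H)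
  (exG : e_ p G = ex_ p n F) (degB : forall w, w \notin A -> degin G B w <= d)
  (bigB : 3 * d + d * d + 3 < #|B|).

Lemma extremal_complete x y : x \in A -> y \in A -> x != y -> adj G x y.
Proof.
move=> Ax Ay xy.
pose G' := graph_of_rel (fun x y => adj G x y || (x \in A) && (y \in A)).
have adjG' u v : adj G' u v = (u != v) && (adj G u v || (u \in A) && (v \in A)).
  rewrite adj_graph_of_rel; congr andb.
  by rewrite [adj G v u]adj_sym [(v \in A) && _]andbC orbb.
rewrite (@extremal_adj _ _ _ _ F G G' hp _ exG) => [||u v Guv].
- by rewrite adjG' xy Ax Ay orbT.
- apply: freeF => w nAw; apply: leq_trans (degB nAw); apply: leq_sum => z.
  rewrite in_setC => nAz; rewrite adjG' (negbTE nAw) orbF.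
  by case: (w != z).
rewrite adjG' Guv andbT; apply: contraL Guv => /eqP->; by rewrite adj_irrefl.
Qed.

Lemma no_improvement (H : sgraph 'I_n) u :
  (forall w, w \notin A -> degin H B w <= d) ->
  (forall w, deg G w <= deg H w) -> deg G u < deg H u -> False.
Proof.
move=> /freeF freeH leGH ltu.
by have := extremal_deg hp freeH exG leGH u; lia.
Qed.

Lemma deficient_adj u v : u \notin A -> v \notin A -> degin G B u < d ->
  degin G B v < d -> u != v -> adj G u v.
Proof.
move=> Au Av ltu ltv uv; apply/negPn/negP => nGuv.
have [Bu Bv] : u \in B /\ v \in B by rewrite !in_setC.
apply: (@no_improvement (add_edge G u v) u).
- move=> w Aw; rewrite degin_add_edge // Bu Bv !andbT.
  have [->|_] := eqVneq w u; first by rewrite (negbTE uv) addn0 addn1.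
  have [->|_] := eqVneq w v; first by rewrite addn0 addn1.
  by rewrite !addn0 degB.
- by move=> w; rewrite !deg_degin degin_add_edge // -addnA leq_addr.
- by rewrite !deg_degin degin_add_edge // eqxx inE (negbTE uv) addn0 addn1.
Qed.

(** By [deficient_adj] the deficient vertices form a clique, so they are one of them together with
    some of its at most [d] neighbours. *)
Lemma card_deficient : #|[set w in B | degin G B w < d]| <= d.+1.
Proof.
have [->|[u]] := set_0Vmem [set w in B | degin G B w < d]; first by rewrite cards0.
rewrite inE in_setC => /andP[Au ltu].
apply: (@leq_trans #|u |: [set w in B | adj G u w]|).
  apply: subset_leq_card; apply/subsetP => w; rewrite !inE => /andP[Aw ltw].
  have [//|wu] := eqVneq w u; rewrite Aw /=; apply: deficient_adj => //.
  by rewrite eq_sym.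
by rewrite cardsU1 -deginE; case: (_ \notin _); have := degB Au; lia.
Qed.

(** Exchanging [x y] for [u x] and [v y] keeps the degrees of [x] and [y] and raises those of [u]
    and [v]. The case u = v is included, with a gain of two, which is why a deficit of at least two
    is then required. *)
Lemma two_deficient u v : u \notin A -> v \notin A -> degin G B u < d ->
  degin G B v < d -> (u = v -> (degin G B u).+1 < d) -> False.
Proof.
move=> Au Av ltu ltv uv; have [Bu Bv] : u \in B /\ v \in B by rewrite !in_setC.
pose N x := [set w in B | adj G x w].
have cardN x : x \notin A -> #|N x| <= d by move=> Ax; rewrite -deginE degB.
pose D := [set w in B | degin G B w < d].
(* Forbidden choices for [x]: deficient vertices, so that [x] has a neighbour [y] in [B]; [u], [v]
   and their neighbours; and second neighbours of [v], so that [v y] is not yet an edge. *)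
pose X := D :|: [set u; v] :|: N u :|: N v :|: \bigcup_(w in N v) N w.
(* The five sets have sizes at most d + 1, 2, d, d and d^2. *)
have leX : #|X| <= 3 * d + d * d + 3.
  have leNN : #|\bigcup_(w in N v) N w| <= d * d.
    apply: (@leq_trans (\sum_(w in N v) d)); last by rewrite sum_nat_const leq_mul ?cardN.
    have : #|\bigcup_(w in N v) N w| <= \sum_(w in N v) #|N w|.
      elim/big_rec2: _ => [|w k S _ le]; first by rewrite cards0.
      by apply: leq_trans (leq_card_setU _ _) _; rewrite leq_add2l.
    move/leq_trans; apply; apply: leq_sum => w; rewrite inE in_setC => /andP[Aw _].
    exact: cardN.
  have le2 : #|[set u; v]| <= 2 by rewrite cards2; case: (u != v).
  have := cardN u Au; have := cardN v Av; have := card_deficient; rewrite -/D.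
  have := (leq_card_setU D [set u; v], leq_card_setU (D :|: [set u; v]) (N u)).
  have := leq_card_setU (D :|: [set u; v] :|: N u) (N v).
  have := leq_card_setU (D :|: [set u; v] :|: N u :|: N v) (\bigcup_(w in N v) N w).
  rewrite -/X => l1 l2 [l3 l4] l5 l6 l7.
  apply: leq_trans l1 _; apply: leq_trans (leq_add l2 leNN) _.
  have := leq_trans l4 (leq_add l3 (leqnn _)).
  by move: l5 l6 l7 le2; move: (d * d) => dd; lia.
have [x Bx nXx] : exists2 x, x \in B & x \notin X.
  have /subsetPn[x] : ~~ (B \subset X).
    by apply: contraL bigB => /subset_leq_card leB; rewrite -leqNgt (leq_trans leB).
  by exists x.
move: nXx; rewrite !in_setU !negb_or !in_set1.
move=> /andP[/andP[/andP[/andP[nDx /andP[xu xv]] nux] nvx] nNNx].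
have Ax : x \notin A by rewrite -in_setC.
have : 0 < #|N x|.
  rewrite -deginE; apply: leq_trans d1 _; move: nDx; rewrite inE Bx /= -leqNgt.
  by [].
case/card_gt0P => y; rewrite inE in_setC => /andP[Ay Gxy].
have By : y \in B by rewrite in_setC.
have nGux : ~~ adj G u x by move: nux; rewrite inE Bx.
have nGvx : ~~ adj G v x by move: nvx; rewrite inE Bx.
have nGvy : ~~ adj G v y.
  apply: contra nNNx => Gvy; apply/bigcupP; exists y; first by rewrite inE By.
  by rewrite inE Bx adj_sym.
have yu : y != u by apply: contraNneq nGux => <-; rewrite adj_sym.
have yv : y != v by apply: contraNneq nGvx => <-; rewrite adj_sym.
pose G1 := del_edge G x y; pose G2 := add_edge G1 u x; pose G3 := add_edge G2 v y.
have ux : u != x by rewrite eq_sym. have vy : v != y by rewrite eq_sym.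
have n1 : ~~ adj G1 u x by rewrite adj_del_edge (negbTE nGux).
have n2 : ~~ adj G2 v y.
  rewrite adj_add_edge // adj_del_edge (negbTE nGvy) /= [v == x]eq_sym (negbTE xv) /=.
  rewrite orbF negb_and; apply/orP; right; apply: contraL Gxy => /eqP->.
  by rewrite adj_irrefl.
(* At [x] and [y] the deleted edge and the added one cancel. *)
have degE3 (U : {set 'I_n}) w : u \in U -> v \in U -> x \in U -> y \in U ->
    degin G3 U w = degin G U w + (w == u) + (w == v).
  move=> Uu Uv Ux Uy; rewrite degin_add_edge // degin_add_edge //.
  rewrite -(degin_del_edge U w Gxy) Uu Uv Ux Uy !andbT -/G1.
  move: (degin G1 U w) (nat_of_bool (w == u)) (nat_of_bool (w == v)).
  by move: (nat_of_bool (w == x)) (nat_of_bool (w == y)) => *; ring.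
apply: (@no_improvement G3 u).
- move=> w Aw; rewrite degE3 //; have := degB Aw.
  have [ewu|_] := eqVneq w u; have [ewv|_] := eqVneq w v; subst; rewrite ?addn0 ?addn1 //.
  by move=> _; apply: uv.
- by move=> w; rewrite !deg_degin degE3 ?inE // -addnA leq_addr.
- by rewrite !deg_degin degE3 ?inE // eqxx addn1; apply: leq_addr.
Qed.

Lemma extremal_near_regular :
  (forall w, w \notin A -> degin G B w = d) \/
  (exists v, [/\ v \notin A, degin G B v = d.-1 &
     forall w, w \notin A -> w != v -> degin G B w = d]).
Proof.
have [/exists_inP[v Bv ltv]|/exists_inPn none] := boolP [exists v in B, degin G B v < d].
  have Av : v \notin A by rewrite -in_setC.
  right; exists v; split=> // [|w Aw wv].
    apply/eqP; rewrite eqn_leq -ltnS prednK // ltv /= leqNgt; apply/negP => lt2.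
    by apply: (two_deficient Av Av ltv ltv) => _; lia.
  apply/eqP; rewrite eqn_leq degB //= leqNgt; apply/negP => ltw.
  by apply: (two_deficient Aw Av ltw ltv) => ewv; rewrite ewv eqxx in wv.
left=> w Aw; apply/eqP; rewrite eqn_leq degB //= leqNgt.
by apply: none; rewrite in_setC.
Qed.

End NearRegular.

(** The handshake lemma makes the parity of l m decide which alternative holds. *)
Lemma near_regular_intro l m (L : sgraph 'I_m) : 0 < l ->
  (forall u, deg L u = l) \/
  (exists v, deg L v = l.-1 /\ forall u, u != v -> deg L u = l) ->
  near_regular l L.
Proof.
move=> l0 degL; have := handshake L; rewrite /near_regular.
case: degL => [regL|[v [degv regL]]].
  rewrite (eq_bigr (fun _ => l)) => [|u _]; last exact: regL.
  by rewrite sum_nat_const card_ord mulnC => /negbTE->.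
have m0 : 0 < m by case: (m) v {degv regL L} => // -[].
rewrite (bigD1 v) //= degv (eq_bigr (fun _ => l)) => [|u]; last exact: regL.
rewrite sum_nat_const cardC1 card_ord => even.
have -> : odd (l * m).
  have e : (l.-1 + m.-1 * l).+1 = l * m.
    by case: (l) l0 => // l' _; case: (m) m0 => // m' _ /=; rewrite mulnS mulnC; lia.
  by rewrite -e /=.
by exists v.
Qed.

Lemma near_regular_le l m (L : sgraph 'I_m) u : near_regular l L -> deg L u <= l.
Proof.
rewrite /near_regular; case: ifP => [_ [v [degv regL]]|_ -> //].
have [->|/regL->//] := eqVneq u v.
by rewrite degv leq_pred.
Qed.

Lemma near_regular_sum (R : realType) l m (L L' : sgraph 'I_m) (g : nat -> R) :
  near_regular l L -> near_regular l L' ->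
  (\sum_u g (deg L u) = \sum_u g (deg L' u))%R.
Proof.
rewrite /near_regular; case: ifP => [_|_ regL regL']; last first.
  by apply: eq_bigr => u _; rewrite regL regL'.
have sumE (K : sgraph 'I_m) v : deg K v = l.-1 -> (forall u, u != v -> deg K u = l) ->
    (\sum_u g (deg K u) = g l.-1 + g l *+ m.-1)%R.
  move=> degv regK; rewrite (bigD1 v) //= degv; congr (_ + _)%R.
  rewrite (eq_bigr (fun _ => g l)) => [|u /regK-> //].
  by rewrite sumr_const cardC1 card_ord.
by move=> [v [dv rv]] [v' [dv' rv']]; rewrite (sumE L v) // (sumE L' v').
Qed.

Lemma e_iso (R : realType) (p : R) (T U : finType) (G : sgraph T) (H : sgraph U) :
  graph_iso G H -> e_ p G = e_ p H.
Proof.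
move=> [f [g gK Kg] isof].
have degf x : deg H (f x) = deg G x.
  rewrite /deg -(card_image (can_inj gK)); apply: eq_card => y.
  rewrite in_adj; apply/idP/imageP => [Hy|[z + ->]].
    by exists (g y); rewrite ?Kg // in_adj -isof Kg.
  by rewrite in_adj isof.
rewrite /e_ [RHS](reindex f) /=; last by exists g => x _.
by apply: eq_bigr => x _; rewrite degf.
Qed.

(** Near-regularity fixes the degree sequence, so one extremal member makes the whole family
    extremal. *)
Lemma e_join_near_regular (R : realType) (p : R) (T : finType) (G : sgraph T)
    l m (L L' : sgraph 'I_m) :
  near_regular l L -> near_regular l L' ->
  e_ p (graph_join G L) = e_ p (graph_join G L').
Proof.
move=> regL regL'; rewrite /e_ [LHS]big_sumType [RHS]big_sumType; congr (_ + _)%R.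
  apply: eq_bigr => a _; congr ((_%:R) `^ p)%R.
  rewrite !degE !big_sumType /=; congr addn; apply: eq_bigr => x _.
    by rewrite !adj_join_ll.
  by rewrite !adj_join_lr.
under eq_bigr => u _ do rewrite deg_join_right.
under [RHS]eq_bigr => u _ do rewrite deg_join_right.
exact: (near_regular_sum (fun k => (#|T| + k)%:R `^ p)%R regL regL').
Qed.

Lemma extremal_exists (R : realType) (p : R) n (T : finType) (F : sgraph T)
    (G : sgraph 'I_n) :
  subgraph_free F G -> exists2 H : sgraph 'I_n, subgraph_free F H & e_ p H = ex_ p n F.
Proof.
move=> freeG.
have [H freeH maxH] := @arg_maxP _ R _ G (subgraph_free F) (fun H => e_ p H) freeG.
exists H => //; apply/eqP; rewrite eq_le ex_ge //=; apply/bigmax_leP; split.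
  by apply: sumr_ge0 => v _; apply: powR_ge0.
by move=> K freeK; apply: maxH.
Qed.

(** * Shapes of extremal graphs *)

Section ExtremalShapes.
Variables (R : realType) (p : R) (T : finType) (F : sgraph T).
Variables (n : nat) (G : sgraph 'I_n) (A : {set 'I_n}) (a b : nat).
Hypotheses (hp : (1 < p)%R) (exG : e_ p G = ex_ p n F) (n0 : 0 < n)
  (cardA : #|A| = a) (cardB : #|~: A| = b)
  (joinA : forall x y, x \in A -> y \notin A -> adj G x y).
Local Notation free_join H1 H2 := (subgraph_free F (graph_join H1 H2)).
Let x0 := Ordinal n0.

Let hom_complete m (f : 'I_m -> 'I_n) i j :
  adj G (f i) (f j) -> adj (complete_graph m) i j.
Proof. by rewrite adj_complete; apply: contraL => /eqP->; rewrite adj_irrefl. Qed.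

Let hom_empty (Q : pred 'I_n) m (f : 'I_m -> 'I_n) : edgeless G Q ->
  (forall i, Q (f i)) -> forall i j, adj G (f i) (f j) -> adj (empty_graph m) i j.
Proof. by move=> noG Qf i j; rewrite (negbTE (noG _ _ (Qf i) (Qf j))). Qed.

Let hom_matching m (s : seq 'I_n) : size s = m ->
  (forall i j, i < size s -> j < size s ->
     adj G (nth x0 s i) (nth x0 s j) -> i./2 = j./2) ->
  forall i j : 'I_m, adj G (nth x0 s i) (nth x0 s j) -> adj (max_matching m) i j.
Proof.
move=> sizes match_s i j Gij; rewrite adj_max_matching (match_s i j) ?sizes // eqxx andbT.
by apply: contraL Gij => /eqP->; rewrite adj_irrefl.
Qed.

Let hom_one_edge m (s : seq 'I_n) : size s = m ->
  (forall i j, i < size s -> j < size s -> adj G (nth x0 s i) (nth x0 s j) ->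
     (i == 0) && (j == 1) || (j == 0) && (i == 1)) ->
  forall i j : 'I_m, adj G (nth x0 s i) (nth x0 s j) -> adj (one_edge m) i j.
Proof.
move=> sizes one_s i j Gij; rewrite adj_graph_of_rel one_s ?sizes // andbT.
by apply: contraL Gij => /eqP->; rewrite adj_irrefl.
Qed.

Let size_label (X : {set 'I_n}) (s : seq 'I_n) m : #|X| = m -> uniq s -> s =i X -> size s = m.
Proof. by move=> <- us sE; rewrite -(eq_card sE) (card_uniqP us). Qed.

Let iso_enum := @extremal_join_iso n G A a b x0 (enum A) (enum (~: A)) cardA cardB joinA
  (enum_uniq _) (mem_enum _) (enum_uniq _) (mem_enum _) R p T F.

Let mapr_notin sA sB (usB : uniq sB) (sBE : sB =i ~: A) (j : 'I_b) :
  @join_map n a b x0 sA sB (inr j) \notin A.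
Proof. exact: (join_map_right a x0 sA cardB usB sBE). Qed.

Let mapl_in sA sB (usA : uniq sA) (sAE : sA =i A) (i : 'I_a) :
  @join_map n a b x0 sA sB (inl i) \in A.
Proof. exact: (join_map_left b x0 sB cardA usA sAE). Qed.

Lemma shape_complete_empty : edgeless G (fun x => x \notin A) ->
  free_join (complete_graph a) (empty_graph b) ->
  graph_iso G (graph_join (complete_graph a) (empty_graph b)).
Proof.
move=> noB freeJ; apply: (iso_enum hp exG freeJ) => [i j|].
  exact: (hom_complete (f := fun i => nth x0 (enum A) i)).
apply: (hom_empty noB) => j.
exact: (mapr_notin (enum A) (enum_uniq _) (mem_enum _)).
Qed.

Lemma shape_empty_empty : edgeless G (mem A) -> edgeless G (fun x => x \notin A) ->
  free_join (empty_graph a) (empty_graph b) ->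
  graph_iso G (complete_bipartite a b).
Proof.
move=> noA noB freeJ.
apply: (@graph_iso_adj _ _ _ (graph_join (empty_graph a) (empty_graph b))).
  move=> [i|i] [j|j]; rewrite ?adj_join_ll ?adj_join_rr ?adj_join_lr ?adj_join_rl;
    by rewrite ?adj_empty adj_graph_of_rel ?andbF.
apply: (iso_enum hp exG freeJ).
  by apply: (hom_empty noA) => i; apply: (mapl_in (enum (~: A)) (enum_uniq _) (mem_enum _)).
by apply: (hom_empty noB) => j; apply: (mapr_notin (enum A) (enum_uniq _) (mem_enum _)).
Qed.

Lemma shape_matching_empty :
  (forall x y z, x \in A -> y \in A -> z \in A -> adj G x y -> adj G x z -> y = z) ->
  edgeless G (fun x => x \notin A) ->
  free_join (max_matching a) (empty_graph b) ->
  graph_iso G (graph_join (max_matching a) (empty_graph b)).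
Proof.
move=> matchA noB freeJ; have [s [us sE match_s]] := matching_labelling x0 matchA.
apply: (extremal_join_iso (x0 := x0) cardA cardB joinA us sE (enum_uniq _) (mem_enum _)
  hp exG freeJ).
  exact: (hom_matching (size_label cardA us sE) match_s).
by apply: (hom_empty noB) => j; apply: (mapr_notin s (enum_uniq _) (mem_enum _)).
Qed.

Lemma shape_one_edge_empty : single_edge G (mem A) ->
  edgeless G (fun x => x \notin A) ->
  free_join (one_edge a) (empty_graph b) ->
  graph_iso G (graph_join (one_edge a) (empty_graph b)).
Proof.
move=> oneA noB freeJ; have [s [us sE one_s]] := single_edge_labelling x0 oneA.
apply: (extremal_join_iso (x0 := x0) cardA cardB joinA us sE (enum_uniq _) (mem_enum _)
  hp exG freeJ).
  exact: (hom_one_edge (size_label cardA us sE) one_s).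
by apply: (hom_empty noB) => j; apply: (mapr_notin s (enum_uniq _) (mem_enum _)).
Qed.

Lemma shape_complete_matching :
  (forall x y z, x \notin A -> y \notin A -> z \notin A ->
     adj G x y -> adj G x z -> y = z) ->
  free_join (complete_graph a) (max_matching b) ->
  graph_iso G (graph_join (complete_graph a) (max_matching b)).
Proof.
move=> matchB freeJ.
have [|s [us sE match_s]] := @matching_labelling _ G x0 (~: A).
  by move=> x y z; rewrite !in_setC; apply: matchB.
apply: (extremal_join_iso (x0 := x0) cardA cardB joinA (enum_uniq _) (mem_enum _) us sE
  hp exG freeJ).
  by move=> i j; apply: (hom_complete (f := fun i => nth x0 (enum A) i)).
exact: (hom_matching (size_label cardB us sE) match_s).
Qed.

Lemma shape_complete_one_edge : single_edge G (fun x => x \notin A) ->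
  free_join (complete_graph a) (one_edge b) ->
  graph_iso G (graph_join (complete_graph a) (one_edge b)).
Proof.
move=> oneB freeJ.
have [|s [us sE one_s]] := @single_edge_labelling _ G x0 (~: A).
  by move=> x y z w; rewrite !inE; apply: oneB.
apply: (extremal_join_iso (x0 := x0) cardA cardB joinA (enum_uniq _) (mem_enum _) us sE
  hp exG freeJ).
  by move=> i j; apply: (hom_complete (f := fun i => nth x0 (enum A) i)).
exact: (hom_one_edge (size_label cardB us sE) one_s).
Qed.

(** With no fixed target to embed G into, [L] is read off from G, and extremality enters through the
    exchange argument. *)
Lemma shape_complete_near_regular d : 1 <= d -> 3 * d + d * d + 3 < b ->
  (forall H : sgraph 'I_n, (forall w, w \notin A -> degin H (~: A) w <= d) ->
     subgraph_free F H) ->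
  (forall w, w \notin A -> degin G (~: A) w <= d) ->
  exists2 L : sgraph 'I_b, near_regular d L &
    graph_iso G (graph_join (complete_graph a) L).
Proof.
move=> d1 bigB freeF degB; rewrite -cardB in bigB.
pose f (j : 'I_b) := @join_map n a b x0 (enum A) (enum (~: A)) (inr j).
have fB j : f j \notin A by apply: (mapr_notin (enum A) (enum_uniq _) (mem_enum _)).
have [g gK Kg] := join_map_bij x0 cardA cardB (enum_uniq _) (mem_enum A)
  (enum_uniq _) (mem_enum (~: A)).
have injf : injective f by move=> i j /(can_inj gK) [].
have imf x : x \notin A -> exists j, x = f j.
  move=> nAx; case ex : (g x) => [i|j].
    move: nAx; rewrite -[x]Kg ex.
    by rewrite (mapl_in (enum (~: A)) (enum_uniq _) (mem_enum _)).
  by exists j; rewrite /f -ex Kg.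
pose L := graph_of_rel (fun i j => adj G (f i) (f j)).
have adjL i j : adj L i j = adj G (f i) (f j).
  rewrite adj_graph_of_rel [adj G (f j) _]adj_sym orbb.
  by case: eqVneq => [->|//]; rewrite adj_irrefl.
have degL j : deg L j = degin G (~: A) (f j).
  rewrite deginE /deg -(card_imset _ injf); apply: eq_card => x.
  rewrite inE in_setC; apply/imsetP/andP => [[i + ->]|[nAx]].
    by rewrite in_adj adjL fB.
  by have [i ->] := imf x nAx => Gji; exists i; rewrite // in_adj adjL.
exists L.
  apply: (near_regular_intro d1).
  have [reg|[v [nAv degv reg]]] := extremal_near_regular hp d1 freeF exG degB bigB.
    by left=> j; rewrite degL reg.
  right; have [j jE] := imf v nAv; exists j; rewrite degL -jE; split=> // i ij.
  by rewrite degL reg // jE (inj_eq injf).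
apply: (join_iso cardA cardB joinA (enum_uniq _) (mem_enum A) (enum_uniq _)
  (mem_enum (~: A)) (x0 := x0)) => i j; last by rewrite adjL.
rewrite adj_complete; have [->|ij] := eqVneq i j; first by rewrite adj_irrefl.
apply: (extremal_complete hp freeF exG degB).
- exact: (mapl_in (enum (~: A)) (enum_uniq _) (mem_enum _)).
- exact: (mapl_in (enum (~: A)) (enum_uniq _) (mem_enum _)).
by rewrite (inj_eq (can_inj gK)); apply: contra ij => /eqP[->].
Qed.

End ExtremalShapes.

(** * The two families of forests *)

Lemma regular_forest_extremal (R : realType) (p : R) (hp : (1 < p)%R)
    (t : nat) (ht : 1 <= t) (s beta : 'I_t -> nat)
    (hs : forall j, 2 <= s j) (hbeta : forall j, 1 <= beta j) :
  let F := disjoint_union (fun j => regular_caterpillar (s j) (beta j)) in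
  tau F = \sum_(j < t) ((s j)./2 * beta j + uphalf (s j)) /\
  exists n0 : nat, forall n : nat, n0 <= n ->
    forall G : sgraph 'I_n, subgraph_free F G -> e_ p G = ex_ p n F ->
    [/\ (forall j, beta j = 1) ->
          graph_iso G (graphL0 n (\sum_(j < t) s j - 1)),
        (exists j, 2 <= beta j /\ ~~ odd (s j)) ->
          graph_iso G (complete_bipartite (tau F - 1) (n - tau F + 1)),
        (forall j, s j <> 3 -> beta j = 1) /\
        (exists j, 2 <= beta j /\ s j = 3) ->
          graph_iso G (graph_join (max_matching (tau F - 1))
                      (empty_graph (n - tau F + 1))) &
        (forall j, ~~ odd (s j) -> beta j = 1) /\
        (exists j, [/\ 2 <= beta j, 5 <= s j & odd (s j)]) ->
          graph_iso G (graph_join (one_edge (tau F - 1))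
                      (empty_graph (n - tau F + 1)))].
Proof.
move=> F; pose c j := (s j)./2 * beta j + uphalf (s j).
have optc j : optimal_cover (regular_caterpillar (s j) (beta j)) (c j).
  exact: regular_optimal_cover.
have sum0 : 0 < \sum_j c j.
  rewrite (bigD1 (Ordinal ht)) //= /c; have := hs (Ordinal ht); lia.
have [tauE bip_free [n0 n0P]] := union_extremal_join hp
  (fun j => @caterpillar_rank (s j) (fun _ => beta j)) optc sum0.
rewrite -/F in tauE bip_free n0P.
rewrite tauE; split=> //; exists n0 => n /n0P[len nP] G freeG exG.
have [A [cardA joinA nop]] := nP G freeG exG.
have n_gt0 : 0 < n by apply: leq_trans len.
have cardB : #|~: A| = n - \sum_j c j + 1.
  by have := cardsC A; rewrite cardA card_ord; lia.
(* An edge outside [A] would help any component, so the first one is used. *)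
have noB : edgeless G (fun x => x \notin A).
  move=> x y Ax Ay; apply/negP => Gxy; apply: (nop (Ordinal ht)).
  exact: outer_edge_regular Ax Ay Gxy.
have joinF (H1 : sgraph 'I_(\sum_j c j - 1)) b :
    (forall i f,
      injhom (regular_caterpillar (s i) (beta i)) (graph_join H1 (empty_graph b)) f ->
      c i <= #|f @^-1: left_part _ _|) ->
    subgraph_free F (graph_join H1 (empty_graph b)).
  by move/union_free; apply; rewrite card_left_part card_ord; lia.
have noE (H1 : sgraph 'I_(\sum_j c j - 1)) b :
    edgeless (graph_join H1 (empty_graph b)) (fun x => x \notin left_part _ _).
  by apply: edgeless_join => i j _ _; rewrite adj_empty.
split.
(* When all beta are 1, the optimal cover of a component has exactly s vertices. *)
- move=> beta1; have cE : \sum_j c j = \sum_j s j.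
    by apply: eq_bigr => j _; rewrite /c beta1; lia.
  have cardB' : #|~: A| = n - (\sum_j s j - 1) by rewrite cardB; lia.
  rewrite /graphL0 -cE; rewrite -cE in cardB'.
  apply: (shape_complete_empty hp exG n_gt0 cardA cardB' joinA noB).
  apply: joinF => i f homf; apply: (regular_trace _ homf) => //.
  by left.
- move=> [j [beta2 even]].
  apply: (shape_empty_empty hp exG n_gt0 cardA cardB joinA _ noB).
    move=> x y Ax Ay; apply/negP => Gxy; apply: (nop j).
    exact: inner_edge_regular Ax Ay Gxy.
  apply: (bip_free _ _ (left_part _ _)).
    by rewrite card_left_part card_ord; lia.
  move=> [x|x] [y|y]; rewrite !inE // ?adj_join_ll ?adj_join_rr.
    by rewrite adj_empty.
  by rewrite adj_empty.
- move=> [beta1 [j [beta2 s3]]].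
  apply: (shape_matching_empty hp exG n_gt0 cardA cardB joinA _ noB).
    move=> x y z Ax Ay Az Gxy Gxz; apply/eqP/negPn/negP => yz; apply: (nop j).
    apply: (inner_path_regular _ _ _ Ay Ax Az _ Gxz yz); rewrite ?s3 //.
    by rewrite adj_sym.
  apply: joinF => i f homf; have [s3i|s3i] := eqVneq (s i) 3.
    apply: (regular_trace3 _ homf) => //.
    move=> [x|x] [y|y] [z|z]; rewrite !inE // => _ _ _; rewrite !adj_join_ll.
    by move=> xy xz; congr inl; apply: max_matching_unique xy xz.
  apply: (regular_trace _ homf) => //.
  by left; apply: beta1; apply/eqP.
- move=> [beta1 [j [beta2 s5 odds]]].
  apply: (shape_one_edge_empty hp exG n_gt0 cardA cardB joinA _ noB).
    apply: single_edge_intro => [x y z Ax Ay Az Gxy Gyz xz|x y z w Ax Ay Az Aw Gxy Gzw dist].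
      apply: (nop j); apply: (inner_path_regular _ odds beta2 Ax Ay Az Gxy Gyz xz).
      by apply: leq_trans s5.
    apply: (nop j).
    exact: (inner_two_edges_regular s5 odds beta2 Ax Ay Az Aw Gxy Gzw dist).
  apply: joinF => i f homf; have [oddi|eveni] := boolP (odd (s i)).
    apply: (regular_trace_odd _ homf) => //.
    exact/single_edge_join_left/one_edge_single.
  apply: (regular_trace _ homf) => //.
  by left; apply: beta1.
Qed.

Lemma broom_forest_extremal (R : realType) (p : R) (hp : (1 < p)%R)
    (t : nat) (ht : 1 <= t) (s beta gamma : 'I_t -> nat)
    (hs : forall j, 2 <= s j)
    (hbeta : forall j, 1 <= beta j) (hgamma : forall j, beta j <= gamma j) :
  let F := disjoint_union
             (fun j => double_broom (s j) (beta j) (gamma j)) in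
  tau F = \sum_(j < t | ~~ odd (s j)) ((s j)./2 + beta j)
          + \sum_(j < t | odd (s j)) uphalf (s j) /\
  exists n0 : nat, forall n : nat, n0 <= n ->
    (forall G : sgraph 'I_n, subgraph_free F G -> e_ p G = ex_ p n F ->
     [/\ (exists j, 2 <= beta j /\ ~~ odd (s j)) ->
           graph_iso G (complete_bipartite (tau F - 1) (n - tau F + 1)),
         (forall j, ~~ odd (s j) -> beta j = 1) /\
         (exists j, ~~ odd (s j)) ->
           graph_iso G (graphL0 n (tau F - 1)),
         (forall j, s j = 3 /\ beta j < gamma j) ->
           in_familyL n (2 * t - 1) (min_over beta) G,
         [/\ forall j, s j = 3 \/ s j = 5,
             forall j, s j = 3 -> beta j < gamma j,
             forall j, s j = 5 -> 2 <= beta j &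
             exists j, s j = 5] ->
           graph_iso G (graphL1 n (tau F - 1)) &
         (forall j, odd (s j)) /\
         (exists j, [\/ [/\ beta j = 1, gamma j = 1 & s j = 3],
                        beta j = 1 /\ s j = 5 |
                        7 <= s j]) ->
           graph_iso G (graphE n (tau F - 1))])
    /\
    ((forall j, s j = 3 /\ beta j < gamma j) ->
      forall G : sgraph 'I_n,
        in_familyL n (2 * t - 1) (min_over beta) G -> extremal p F G).
Proof.
move=> F; pose c j := if odd (s j) then uphalf (s j) else (s j)./2 + beta j.
have optc j : optimal_cover (double_broom (s j) (beta j) (gamma j)) (c j).
  by apply: broom_optimal_cover; rewrite ?hbeta ?hgamma.
have sum0 : 0 < \sum_j c j.
  rewrite (bigD1 (Ordinal ht)) //= /c; have := hs (Ordinal ht); case: ifP; lia.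
have sumE : \sum_j c j = \sum_(j < t | ~~ odd (s j)) ((s j)./2 + beta j)
    + \sum_(j < t | odd (s j)) uphalf (s j).
  rewrite (bigID (fun j => odd (s j))) /= addnC; congr addn.
    by apply: eq_bigr => j /negbTE odds; rewrite /c odds.
  by apply: eq_bigr => j odds; rewrite /c odds.
have [tauE bip_free [n0 n0P]] := union_extremal_join hp
  (fun j => @caterpillar_rank (s j) (fun i : 'I_(s j) => if i == 0 :> nat then beta j
                      else if i == (s j).-1 :> nat then gamma j else 0)) optc sum0.
rewrite -/F in tauE bip_free n0P.
(* The component [j0] with the smallest beta is the one that caps the degrees outside [A]. *)
have [j0 betaj0 min_beta] := min_overP beta ht.
set d := min_over beta in betaj0 min_beta *.
have d1 : 1 <= d by rewrite -betaj0.
(* Kept general in [H] and [A], since it serves both the exchanges inside an extremal graph and the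
   freeness of every member of the family. *)
have star_free : (forall j, s j = 3 /\ beta j < gamma j) ->
    forall (W : finType) (H : sgraph W) (A : {set W}), #|A| = 2 * t - 1 ->
    (forall w, w \notin A -> degin H (~: A) w <= d) -> subgraph_free F H.
  move=> all3 W H A cardA degA; apply: (union_free (A := A) (c := fun _ => 2)).
    by move=> j f homf; have [s3 ltbg] := all3 j;
      apply: (broom_trace3 s3 (min_beta j) ltbg homf degA).
  by rewrite sum_nat_const card_ord cardA; lia.
rewrite tauE; split=> //.
(* As |A| = 2t - 1, this leaves more than 3 d + d^2 + 3 vertices outside [A], as the exchange
   argument requires. *)
exists (maxn n0 (2 * t + 3 * d + d * d + 4)) => n.
rewrite geq_max => /andP[/n0P[len nP] nbig].
have {n0P nP}main (G : sgraph 'I_n) : subgraph_free F G -> e_ p G = ex_ p n F ->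
     [/\ (exists j, 2 <= beta j /\ ~~ odd (s j)) ->
           graph_iso G (complete_bipartite (\sum_j c j - 1) (n - \sum_j c j + 1)),
         (forall j, ~~ odd (s j) -> beta j = 1) /\
         (exists j, ~~ odd (s j)) ->
           graph_iso G (graphL0 n (\sum_j c j - 1)),
         (forall j, s j = 3 /\ beta j < gamma j) ->
           in_familyL n (2 * t - 1) d G,
         [/\ forall j, s j = 3 \/ s j = 5,
             forall j, s j = 3 -> beta j < gamma j,
             forall j, s j = 5 -> 2 <= beta j &
             exists j, s j = 5] ->
           graph_iso G (graphL1 n (\sum_j c j - 1)) &
         (forall j, odd (s j)) /\
         (exists j, [\/ [/\ beta j = 1, gamma j = 1 & s j = 3],
                        beta j = 1 /\ s j = 5 |
                        7 <= s j]) ->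
           graph_iso G (graphE n (\sum_j c j - 1))].
  move=> freeG exG; have [A [cardA joinA nop]] := nP G freeG exG.
  have n_gt0 : 0 < n by apply: leq_trans len.
  have cardB : #|~: A| = n - \sum_j c j + 1.
    by have := cardsC A; rewrite cardA card_ord; lia.
  have cardB' : #|~: A| = n - (\sum_j c j - 1) by rewrite cardB; lia.
  have joinF b (H1 : sgraph 'I_(\sum_j c j - 1)) (H2 : sgraph 'I_b) :
      (forall i f, injhom (double_broom (s i) (beta i) (gamma i)) (graph_join H1 H2) f ->
        c i <= #|f @^-1: left_part _ _|) ->
      subgraph_free F (graph_join H1 H2).
    by move/union_free; apply; rewrite card_left_part card_ord; lia.
  have outer_even j : ~~ odd (s j) -> edgeless G (fun x => x \notin A).
    move=> even x y Ax Ay; apply/negP => Gxy; apply: (nop j).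
    rewrite /c (negbTE even).
    exact: (outer_edge_broom (gamma j) (hs j) even (hbeta j) Ax Ay Gxy).
  split.
  - move=> [j [beta2 even]].
    apply: (shape_empty_empty hp exG n_gt0 cardA cardB joinA _ (outer_even j even)).
      move=> x y Ax Ay; apply/negP => Gxy; apply: (nop j).
      by rewrite /c (negbTE even); apply: inner_edge_broom Ax Ay Gxy.
    apply: (bip_free _ _ (left_part _ _)).
      by rewrite card_left_part card_ord; lia.
    by move=> [x|x] [y|y]; rewrite !inE // ?adj_join_ll ?adj_join_rr adj_empty.
  - move=> [beta1 [j even]].
    apply: (shape_complete_empty hp exG n_gt0 cardA cardB' joinA (outer_even j even)).
    apply: joinF => i f homf; apply: (broom_trace _ _ _ homf) => //.
      exact: beta1.
    by apply: edgeless_join => x y _ _; rewrite adj_empty.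
  - move=> all3; have cE : \sum_j c j = 2 * t.
      rewrite (eq_bigr (fun _ => 2)) => [|j _]; last by rewrite /c (proj1 (all3 j)).
      by rewrite sum_nat_const card_ord mulnC.
    rewrite cE in cardA cardB'.
    apply: (shape_complete_near_regular hp exG n_gt0 cardA cardB' joinA d1) => //.
    + by lia.
    + by move=> H; apply: star_free.
    move=> w Aw; rewrite leqNgt; apply/negP => ltd; apply: (nop j0).
    have [s3 _] := all3 j0; rewrite /c s3 /=.
    apply: (@outer_star_broom _ _ _ _ _ w [set x in ~: A | adj G w x] Aw).
      by move=> x; rewrite inE in_setC => /andP[].
    by rewrite -deginE betaj0.
  - move=> [s35 lt3 ge5 [j s5]].
    apply: (shape_complete_matching hp exG n_gt0 cardA cardB' joinA).
      move=> x y z Ax Ay Az Gxy Gxz; apply/eqP/negPn/negP => yz; apply: (nop j).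
      rewrite /c s5 /=.
      by apply: (@outer_path_broom _ _ _ 5 _ _ y x z) => //; rewrite adj_sym.
    apply: joinF => i f homf.
    have deg1 w : w \notin left_part 'I_(\sum_j c j - 1) 'I_(n - (\sum_j c j - 1)) ->
        degin (graph_join (complete_graph _) (max_matching _)) (~: left_part _ _) w <= 1.
      case: w => [w|w]; rewrite inE // => _; rewrite degin_join_right.
      apply/card_le1_eqP => x y wx wy; exact: max_matching_unique wy wx.
    have [s3|s5i] := s35 i; rewrite /c.
      by rewrite [in X in X <= _]s3 /=; apply: (broom_trace3 s3 _ (lt3 i s3) homf deg1).
    rewrite [in X in X <= _]s5i /=.
    exact: (broom_trace5 s5i (ge5 i s5i) (hgamma i) homf deg1).
  - move=> [odds [j altj]].
    apply: (shape_complete_one_edge hp exG n_gt0 cardA cardB' joinA); last first.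
      apply: joinF => i f homf; rewrite /c odds.
      apply: (broom_trace_odd _ _ _ homf) => //.
      exact/single_edge_join_right/one_edge_single.
    apply: single_edge_intro => [x y z Ax Ay Az Gxy Gyz xz|x y z w Ax Ay Az Aw Gxy Gzw dist];
      apply: (nop j); rewrite /c odds.
      (* For s = 3 the first alternative gives beta = 1, and the path is a star with two leaves;
         otherwise s >= 5 and the path fits into the spine. *)
      have [s3|s3] := eqVneq (s j) 3; last first.
        apply: (@outer_path_broom _ _ _ (s j) _ _ x y z _ (odds j) Ax Ay Az Gxy Gyz xz).
        by case: altj => [[_ _ e]|[_ ->]|] //; [rewrite e in s3 | lia].
      have beta1 : beta j = 1 by case: altj => [[]|[]|] //; rewrite s3.
      rewrite s3 beta1; apply: (@outer_star_broom _ _ _ _ _ y [set x; z] Ay).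
        by move=> u /set2P[] ->; rewrite // adj_sym.
      by rewrite cards2 xz.
    case: altj => [[-> -> ->]|[-> ->]|s7].
    + exact: outer_two_edges_path5 Ax Ay Az Aw Gxy Gzw dist.
    + exact: outer_two_edges_broom5 Ax Ay Az Aw Gxy Gzw dist.
    exact: (outer_two_edges_broom _ _ s7 (odds j) Ax Ay Az Aw Gxy Gzw dist).
split=> // all3 G [L regL isoG].
have freeJ : subgraph_free F (graph_join (complete_graph (2 * t - 1)) L).
  apply: (star_free all3 _ _ (left_part _ _)); first by rewrite card_left_part card_ord.
  move=> [w|w]; rewrite inE // => _; rewrite degin_join_right.
  exact: near_regular_le regL.
have freeG : subgraph_free F G.
  apply: contra freeJ => /contains_trans; apply; apply/containsP.
  have [f bijf isof] := isoG; exists f; split=> [|x y]; first exact: bij_inj.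
  by rewrite isof.
(* Some extremal [H] exists, and by [main] it belongs to the family, so [G] has the same value of
   e_p. *)
split=> //; have [H freeH exH] := extremal_exists p freeG.
have [_ _ famH _ _] := main H freeH exH; have [L' regL' isoH] := famH all3.
by rewrite -exH (e_iso p isoG) (e_iso p isoH); exact: (e_join_near_regular p _ regL regL').
Qed.

Theorem theorem4p6 (R : realType) (p : R) (hp : (1 < p)%R)
    (t : nat) (ht : 1 <= t) :
  (forall (s beta : 'I_t -> nat)
      (hs : forall j, 2 <= s j) (hbeta : forall j, 1 <= beta j),
    let F := disjoint_union (fun j => regular_caterpillar (s j) (beta j)) in
    tau F = \sum_(j < t) ((s j)./2 * beta j + uphalf (s j)) /\
    exists n0 : nat, forall n : nat, n0 <= n ->
      forall G : sgraph 'I_n, subgraph_free F G -> e_ p G = ex_ p n F ->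
      [/\ (forall j, beta j = 1) ->
            graph_iso G (graphL0 n (\sum_(j < t) s j - 1)),
          (exists j, 2 <= beta j /\ ~~ odd (s j)) ->
            graph_iso G (complete_bipartite (tau F - 1) (n - tau F + 1)),
          (forall j, s j <> 3 -> beta j = 1) /\
          (exists j, 2 <= beta j /\ s j = 3) ->
            graph_iso G (graph_join (max_matching (tau F - 1))
                        (empty_graph (n - tau F + 1))) &
          (forall j, ~~ odd (s j) -> beta j = 1) /\
          (exists j, [/\ 2 <= beta j, 5 <= s j & odd (s j)]) ->
            graph_iso G (graph_join (one_edge (tau F - 1))
                        (empty_graph (n - tau F + 1)))])
  /\
  (forall (s beta gamma : 'I_t -> nat)
      (hs : forall j, 2 <= s j)
      (hbeta : forall j, 1 <= beta j) (hgamma : forall j, beta j <= gamma j),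
    let F := disjoint_union
               (fun j => double_broom (s j) (beta j) (gamma j)) in
    tau F = \sum_(j < t | ~~ odd (s j)) ((s j)./2 + beta j)
            + \sum_(j < t | odd (s j)) uphalf (s j) /\
    exists n0 : nat, forall n : nat, n0 <= n ->
      (forall G : sgraph 'I_n, subgraph_free F G -> e_ p G = ex_ p n F ->
       [/\ (exists j, 2 <= beta j /\ ~~ odd (s j)) ->
             graph_iso G (complete_bipartite (tau F - 1) (n - tau F + 1)),
           (forall j, ~~ odd (s j) -> beta j = 1) /\
           (exists j, ~~ odd (s j)) ->
             graph_iso G (graphL0 n (tau F - 1)),
           (forall j, s j = 3 /\ beta j < gamma j) ->
             in_familyL n (2 * t - 1) (min_over beta) G,
           [/\ forall j, s j = 3 \/ s j = 5,
               forall j, s j = 3 -> beta j < gamma j,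
               forall j, s j = 5 -> 2 <= beta j &
               exists j, s j = 5] ->
             graph_iso G (graphL1 n (tau F - 1)) &
           (forall j, odd (s j)) /\
           (exists j, [\/ [/\ beta j = 1, gamma j = 1 & s j = 3],
                          beta j = 1 /\ s j = 5 |
                          7 <= s j]) ->
             graph_iso G (graphE n (tau F - 1))])
      /\
      ((forall j, s j = 3 /\ beta j < gamma j) ->
        forall G : sgraph 'I_n,
          in_familyL n (2 * t - 1) (min_over beta) G -> extremal p F G)).
Proof.
by split; [exact: regular_forest_extremal | exact: broom_forest_extremal].
Qed.
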